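(* For every integer $d\geq 1$, $$2\pi\, m(P_d)= \frac{-2}{d+2} \sum_{0<k<k'\leq d} \mathrm{vol}\left(\frac{2k\pi}{d+1},\frac{2(k'-k)\pi}{d+1}\right)+\frac{2}{d+1} \sum_{0<k<k'\leq d+1} \mathrm{vol}\left(\frac{2k\pi}{d+2},\frac{2(k'-k)\pi}{d+2}\right),$$ where the sums run over integers $k,k'$.
   Context: For $d\geq 1$ let $P_d(x,y)=\sum_{i,j\geq 0,\ i+j\leq d} x^i y^j\in\mathbb{C}[x,y]$. The (logarithmic) Mahler measure of $P\in\mathbb{C}[x,y]$ is $m(P)=\frac{1}{(2\pi)^2}\int_0^{2\pi}\int_0^{2\pi}\log|P(e^{i\theta_1},e^{i\theta_2})|\,d\theta_1\,d\theta_2$. The Bloch–Wigner dilogarithm is $D(z)=\operatorname{Im}(\mathrm{Li}_2(z))+\arg(1-z)\log|z|$, with $\arg\in(-\pi,\pi]$ and $\mathrm{Li}_2(z)=-\int_0^z\log(1-u)\frac{du}{u}$ (extended continuously to all of $\mathbb{C}$); on the unit circle $D(e^{i\theta})=\sum_{n\geq1}\frac{\sin(n\theta)}{n^2}$. Define $\mathrm{vol}(\theta,\alpha)=D(e^{i\theta})-D(e^{i(\theta+\alpha)})+D(e^{i\alpha})$ for $(\theta,\alpha)\in[0,2\pi]^2$. *)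

(* Defs.v *)
From HB Require Import structures.
From mathcomp Require Import all_boot all_order all_algebra.
From mathcomp Require Import complex.
From mathcomp Require Import all_classical all_reals all_analysis.

Set Implicit Arguments.
Unset Strict Implicit.
Unset Printing Implicit Defensive.

Import Order.TTheory GRing.Theory Num.Theory.
Import numFieldNormedType.Exports.

Local Open Scope classical_set_scope.
Local Open Scope ring_scope.
Local Open Scope complex_scope.

Section Complex.
Context {R : realType}.
Implicit Types (z : R[i]) (t : R).

(* The modulus as an element of R: the generic norm `|z| lives in R[i]. *)
Definition cmod z : R := ComplexField.Normc.normc z.

Definition expi t : R[i] := cos t +i* sin t.

(* Principal argument, with values in ]-pi, pi]; carg 0 = 0 by convention. *)
Definition carg z : R :=
  if z == 0 then 0
  else if 0 <= complex.Im z then acos (complex.Re z / cmod z)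
  else - acos (complex.Re z / cmod z).

Definition clog z : R[i] := ln (cmod z) +i* carg z.

Definition Cintegral (D : set R) (f : R -> R[i]) : R[i] :=
  (\int[lebesgue_measure]_(t in D) complex.Re (f t)) +i*
  (\int[lebesgue_measure]_(t in D) complex.Im (f t)).

(* Contour integral of f along the segment u = t z, 0 <= t <= 1. *)
Definition segment_integral (f : R[i] -> R[i]) z : R[i] :=
  Cintegral `[0, 1] (fun t => f (t%:C * z) * z).

Definition Li2 z : R[i] := - segment_integral (fun u => clog (1 - u) / u) z.

(* For real z > 1 the integrand of Li2 uses the boundary value arg = pi on the
   cut, so that the two terms cancel and D z = 0; with ln 0 = 0 one also gets
   D 0 = D 1 = 0.  These are the values of the continuous extension of the
   Bloch-Wigner function to the whole plane. *)
Definition BlochWigner z : R :=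
  complex.Im (Li2 z) + carg (1 - z) * ln (cmod z).

Definition vol (theta alpha : R) : R :=
  BlochWigner (expi theta) - BlochWigner (expi (theta + alpha))
  + BlochWigner (expi alpha).

(* Extended-real valued, with log 0 = -oo, so that a finite value expresses
   that the integral converges. *)
Definition mahler (P : {poly {poly R[i]}}) : \bar R :=
  (((2 * pi) ^+ 2)^-1%:E *
   \int[lebesgue_measure]_(t2 in `[0%R, (2 * pi)%R])
     \int[lebesgue_measure]_(t1 in `[0%R, (2 * pi)%R])
       lne (cmod P.[expi t1, expi t2])%:E)%E.

End Complex.

(* 'X is the variable x and 'Y (= 'X%:P) the variable y. *)
Definition Pd (R : realType) (d : nat) : {poly {poly R[i]}} :=
  \sum_(i < d.+1) \sum_(j < d.+1 | (i + j <= d)%N) 'X^i * 'Y ^+ j.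

(* Main.v *)
(** Write [n = d + 2], [g z = 1 + z + ... + z^(n-1)] and
    [h(x, z) = sum_(i + j <= d) z^i x^j], so that [(z - x) h(x, z) = g z - g x].
    By Jensen's formula the inner integral at [x = e^(ia)] is [2 pi Phi(a)], where
    [Phi(a)] is the sum of [ln |y|] over the roots [y] of [h(x, .)] outside the unit
    circle.  Along the curve [h(x, y) = 0], [|x| = 1], a combination [prim] of
    Bloch-Wigner dilogarithms is a primitive of [n (n - 1) ln |y| d(arg x)].  Its sum
    [Psi] over the outer roots therefore has derivative [n (n - 1) Phi], except where a
    root crosses the circle.  Comparing [h(x, y) = 0] with its conjugate shows that this
    happens only when [x] and [y] are both [n]-th or both [(n-1)]-th roots of unity, and
    there [prim] is [n], resp. [n - 1], times a volume.  The sign of the radial velocity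
    of the crossing roots gives the one-sided limits of [Psi], and the integral of [Phi]
    is the sum of the increments of [Psi] between consecutive crossings.

    Off the unit circle the dilogarithm is expressed through its values on the circle,
    so that only the derivative [- ln |1 - e^(it)|] of [D(e^(it))] is needed. *)

(* Why a function like [prim] exists: the differential ln |z| d arg(1 - z) - ln |1 - z| d arg z of
   the Bloch-Wigner function is the image of the symbol z /\ (1 - z), so a primitive can be found by
   algebra on symbols. As (z - 1) g z = z^n - 1, the relation h(x, y) = 0 gives (y - 1)(x^n - 1) =
   (x - 1)(y^n - 1). Hence S = (y - 1)/(y - x) and T = x^n S satisfy S - 1 = (x - 1)/(y - x) and T -
   1 = y^n (x - 1)/(y - x). Expanding, the symbol of S minus that of T, plus n times those of x and
   y/x, minus n times that of y, collapses to -n (n - 1) x /\ y, and its image is n (n - 1) ln |y| d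
   arg x where |x| = 1. Only roots with |y| >= 1 are followed. For |z| >= 1 the number h(z, z) =
   g'(z) is nonzero, so these roots are simple and g is injective near them; this takes the place of
   the implicit function theorem, and nothing is claimed about the roots inside the disc. At x = 1
   the terms of [prim] are singular, but all outer contributions cancel in the limit: [Psi] tends to
   0 at both ends of the period and no constant remains. *)
Require Import Defs.
From mathcomp Require Import all_boot all_order all_algebra.
From mathcomp Require Import complex.
From mathcomp Require Import all_classical all_reals all_analysis measurable_realfun.
From mathcomp Require Import ring lra zify.

Set Implicit Arguments.
Unset Strict Implicit.
Unset Printing Implicit Defensive.

Import Order.TTheory GRing.Theory Num.Theory.
Import numFieldNormedType.Exports.
Import ComplexField.Normc.

Local Open Scope classical_set_scope.
Local Open Scope ring_scope.
Local Open Scope complex_scope.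

Local Notation Re := (@complex.Re _).
Local Notation Im := (@complex.Im _).

Arguments cmod {R} z : simpl never.
Arguments expi {R} t : simpl never.

(** * Complex numbers: components, modulus, exponential, polar form *)

Section ComplexBasics.
Context {R : realType}.
Local Notation C := R[i].
Implicit Types (z w : C) (t : R).

Lemma ReD z w : Re (z + w) = Re z + Re w. Proof. by case: z; case: w. Qed.
Lemma ImD z w : Im (z + w) = Im z + Im w. Proof. by case: z; case: w. Qed.
Lemma ReN z : Re (- z) = - Re z. Proof. by case: z. Qed.
Lemma ImN z : Im (- z) = - Im z. Proof. by case: z. Qed.
Lemma ReM z w : Re (z * w) = Re z * Re w - Im z * Im w.
Proof. by case: z; case: w. Qed.
Lemma ImM z w : Im (z * w) = Re z * Im w + Im z * Re w.
Proof. by case: z; case: w. Qed.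
Lemma ReV z : Re z^-1 = Re z / (Re z ^+ 2 + Im z ^+ 2). Proof. by case: z. Qed.
Lemma ImV z : Im z^-1 = - Im z / (Re z ^+ 2 + Im z ^+ 2).
Proof. by case: z => a b /=; rewrite mulNr. Qed.
Lemma ReC t : Re t%:C = t. Proof. by []. Qed.
Lemma ImC t : Im t%:C = 0. Proof. by []. Qed.
Lemma Re1 : Re (1 : C) = 1. Proof. by []. Qed.
Lemma Im1 : Im (1 : C) = 0. Proof. by []. Qed.
Lemma Re_i : Re ('i : C) = 0. Proof. by []. Qed.
Lemma Im_i : Im ('i : C) = 1. Proof. by []. Qed.
Lemma Re_mk (a b : R) : Re (a +i* b) = a. Proof. by []. Qed.
Lemma Im_mk (a b : R) : Im (a +i* b) = b. Proof. by []. Qed.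
Lemma Re_conj z : Re (conjc z) = Re z. Proof. by case: z. Qed.
Lemma Im_conj z : Im (conjc z) = - Im z. Proof. by case: z. Qed.
Lemma Re_expi t : Re (expi t) = cos t. Proof. by []. Qed.
Lemma Im_expi t : Im (expi t) = sin t. Proof. by []. Qed.
Definition ReImE := (Re_i, Im_i, Re_mk, Im_mk, Re_conj, Im_conj, Re_expi, Im_expi,
  ReD, ImD, ReN, ImN, ReM, ImM, ReC, ImC, Re1, Im1).

Lemma complexP z w : Re z = Re w -> Im z = Im w -> z = w.
Proof. by case: z => a b; case: w => c e /= -> ->. Qed.

Lemma cmodE z : cmod z = Num.sqrt (Re z ^+ 2 + Im z ^+ 2).
Proof. by case: z. Qed.
Lemma cmod_sqr z : cmod z ^+ 2 = Re z ^+ 2 + Im z ^+ 2.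
Proof. by rewrite cmodE sqr_sqrtr // addr_ge0 // sqr_ge0. Qed.
Lemma cmod_ge0 z : 0 <= cmod z. Proof. by rewrite cmodE sqrtr_ge0. Qed.
Lemma cmod0 : cmod (0 : C) = 0. Proof. exact: normc0. Qed.
Lemma cmod1 : cmod (1 : C) = 1. Proof. exact: normc1. Qed.
Lemma cmod_eq0 z : (cmod z == 0) = (z == 0).
Proof. by apply/eqP/eqP => [/eq0_normc //|->]; exact: normc0. Qed.
Lemma cmod_gt0 z : (0 < cmod z) = (z != 0).
Proof. by rewrite lt_neqAle cmod_ge0 andbT eq_sym cmod_eq0. Qed.
Lemma cmodM z w : cmod (z * w) = cmod z * cmod w. Proof. exact: normcM. Qed.
Lemma cmodV z : cmod z^-1 = (cmod z)^-1. Proof. exact: normcV. Qed.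
Lemma cmodN z : cmod (- z) = cmod z. Proof. exact: (@normcN _ z). Qed.
Lemma cmodB z w : cmod (z - w) = cmod (w - z).
Proof. by rewrite -opprB cmodN. Qed.
Lemma cmodD z w : cmod (z + w) <= cmod z + cmod w. Proof. exact: le_normcD. Qed.
Lemma cmodX z n : cmod (z ^+ n) = cmod z ^+ n.
Proof. by elim: n => [|n IH]; rewrite ?expr0 ?cmod1 // !exprS cmodM IH. Qed.
Lemma cmodC t : cmod t%:C = `|t|.
Proof. by rewrite cmodE /= expr0n addr0 sqrtr_sqr. Qed.
Lemma cmod_conj z : cmod (conjc z) = cmod z.
Proof. by case: z => a b; rewrite !cmodE /= sqrrN. Qed.
Lemma cmod_prod I (s : seq I) (f : I -> C) :
  cmod (\prod_(i <- s) f i) = \prod_(i <- s) cmod (f i).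
Proof. by elim/big_rec2: _ => [|i y1 y2 _ <-]; rewrite ?cmod1 // cmodM. Qed.
Lemma Re_le_cmod z : `|Re z| <= cmod z.
Proof. by rewrite cmodE -sqrtr_sqr ler_wsqrtr // lerDl sqr_ge0. Qed.
Lemma Im_le_cmod z : `|Im z| <= cmod z.
Proof. by rewrite cmodE -sqrtr_sqr ler_wsqrtr // lerDr sqr_ge0. Qed.
Lemma conjcM_cmod z : z * (conjc z) = (cmod z ^+ 2)%:C.
Proof. by rewrite cmod_sqr; case: z => a b; apply: complexP => /=; ring. Qed.
Lemma conjc_mul z w : (conjc (z * w)) = (conjc z) * (conjc w). Proof. exact: (rmorphM (@conjc R)). Qed.
Lemma conjc_sub z w : (conjc (z - w)) = (conjc z) - (conjc w). Proof. exact: (rmorphB (@conjc R)). Qed.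
Lemma conjc_C t : (conjc (t%:C)) = t%:C. Proof. exact: conjc_real. Qed.
Lemma cmod1_conj z : cmod z = 1 -> (conjc z) = z^-1.
Proof.
move=> z1; have z0 : z != 0 by rewrite -cmod_gt0 z1.
by apply: (mulfI z0); rewrite conjcM_cmod z1 expr1n divff.
Qed.
Lemma cmod1_neq0 z : cmod z = 1 -> z != 0.
Proof. by move=> z1; rewrite -cmod_gt0 z1. Qed.

Lemma expi0 : expi 0 = 1 :> C. Proof. by rewrite /expi cos0 sin0. Qed.
Lemma expiD t s : expi (t + s) = expi t * expi s :> C.
Proof. by rewrite /expi cosD sinD; apply: complexP => //=; ring. Qed.
Lemma cmod_expi t : cmod (expi t) = 1.
Proof. by rewrite cmodE /= cos2Dsin2 sqrtr1. Qed.
Lemma expi_neq0 t : expi t != 0 :> C. Proof. exact/cmod1_neq0/cmod_expi. Qed.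
Lemma conj_expi t : (conjc (expi t)) = expi (- t) :> C.
Proof. by rewrite /expi cosN sinN. Qed.
Lemma expiN t : expi (- t) = (expi t)^-1 :> C.
Proof. by rewrite -conj_expi cmod1_conj // cmod_expi. Qed.
Lemma expiB t s : expi (t - s) = expi t / expi s :> C.
Proof. by rewrite expiD expiN. Qed.
Lemma expiX t n : expi t ^+ n = expi (n%:R * t) :> C.
Proof.
elim: n => [|n IH]; first by rewrite mul0r expi0.
by rewrite exprS IH -expiD; congr expi; rewrite -[n.+1]add1n natrD; ring.
Qed.
Lemma expipi : expi pi = -1 :> C.
Proof. by rewrite /expi cospi sinpi; apply: complexP => //=; rewrite oppr0. Qed.
Lemma expi2pi : expi (2 * pi) = 1 :> C.
Proof. by rewrite mulr_natl mulr2n expiD expipi mulN1r opprK. Qed.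
Lemma expi_period t : expi (t + 2 * pi) = expi t :> C.
Proof. by rewrite expiD expi2pi mulr1. Qed.

(** Pulling out the half angle makes the modulus and the argument of a chord explicit; both
    [dilog_expi] and the velocity signs in [Re_rot] rest on this. *)
Lemma expi_sub1 t : expi t - 1 = (2 * sin (t / 2))%:C * 'i * expi (t / 2) :> C.
Proof.
have e : t = t / 2 *+ 2 by rewrite -mulr_natr divfK.
rewrite {1}/expi {1 2}e sin_mulr2n cos_mulr2n.
apply: complexP; rewrite !ReImE; last by ring.
by rewrite cos2sin2; ring.
Qed.

Lemma expi_eq1 t : 0 < t < 2 * pi -> expi t != 1 :> C.
Proof.
move=> /andP[t0 t2]; rewrite -subr_eq0 expi_sub1 !mulf_neq0 ?expi_neq0 //.
  have : 0 < sin (t / 2) by rewrite sin_gt0_pi //; lra.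
  by move=> s; rewrite eq_complex /= eqxx andbT; nra.
by rewrite eq_complex /= oner_eq0 andbF.
Qed.

Lemma polar z : z != 0 -> z = (cmod z)%:C * expi (carg z).
Proof.
move=> z0; have m0 : 0 < cmod z by rewrite cmod_gt0.
have c1 : -1 <= Re z / cmod z <= 1.
  have := Re_le_cmod z; rewrite ler_norml => /andP[h1 h2].
  by rewrite ler_pdivlMr // ler_pdivrMr // mul1r mulN1r h1 h2.
have s : Num.sqrt (1 - (Re z / cmod z) ^+ 2) = `|Im z| / cmod z.
  have -> : 1 - (Re z / cmod z) ^+ 2 = (Im z / cmod z) ^+ 2.
    have m2 : cmod z ^+ 2 != 0 by rewrite expf_neq0 // gt_eqF.
    rewrite !expr_div_n -[X in X - _](divff m2) -mulrBl; congr (_ / _).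
    by rewrite cmod_sqr addrC addKr.
  by rewrite sqrtr_sqr normrM [ `|(cmod z)^-1|]ger0_norm // invr_ge0 cmod_ge0.
rewrite /carg (negbTE z0); apply: complexP; rewrite !ReImE /=.
  case: ifP => _; rewrite ?cosN acosK ?in_itv //= mul0r subr0 mulrC divfK //;
    by rewrite gt_eqF.
case: ifP => [h|/negbT]; rewrite ?sinN ?sin_acos // s mul0r addr0.
  by rewrite ger0_norm // mulrC divfK // gt_eqF.
rewrite -ltNge => h; rewrite ltr0_norm // mulNr opprK mulrC divfK // gt_eqF //.
Qed.

Lemma unit_polar z : cmod z = 1 -> z = expi (carg z).
Proof.
by move=> z1; rewrite {1}(polar (cmod1_neq0 z1)) z1 mul1r.
Qed.

End ComplexBasics.

(** * Limits of complex-valued functions *)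

Section ComplexLimits.
Context {R : realType}.
Local Notation C := R[i].

(* Componentwise, because [R[i]] is a normed space over itself only and the curves
   below are parametrised by [R]. *)
Definition ccvg {T : Type} (F : set_system T) (f : T -> C) (l : C) :=
  (Re (f t) @[t --> F] --> Re l) /\ (Im (f t) @[t --> F] --> Im l).

Context {T : Type} {F : set_system T} {FF : Filter F}.
Implicit Types (f g : T -> C).

Lemma ccvg_cst (l : C) : ccvg F (fun=> l) l.
Proof. by split; exact: cvg_cst. Qed.

Lemma ccvgD f g l m : ccvg F f l -> ccvg F g m -> ccvg F (fun t => f t + g t) (l + m).
Proof.
move=> [f1 f2] [g1 g2]; split.
  by under eq_fun do rewrite ReD; rewrite ReD; exact: cvgD.
by under eq_fun do rewrite ImD; rewrite ImD; exact: cvgD.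
Qed.

Lemma ccvgN f l : ccvg F f l -> ccvg F (fun t => - f t) (- l).
Proof.
move=> [f1 f2]; split.
  by under eq_fun do rewrite ReN; rewrite ReN; exact: cvgN.
by under eq_fun do rewrite ImN; rewrite ImN; exact: cvgN.
Qed.

Lemma ccvgB f g l m : ccvg F f l -> ccvg F g m -> ccvg F (fun t => f t - g t) (l - m).
Proof. by move=> hf hg; apply: ccvgD => //; apply: ccvgN. Qed.

Lemma ccvgM f g l m : ccvg F f l -> ccvg F g m -> ccvg F (fun t => f t * g t) (l * m).
Proof.
move=> [f1 f2] [g1 g2]; split.
  by under eq_fun do rewrite ReM; rewrite ReM; apply: cvgB; apply: cvgM.
by under eq_fun do rewrite ImM; rewrite ImM; apply: cvgD; apply: cvgM.
Qed.

Lemma ccvgV f l : l != 0 -> ccvg F f l -> ccvg F (fun t => (f t)^-1) l^-1.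
Proof.
move=> l0 [f1 f2].
have n0 : Re l ^+ 2 + Im l ^+ 2 != 0 by rewrite -cmod_sqr expf_neq0 // cmod_eq0.
have h : (Re (f t) ^+ 2 + Im (f t) ^+ 2)^-1 @[t --> F] --> (Re l ^+ 2 + Im l ^+ 2)^-1.
  by apply: cvgV => //; apply: cvgD; apply: cvgM.
split.
  by under eq_fun do rewrite ReV; rewrite ReV; exact: cvgM.
under eq_fun do rewrite ImV; rewrite ImV; apply: cvgM => //; exact: cvgN.
Qed.

Lemma ccvg_div f g l m : m != 0 -> ccvg F f l -> ccvg F g m ->
  ccvg F (fun t => f t / g t) (l / m).
Proof. by move=> m0 hf hg; apply: ccvgM => //; apply: ccvgV. Qed.

Lemma ccvgX f l n : ccvg F f l -> ccvg F (fun t => f t ^+ n) (l ^+ n).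
Proof.
move=> h; elim: n => [|n IH]; first exact: ccvg_cst.
by under [X in ccvg _ X]eq_fun do rewrite exprS; rewrite exprS; exact: ccvgM.
Qed.

Lemma ccvg_sum I (s : seq I) (P : pred I) (f : I -> T -> C) (l : I -> C) :
  (forall i, P i -> ccvg F (f i) (l i)) ->
  ccvg F (fun t => \sum_(i <- s | P i) f i t) (\sum_(i <- s | P i) l i).
Proof.
move=> h; elim: s => [|i s IH].
  by under [X in ccvg _ X]eq_fun do rewrite big_nil; rewrite big_nil; exact: ccvg_cst.
under [X in ccvg _ X]eq_fun do rewrite big_cons; rewrite big_cons.
case: ifP => // Pi; apply: ccvgD => //; exact: h.
Qed.

Lemma ccvg_cmod f l : ccvg F f l -> cmod (f t) @[t --> F] --> cmod l.
Proof.
move=> [f1 f2]; under eq_fun do rewrite cmodE; rewrite cmodE.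
apply: (@cvg_comp _ _ _ (fun t => Re (f t) ^+ 2 + Im (f t) ^+ 2) Num.sqrt); last exact: sqrt_continuous.
by apply: cvgD; apply: cvgM.
Qed.

Lemma ccvg0 f l : cmod (f t - l) @[t --> F] --> (0 : R) -> ccvg F f l.
Proof.
move=> h; split.
  apply/subr_cvg0; apply: (@norm_cvg0 _ _ _ _ _ _).
  apply: (@squeeze_cvgr _ F _ _ (fun=> 0) (fun t => cmod (f t - l))) => //; last exact: cvg_cst.
  apply: nearW => t; rewrite normr_ge0 /=.
  by rewrite (le_trans _ (Re_le_cmod _)) // ReD ReN.
apply/subr_cvg0; apply: (@norm_cvg0 _ _ _ _ _ _).
apply: (@squeeze_cvgr _ F _ _ (fun=> 0) (fun t => cmod (f t - l))) => //; last exact: cvg_cst.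
apply: nearW => t; rewrite normr_ge0 /=.
by rewrite (le_trans _ (Im_le_cmod _)) // ImD ImN.
Qed.

Lemma ccvgP f l : ccvg F f l -> cmod (f t - l) @[t --> F] --> (0 : R).
Proof.
by move=> h; have := ccvg_cmod (ccvgB h (ccvg_cst l)); rewrite subrr cmod0.
Qed.

Lemma ccvg_near f l e : 0 < e -> ccvg F f l -> \forall t \near F, cmod (f t - l) < e.
Proof.
move=> e0 /ccvgP /cvgr0Pnorm_lt /(_ e e0); apply: filterS => t.
by rewrite ger0_norm // cmod_ge0.
Qed.

Lemma ccvg_near_neq0 f l : l != 0 -> ccvg F f l -> \forall t \near F, f t != 0.
Proof.
move=> l0 /(@ccvg_near _ _ (cmod l)); rewrite cmod_gt0 => /(_ l0).
by apply: filterS => t; apply: contraTneq => ->; rewrite sub0r cmodN ltxx.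
Qed.

Lemma ccvg_real (f : T -> R) (l : R) : f t @[t --> F] --> l -> ccvg F (fun t => (f t)%:C) l%:C.
Proof. by move=> h; split => //=; exact: cvg_cst. Qed.

Lemma ccvg_expi (f : T -> R) (l : R) : f t @[t --> F] --> l -> ccvg F (fun t => expi (f t)) (expi l).
Proof.
move=> h; split => /=.
  by apply: continuous_cvg => //; exact: continuous_cos.
by apply: continuous_cvg => //; exact: continuous_sin.
Qed.

End ComplexLimits.

(** * Differentiation rules and consequences of the mean value theorem *)

Section RealDerivatives.
Context {R : realType}.
Implicit Types (f g : R -> R) (x a b : R).

Lemma is_derive1D f g x a b : is_derive x 1 f a -> is_derive x 1 g b ->
  is_derive x 1 (fun t => f t + g t) (a + b).
Proof. by move=> hf hg; exact: (is_deriveD hf hg). Qed.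

Lemma is_derive1N f x a : is_derive x 1 f a -> is_derive x 1 (fun t => - f t) (- a).
Proof. by move=> hf; exact: (is_deriveN hf). Qed.

Lemma is_derive1B f g x a b : is_derive x 1 f a -> is_derive x 1 g b ->
  is_derive x 1 (fun t => f t - g t) (a - b).
Proof. by move=> hf hg; exact: (is_deriveB hf hg). Qed.

Lemma is_derive1M f g x a b : is_derive x 1 f a -> is_derive x 1 g b ->
  is_derive x 1 (fun t => f t * g t) (f x * b + g x * a).
Proof. by move=> hf hg; exact: (is_deriveM hf hg). Qed.

Lemma is_derive1c x b : is_derive x 1 (fun=> b) 0.
Proof. exact: is_derive_cst. Qed.

Lemma is_derive1id x : is_derive x 1 (fun t => t) 1.
Proof. exact: is_derive_id. Qed.

Lemma is_derive1_cvg f x a : is_derive x 1 f a -> {for x, continuous f}.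
Proof.
move=> h; apply: differentiable_continuous; apply/derivable1_diffP.
exact: ex_derive.
Qed.

Lemma cst_of_derive0 f a b : a <= b -> {within `[a, b], continuous f} ->
  (forall x, a < x < b -> is_derive x 1 f 0) -> f b = f a.
Proof.
rewrite le_eqVlt => /predU1P[->//|ab] cf df.
have dx x : x \in `]a, b[ -> is_derive x 1 f ((fun=> 0) x) by rewrite in_itv /=; exact: df.
have [c _] := MVT ab dx cf.
by rewrite mul0r => /eqP; rewrite subr_eq0 => /eqP.
Qed.

Lemma atan_le x : `|atan x| <= `|x|.
Proof.
wlog x0 : x / 0 <= x => [hw|].
  have [/hw//|/ltW x0] := leP 0 x.
  by have := hw (- x); rewrite atanN !normrN; apply; rewrite oppr_ge0.
move: x0; rewrite le_eqVlt => /predU1P[<-|x0]; first by rewrite atan0.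
have dx (y : R) : y \in `]0, x[ -> is_derive y 1 atan ((fun y => (1 + y ^+ 2)^-1) y).
  by move=> _; exact: is_derive1_atan.
have ca : {within `[0, x], continuous (@atan R)}.
  by apply: continuous_subspaceT => y; exact: continuous_atan.
have [c c0] := MVT x0 dx ca.
rewrite atan0 !subr0 => ->; rewrite normrM ler_piMl // ger0_norm ?invr_ge0.
  by rewrite invf_le1 ?lerDl ?sqr_ge0 // ltr_pwDl // sqr_ge0.
by rewrite addr_ge0 // sqr_ge0.
Qed.

End RealDerivatives.

(** * The Clausen function: continuity, derivative, duplication formula *)

Section Clausen.
Context {R : realType}.
Implicit Types (t s : R).
Local Notation mu := (@lebesgue_measure R).

(** On the right half-plane the case split of [carg] disappears and a smooth formula remains. *)
Lemma carg_Re_gt0 (z : R[i]) : 0 < Re z -> carg z = atan (Im z / Re z).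
Proof.
move=> r0; have z0 : z != 0 by apply: contraTneq r0 => ->; rewrite ltxx.
have m0 : 0 < cmod z by rewrite cmod_gt0.
have pz := polar z0.
have cz : cos (carg z) = Re z / cmod z.
  by rewrite {2}pz !ReImE mul0r subr0 mulrC mulKf // gt_eqF.
have sz : sin (carg z) = Im z / cmod z.
  by rewrite {2}pz !ReImE mul0r addr0 mulrC mulKf // gt_eqF.
have tz : tan (carg z) = Im z / Re z.
  by rewrite /tan cz sz invf_div mulrA divfK // gt_eqF.
rewrite -tz tanK // in_itv /=.
have c1 : -1 <= Re z / cmod z <= 1.
  by rewrite -cz cos_geN1 cos_le1.
have c0 : 0 < Re z / cmod z by rewrite divr_gt0.
have h1 : acos (Re z / cmod z) < pi / 2.
  rewrite -ltr_cos ?in_itv /=; first by rewrite cos_pihalf acosK.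
    by rewrite acos_ge0 // acos_lepi.
  by have := @pi_gt0 R; lra.
have h2 := acos_ge0 c1; have := @pi_gt0 R.
rewrite /carg (negbTE z0); case: ifP => _; lra.
Qed.

(** Equals - arg(1 - s e^(it)) / s, up to sign the imaginary part of the integrand of [Li2] along
    the radius; [atan] suffices because 1 - s cos t > 0 for 0 < s < 1. *)
Definition claus_kernel t s := atan (s * sin t / (1 - s * cos t)) / s.

(** The Clausen function of order two. *)
Definition claus t := BlochWigner (expi t).

Lemma one_sub_scos_gt0 t s : 0 < s < 1 -> 0 < 1 - s * cos t.
Proof.
move=> /andP[s0 s1]; have := cos_le1 t; rewrite -(ler_pM2l s0); nra.
Qed.

(** A bound independent of t is what dominated convergence needs. For s <= 1/2 the inequality |atan
    u| <= |u| absorbs the factor 1/s; for s > 1/2 both |atan| < 2 and 1/s < 2. *)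
Lemma claus_kernel_bound t s : 0 < s < 1 -> `|claus_kernel t s| <= 4.
Proof.
move=> s01; have d0 := one_sub_scos_gt0 t s01; move/andP: s01 => [s0 s1].
rewrite /claus_kernel normrM (gtr0_norm (_ : 0 < s^-1)) ?invr_gt0 //.
rewrite ler_pdivrMr //.
have [h|h] := leP s (1 / 2).
  rewrite (le_trans (atan_le _)) // normrM normfV (gtr0_norm d0) ler_pdivrMr //.
  rewrite normrM (gtr0_norm s0).
  have := sin_max t; have := cos_le1 t; have := normr_ge0 (sin t) => a1 a2 a3.
  have : s * cos t <= 1 / 2 by nra.
  nra.
rewrite ler_norml; have := atan_gtNpi2 (s * sin t / (1 - s * cos t)).
have := atan_ltpi2 (s * sin t / (1 - s * cos t)); have := @pihalf_lt2 R.
lra.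
Qed.

Lemma claus_kernel_continuous t : {in `]0, 1[, continuous (claus_kernel t)}.
Proof.
move=> s; rewrite in_itv /= => s01; have d0 := one_sub_scos_gt0 t s01.
apply: cvgM; last by apply: cvgV => //; rewrite gt_eqF //; case/andP: s01.
apply: continuous_cvg; first exact: continuous_atan.
apply: cvgM; first by apply: cvgM => //; exact: cvg_cst.
apply: cvgV; first by rewrite gt_eqF.
by apply: cvgB; [exact: cvg_cst|apply: cvgM => //; exact: cvg_cst].
Qed.

Lemma claus_kernel_measurable t : measurable_fun (`]0%R, 1%R[%classic : set R) (claus_kernel t).
Proof.
apply: open_continuous_measurable_fun => //.
by move=> x /set_mem; exact: claus_kernel_continuous.
Qed.

Lemma claus_kernel_integrable t : mu.-integrable `]0, 1[ (EFin \o claus_kernel t).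
Proof.
apply: measurable_bounded_integrable => //.
- by rewrite /= lebesgue_measure_itv /= lte_fin ltr01 oppr0 adde0 ltry.
- exact: claus_kernel_measurable.
exists 4; split; first exact: num_real.
move=> x x4 y /= y01; rewrite (le_trans (claus_kernel_bound t _)) ?ltW //.
Qed.

(** On the unit circle the logarithmic term of [BlochWigner] vanishes and only Im Li2 is left. The
    endpoints, where the integrand may be degenerate, form a null set and are dropped. *)
Lemma clausE t : claus t = \int[mu]_(s in `]0, 1[) claus_kernel t s.
Proof.
rewrite /claus /BlochWigner cmod_expi ln1 mulr0 addr0 /Li2 ImN /segment_integral /Cintegral Im_mk.
set f := fun s : R => complex.Im (clog (1 - s%:C * expi t) / (s%:C * expi t) * expi t).
have h : {in `]0%R, 1%R[%classic, f =1 (fun s => - claus_kernel t s)}.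
  move=> s /set_mem /=; rewrite in_itv /= => s01.
  have p0 := one_sub_scos_gt0 t s01; move/andP: (s01) => [s0 s1]; rewrite /f.
  have -> : clog (1 - s%:C * expi t) / (s%:C * expi t) * expi t =
    clog (1 - s%:C * expi t) * (s^-1)%:C.
    rewrite invfM mulrA divfK ?expi_neq0 //; congr (_ * _).
    by rewrite -fmorphV.
  rewrite !ReImE mulr0 add0r carg_Re_gt0.
    have -> : Im (1 - s%:C * expi t) = - (s * sin t) by rewrite !ReImE; ring.
    have -> : Re (1 - s%:C * expi t) = 1 - s * cos t by rewrite !ReImE; ring.
    by rewrite mulNr atanN mulNr.
  by rewrite !ReImE mul0r subr0.
have mf : measurable_fun (`]0%R, 1%R[%classic : set R) f.
  apply: (eq_measurable_fun (fun s => - claus_kernel t s)).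
    by move=> s /h ->.
  apply: measurableT_comp => //.
  exact: claus_kernel_measurable.
have -> : \int[mu]_(s in `[0, 1]) f s = \int[mu]_(s in `]0, 1[) f s.
  rewrite /Rintegral -integral_itv_bndo_bndc; last first.
    by apply/measurable_EFinP/measurable_fun_itv_obnd_cbndP.
  by rewrite -integral_itv_obnd_cbnd //; exact/measurable_EFinP.
have -> : \int[mu]_(s in `]0, 1[) f s = \int[mu]_(s in `]0, 1[) (-1 * claus_kernel t s).
  by apply: eq_Rintegral => s sI; rewrite mulN1r h.
by rewrite RintegralZl ?mulN1r ?opprK //; exact: claus_kernel_integrable.
Qed.

Lemma claus_continuous : continuous claus.
Proof.
move=> t.
have -> : claus = fun t => \int[mu]_(s in `]0, 1[) claus_kernel t s.
  by apply/funext => u; exact: clausE.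
apply: (@continuity_under_integral R _ _ mu claus_kernel `]0, 1[ _ (t - 1) (t + 1) _ _ (fun=> 4)).
- by [].
- by move=> x _; exact: claus_kernel_integrable.
- apply: aeW => s /= s01 u _; move: s01; rewrite in_itv /= => s01.
  have p0 := one_sub_scos_gt0 u s01.
  apply: cvgM; last exact: cvg_cst.
  apply: continuous_cvg; first exact: continuous_atan.
  apply: cvgM; first by apply: cvgM; [exact: cvg_cst|exact: continuous_sin].
  apply: cvgV; first by rewrite gt_eqF.
  by apply: cvgB; [exact: cvg_cst|apply: cvgM; [exact: cvg_cst|exact: continuous_cos]].
- apply: measurable_bounded_integrable => //.
    by rewrite /= lebesgue_measure_itv /= lte_fin ltr01 oppr0 adde0 ltry.
  by exists 4; split => // x x4 y _ /=; rewrite ger0_norm ?ltW.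
- move=> x _; apply: aeW => s /=; rewrite in_itv /= => s01; exact: claus_kernel_bound.
by rewrite inE /= in_itv /=; apply/andP; split; lra.
Qed.

Lemma clausN t : claus (- t) = - claus t.
Proof.
rewrite !clausE.
have -> : \int[mu]_(s in `]0, 1[) claus_kernel (- t) s = \int[mu]_(s in `]0, 1[) (-1 * claus_kernel t s).
  apply: eq_Rintegral => s _; rewrite mulN1r /claus_kernel sinN cosN mulrN mulNr atanN.
  by rewrite mulNr.
by rewrite RintegralZl ?mulN1r //; exact: claus_kernel_integrable.
Qed.

Lemma claus_sin0 t : sin t = 0 -> claus t = 0.
Proof.
move=> st; rewrite clausE; under eq_Rintegral do rewrite /claus_kernel st mulr0 mul0r atan0 mul0r.
by rewrite Rintegral_cst //= mul0r.
Qed.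

Lemma claus_period t : claus (t + 2 * pi) = claus t.
Proof. by rewrite /claus expi_period. Qed.

(** The denominator is |1 - s e^(it)|^2. *)
Lemma claus_kernel_derive t s : 0 < s < 1 ->
  is_derive t 1 (claus_kernel^~ s) ((cos t - s) / (1 - 2 * s * cos t + s ^+ 2)).
Proof.
move=> s01; have p0 := one_sub_scos_gt0 t s01; case/andP: (s01) => s0 s1.
have p0' : 1 - s * cos t != 0 by rewrite gt_eqF.
have s0' : s != 0 by rewrite gt_eqF.
have e : 1 - 2 * s * cos t + s ^+ 2 = (1 - s * cos t) ^+ 2 + (s * sin t) ^+ 2.
  by have := cos2Dsin2 t; nra.
have q0 : (1 - s * cos t) ^+ 2 + (s * sin t) ^+ 2 != 0.
  by rewrite gt_eqF // ltr_pwDl ?sqr_ge0 // exprn_gt0.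
apply: is_derive_eq; rewrite /GRing.scale /=.
rewrite e; have := cos2Dsin2 t => cs.
have -> : cos t - s = cos t - s * (cos t ^+ 2 + sin t ^+ 2) by rewrite cs mulr1.
field.
by rewrite q0 p0' s0'.
Qed.

Lemma cmod_1sub_expi t : cmod (1 - expi t) ^+ 2 = 2 - 2 * cos t.
Proof. by rewrite cmod_sqr !ReImE; have := cos2Dsin2 t; nra. Qed.

(** In s, the integrand is minus half the logarithmic derivative of q(s) = |1 - s e^(it)|^2, and cos
    t != 1 keeps q positive up to s = 1. *)
Lemma claus_derivative_integral t : cos t != 1 ->
  \int[mu]_(s in `]0, 1[) ((cos t - s) / (1 - 2 * s * cos t + s ^+ 2)) = - ln (cmod (1 - expi t)).
Proof.
move=> ct1; have c1 : cos t < 1 by rewrite lt_neqAle ct1 cos_le1.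
have cN1 := cos_geN1 t.
pose q s := 1 - 2 * s * cos t + s ^+ 2.
have q0 s : 0 <= s <= 1 -> 0 < q s.
  move=> /andP[s0]; have -> : q s = (1 - s) ^+ 2 + 2 * (s * (1 - cos t)) by rewrite /q; ring.
  rewrite le_eqVlt => /predU1P[->|s1]; first by rewrite subrr expr0n add0r mul1r; lra.
  by rewrite ltr_pwDl ?exprn_gt0 ?subr_gt0 // mulr_ge0 // mulr_ge0 // subr_ge0 ltW.
have cq : continuous q.
  move=> s; apply: cvgD; last exact: exprn_continuous.
  apply: cvgB; first exact: cvg_cst.
  by apply: cvgM; [apply: cvgM; [exact: cvg_cst|exact: cvg_id]|exact: cvg_cst].
have cont : {within `[0, 1], continuous (fun s => (cos t - s) / q s)}.
  apply: continuous_in_subspaceT => s; rewrite inE /= in_itv /= => s01.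
  apply: cvgM; first by apply: cvgB; [exact: cvg_cst|exact: cvg_id].
  by apply: cvgV; [rewrite gt_eqF // q0|exact: cq].
have int01 : mu.-integrable `[0, 1] (EFin \o (fun s => (cos t - s) / q s)).
  by apply: continuous_compact_integrable => //; exact: segment_compact.
rewrite Rintegral_itv_obnd_cbnd; last first.
  by apply: integrableS int01 => //; apply: subset_itv; rewrite bnd_simp.
rewrite Rintegral_itv_bndo_bndc; last first.
  by apply: integrableS int01 => //; apply: subset_itv; rewrite bnd_simp.
have dF s : 0 <= s <= 1 -> is_derive s 1 (fun s => - (2^-1 * ln (q s))) ((cos t - s) / q s).
  move=> s01; have := q0 s s01 => qs; have qs' : q s != 0 by rewrite gt_eqF.
  have hq : is_derive s 1 q (- 2 * cos t + 2 * s).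
    by apply: is_derive_eq; rewrite /GRing.scale /=; ring.
  have hl := is_derive1_comp (is_derive1_ln qs) hq.
  apply: (is_derive_eq (is_derive1N (is_derive1M (is_derive1c s 2^-1) hl))).
  by field.
rewrite /Rintegral (@continuous_FTC2 _ _ (fun s => - (2^-1 * ln (q s)))) //=.
- rewrite /q !expr0n mulr0 mul0r subr0 addr0 ln1 mulr0 oppr0 subr0 expr1n.
  have cm0 : 0 < cmod (1 - expi t).
    by rewrite cmod_gt0 subr_eq0; apply: contra ct1 => /eqP e; rewrite -(Re_expi t) -e.
  have -> : 1 - 2 * 1 * cos t + 1 = cmod (1 - expi t) ^+ 2 by rewrite cmod_1sub_expi; ring.
  by rewrite expr2 lnM ?posrE //; field.
- split.
  + by move=> s; rewrite in_itv /= => /andP[s0 s1]; have [|//] := dF s; rewrite !ltW.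
  + apply: cvg_at_right_filter; apply: (is_derive1_cvg (dF 0 _)); lra.
  + apply: cvg_at_left_filter; apply: (is_derive1_cvg (dF 1 _)); lra.
- move=> s; rewrite in_itv /= => /andP[s0 s1]; rewrite derive1E; have [|_ ->//] := dF s; by rewrite !ltW.
Qed.

(** Differentiation under the integral sign, with a domination valid near any t at which e^(it) !=
    1. *)
Lemma claus_derive t : cos t != 1 -> is_derive t 1 claus (- ln (cmod (1 - expi t))).
Proof.
move=> ct1; have c1 : cos t < 1 by rewrite lt_neqAle ct1 cos_le1.
pose c0 := (1 - cos t) / 2; have c00 : 0 < c0 by rewrite /c0; lra.
have [e e0 he] : nbhs t [set u | cos u < 1 - c0].
  have /(_ t) := @continuous_cos R; move/cvgr_lt => /(_ (1 - c0)); apply; rewrite /c0; lra.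
(* The denominator is (1 - s)^2 + 2 s (1 - cos u): at least 1/4 when s <= 1/2, at least c0 when s >=
   1/2. *)
rewrite /= in e0; pose m := Num.min (1 / 4) c0; have m0 : 0 < m by rewrite lt_min c00; lra.
have mq u s : t - e < u < t + e -> 0 < s < 1 -> m <= 1 - 2 * s * cos u + s ^+ 2.
  move=> ue /andP[s0 s1]; have : cos u < 1 - c0.
    by apply: he; rewrite /ball_ /= ltr_norml; move: ue; lra.
  have : m <= 1 / 4 by rewrite ge_min lexx.
  have : m <= c0 by rewrite ge_min lexx orbT.
  by have [|] := leP (1 / 2) s; nra.
have -> : claus = fun t => \int[mu]_(s in `]0, 1[) claus_kernel t s.
  by apply/funext => u; exact: clausE.
have dk u s : `]t - e, t + e[%classic u -> `]0%R, 1%R[%classic s ->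
    is_derive u 1 (claus_kernel^~ s) ((cos u - s) / (1 - 2 * s * cos u + s ^+ 2)).
  by move=> _ /=; rewrite in_itv /=; exact: claus_kernel_derive.
have int_c (k : R) : mu.-integrable `]0, 1[ (EFin \o (fun=> k)).
  apply: measurable_bounded_integrable => //.
    by rewrite /= lebesgue_measure_itv /= lte_fin ltr01 oppr0 adde0 ltry.
  by exists `|k|; split => // x xk y _ /=; rewrite ltW.
have tI : `]t - e, t + e[%classic t by rewrite /= in_itv /=; apply/andP; split; lra.
have a1 x : `]t - e, t + e[%classic x -> mu.-integrable `]0, 1[ (EFin \o claus_kernel x).
  by move=> _; exact: claus_kernel_integrable.
have a2 x y : `]t - e, t + e[%classic x -> `]0%R, 1%R[%classic y -> derivable (claus_kernel^~ y) x 1.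
  by move=> xI yI; have [] := dk x y xI yI.
have le2 (c y : R) : -1 <= c <= 1 -> 0 < y < 1 -> `|c - y| <= 2.
  by move=> h1 h2; rewrite ler_norml; lra.
have a3 (y : R) : 0 <= 2 / m by rewrite divr_ge0 // ltW.
have a4 x y : `]t - e, t + e[%classic x -> `]0%R, 1%R[%classic y -> `|partial1of2 claus_kernel x y| <= 2 / m.
  move=> xI yI; rewrite partial1of2E; have [_ ->] := dk x y xI yI.
  move: xI yI; rewrite /= !in_itv /= => xI yI; have mx := mq x y xI yI.
  have q0 := lt_le_trans m0 mx.
  rewrite normrM normfV (gtr0_norm q0); apply: ler_pM => //; first by rewrite invr_ge0 ltW.
    by apply: le2 => //; rewrite cos_geN1 cos_le1.
  by rewrite lef_pV2 ?posrE.
have a5 := int_c (2 / m).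
have m01 : measurable (`]0%R, 1%R[%classic : set R) by [].
have D1 := @differentiation_under_integral R _ _ mu claus_kernel _ m01 t _ _ tI a1 a2 _ a3 a5 a4.
have D2 := @derivable_under_integral R _ _ mu claus_kernel _ m01 t _ _ tI a1 a2 _ a3 a5 a4.
apply: DeriveDef; first exact: D2.
rewrite -derive1E D1 -claus_derivative_integral //; apply: eq_Rintegral => s /set_mem sI.
by rewrite partial1of2E; have [_ ->] := dk t s tI sI.
Qed.

Lemma cos_neq1 t : expi t != 1 :> R[i] -> cos t != 1.
Proof.
apply: contra => /eqP ct; apply/eqP; rewrite /expi ct; apply: complexP => //=.
by apply: cos1sin0; rewrite ct normr1.
Qed.

(** The difference of the two sides has derivative zero because 1 - e^(2it) = (1 - e^(it)) (1 -
    e^(i(t + pi))), and it vanishes at t = 0. *)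
Lemma claus_dup t : 0 <= t <= 2 * pi -> claus (2 * t) = 2 * claus t + 2 * claus (t + pi).
Proof.
pose g t := claus (2 * t) - 2 * claus t - 2 * claus (t + pi).
have cg : continuous g.
  move=> u; apply: cvgB; first apply: cvgB.
  - by apply: continuous_cvg; [exact: claus_continuous|apply: cvgM; [exact: cvg_cst|exact: cvg_id]].
  - by apply: cvgM; [exact: cvg_cst|exact: claus_continuous].
  - apply: cvgM; first exact: cvg_cst.
    by apply: continuous_cvg; [exact: claus_continuous|apply: cvgD; [exact: cvg_id|exact: cvg_cst]].
(* The derivative fails to exist at multiples of pi, so the identity is first proved on a half
   period and then shifted by pi. *)
have g0 u : 0 <= u <= pi -> g u = 0.
  move=> /andP[u0 upi].
  have -> : g u = g 0.
    apply: cst_of_derive0 => //; first exact: continuous_subspaceT.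
    move=> x /andP[x0 xu].
    have x2 : expi (2 * x) != 1 :> R[i] by apply: expi_eq1; apply/andP; split; lra.
    have x1 : expi x != 1 :> R[i] by apply: contra x2 => /eqP h; rewrite -expiX h expr1n.
    have x3 : expi (x + pi) != 1 :> R[i].
      by apply: contra x2 => /eqP h; rewrite -(expi_period (2 * x)) -mulrDr -expiX h expr1n.
    have d1 := claus_derive (cos_neq1 x1); have d2 := claus_derive (cos_neq1 x2).
    have d3 := claus_derive (cos_neq1 x3).
    apply: is_derive_eq; rewrite /GRing.scale /=.
    have -> : 1 - expi (2 * x) = (1 - expi x) * (1 - expi (x + pi)) :> R[i].
      by rewrite -expiX expiD expipi; ring.
    rewrite cmodM lnM ?posrE ?cmod_gt0 ?subr_eq0 1?eq_sym //; ring.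
  by rewrite /g mulr0 add0r !claus_sin0 ?sin0 ?sinpi // mulr0 !subr0.
move=> /andP[t0 t2]; have [tp|tp] := leP t pi.
  by have := g0 t; rewrite t0 tp /g => /(_ isT) h; lra.
have := g0 (t - pi); rewrite subr_ge0 lerBlDr (ltW tp) /= => h.
have {}h := h (_ : _); rewrite /g subrK in h.
have : claus (2 * (t - pi)) = claus (2 * t) by rewrite -claus_period; congr claus; ring.
have : claus (t + pi) = claus (t - pi) by rewrite -[RHS]claus_period; congr claus; ring.
have tt : t <= pi + pi by lra.
by move=> h1 h2; have := h tt; lra.
Qed.

End Clausen.

(** * Geometric sums and their divided difference *)

Section Geometric.
Context {A : comNzRingType}.
Implicit Types x z : A.

Definition geom n z : A := \sum_(k < n) z ^+ k.

Lemma geomS n z : geom n.+1 z = geom n z + z ^+ n.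
Proof. exact: big_ord_recr. Qed.

Lemma geomE n z : (z - 1) * geom n z = z ^+ n - 1.
Proof. by rewrite subrX1. Qed.

Lemma geom1 n : geom n 1 = n%:R.
Proof.
by rewrite /geom (eq_bigr (fun=> 1)) ?sumr_const ?card_ord // => i _; rewrite expr1n.
Qed.

(** Passing from degree d to d + 1 adds the homogeneous part, the sum of x^(d+1-i) z^i, which times
    z - x is z^(d+2) - x^(d+2). *)
Lemma geomB d x z :
  (z - x) * (\sum_(i < d.+1) geom (d.+1 - i) x * z ^+ i) = geom d.+2 z - geom d.+2 x.
Proof.
elim: d => [|n IH].
  rewrite big_ord1 /geom !subn0 !big_ord_recr !big_ord0 /=; ring.
have -> : \sum_(i < n.+2) geom (n.+2 - i) x * z ^+ i =
  \sum_(i < n.+1) geom (n.+1 - i) x * z ^+ i + \sum_(i < n.+2) x ^+ (n.+1 - i) * z ^+ i.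
  rewrite big_ord_recr /= [X in _ = _ + X]big_ord_recr /= addrA -big_split /=.
  rewrite subSnn /geom big_ord1 subnn; congr (_ + _).
  apply: eq_bigr => i _; rewrite subSn ?leq_ord //; last by rewrite ltnW // ltn_ord.
  by rewrite big_ord_recr /= mulrDl.
rewrite mulrDr IH (geomS n.+2 z) (geomS n.+2 x).
have := subrXX x z n.+2; rewrite /= => e.
have -> : (z - x) * \sum_(i < n.+2) x ^+ (n.+1 - i) * z ^+ i = z ^+ n.+2 - x ^+ n.+2.
  by rewrite -opprB mulNr -e opprB.
ring.
Qed.

End Geometric.

(** * The roots of h(x, .) and their dependence on x *)

Section Roots.
Context {R : realType}.
Local Notation C := R[i].
Variable d : nat.
Implicit Types (x y z : C).

(** The polynomial h(x, .) of the overview: the coefficient of z^i collects the x^j with j <= d -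
    i. *)
Definition hpoly x : {poly C} := \poly_(i < d.+1) geom (d.+1 - i) x.

Lemma hornerh x z : (hpoly x).[z] = \sum_(i < d.+1) geom (d.+1 - i) x * z ^+ i.
Proof. by rewrite horner_poly. Qed.

Lemma hpolyB x z : (z - x) * (hpoly x).[z] = geom d.+2 z - geom d.+2 x.
Proof. by rewrite hornerh geomB. Qed.

Lemma hpoly_mulXsub x : ('X - x%:P) * hpoly x = geom d.+2 'X - (geom d.+2 x)%:P.
Proof.
have g n : (geom n x)%:P = geom n x%:P.
  by rewrite /geom rmorph_sum; apply: eq_bigr => i _; rewrite rmorphXn.
rewrite /hpoly poly_def g -geomB; congr (_ * _); apply: eq_bigr => i _.
by rewrite -mul_polyC g.
Qed.

Lemma size_hpoly x : size (hpoly x) = d.+1.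
Proof.
by rewrite size_poly_eq //= subSnn /geom big_ord1 expr0 oner_neq0.
Qed.

Lemma hpoly_monic x : hpoly x \is monic.
Proof.
by rewrite monicE /lead_coef size_hpoly coef_poly /= ltnSn subSnn /geom big_ord1.
Qed.

Lemma Re_sum I (s : seq I) (P : pred I) (f : I -> C) :
  Re (\sum_(i <- s | P i) f i) = \sum_(i <- s | P i) Re (f i).
Proof. by elim/big_rec2: _ => [|i y1 y2 _ <-] //; rewrite ReD. Qed.

(** Equality case of the triangle inequality: each Re z^k is at most 1, so a sum equal to n forces
    Re z = 1, and then |z| <= 1 forces Im z = 0. *)
Lemma geom_eq_nat n z : (1 < n)%N -> cmod z <= 1 -> geom n z = n%:R -> z = 1.
Proof.
case: n => [|[|n]] // _ z1 /(congr1 (@complex.Re _)).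
have Ren k : Re (k%:R : C) = k%:R.
  by elim: k => [//|k IH]; rewrite -[k.+1]add1n !natrD ReD IH.
have Rle k : Re (z ^+ k) <= 1.
  rewrite (le_trans (ler_norm _)) // (le_trans (Re_le_cmod _)) // cmodX.
  by rewrite exprn_ile1 // cmod_ge0.
rewrite Ren /geom Re_sum 2!big_ord_recl /= => e.
have h : \sum_(i < n) Re (z ^+ bump 0 (bump 0 i)) <= n%:R.
  rewrite -[leRHS]mulr1 -[X in X%:R * _](card_ord n) mulr_natl -sumr_const.
  by apply: ler_sum => i _; exact: Rle.
have R1 : Re z = 1.
  move: e h (Rle 1%N); rewrite expr1 -[n.+2]addn2 natrD.
  set S := \sum_(_ < _) _ ; lra.
apply: complexP; rewrite ?R1 //.
have : cmod z ^+ 2 <= 1 by rewrite exprn_ile1 // cmod_ge0.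
by rewrite cmod_sqr R1 => h2; apply/eqP; rewrite -sqrf_eq0; apply/eqP; have := sqr_ge0 (Im z); nra.
Qed.

(** The diagonal value h(z, z) of the divided difference is the derivative of [geom d.+2] at z; this
    is the differentiated form of (z - 1) g z = z^n - 1. *)
Lemma hpoly_diag z : (z - 1) * (hpoly z).[z] = d.+2%:R * z ^+ d.+1 - geom d.+2 z.
Proof.
rewrite hornerh mulr_sumr (eq_bigr (fun i : 'I_d.+1 => z ^+ d.+1 - z ^+ i)).
  by rewrite sumrB sumr_const card_ord (geomS d.+1) /geom -[in RHS]add1n natrD; ring.
by move=> i _; rewrite mulrA geomE mulrBl mul1r -exprD subnK // ltnW // ltn_ord.
Qed.

(** All critical points of g lie in the open disc: g'(z) = 0 means n z^(n-1) = g z, and division by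
    z^(n-1) gives g(1/z) = n with |1/z| <= 1, hence z = 1, where g' is positive. *)
Lemma hpoly_diag_neq0 z : 1 <= cmod z -> (hpoly z).[z] != 0.
Proof.
move=> z1; have z0 : z != 0 by rewrite -cmod_gt0 (lt_le_trans _ z1).
have [->|zn1] := eqVneq z 1.
  rewrite hornerh (eq_bigr (fun i : 'I_d.+1 => (d.+1 - i)%:R)) => [|i _]; last by rewrite geom1 expr1n mulr1.
  by rewrite -natr_sum pnatr_eq0 -lt0n big_ord_recl subn0.
apply: contra_neq zn1 => e; have := hpoly_diag z; rewrite e mulr0 => /esym/eqP.
rewrite subr_eq0 => /eqP e2.
have e3 : geom d.+2 z^-1 = d.+2%:R.
  apply: (mulIf (expf_neq0 d.+1 z0)); rewrite e2 /geom mulr_suml.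
  rewrite (reindex_inj rev_ord_inj) /=; apply: eq_bigr => i _.
  rewrite exprVn subSS mulrC -expfB_cond; last by rewrite (negbTE z0) /= leq_subr.
  by rewrite subKn // -ltnS ltn_ord.
apply: invr_inj; rewrite invr1; apply: (@geom_eq_nat d.+2) => //.
by rewrite cmodV invf_le1 // cmod_gt0.
Qed.

Lemma hpoly_rootE x z : z != x -> ((hpoly x).[z] == 0) = (geom d.+2 z == geom d.+2 x).
Proof.
by move=> zx; rewrite -[in RHS]subr_eq0 -hpolyB mulf_eq0 subr_eq0 (negbTE zx).
Qed.

Lemma root_neq_diag x z : 1 <= cmod x -> (hpoly x).[z] = 0 -> z != x.
Proof. by move=> x1 /eqP; apply: contraTneq => ->; exact: hpoly_diag_neq0. Qed.

Lemma geom_root x z : (hpoly x).[z] = 0 -> geom d.+2 z = geom d.+2 x.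
Proof. by move=> e; apply/eqP; rewrite -subr_eq0 -hpolyB e mulr0. Qed.

(** A root at 1 would give g x = n, hence x = 1, against h(1, 1) != 0. *)
Lemma root_neq1 x z : cmod x = 1 -> (hpoly x).[z] = 0 -> z != 1.
Proof.
move=> x1 e; apply/eqP => z1; rewrite z1 in e.
have x1' : x = 1.
  apply: (@geom_eq_nat d.+2) => //; first by rewrite x1.
  by rewrite -(geom_root e) geom1.
by move/eqP: e; rewrite x1'; apply/negP; rewrite hpoly_diag_neq0 // cmod1.
Qed.

(** Ensures that no root crosses the circle at the two ends of the period. *)
Lemma root_at1 z : (hpoly 1).[z] = 0 -> 1 < cmod z.
Proof.
move=> e; rewrite ltNge; apply/negP => z1; have := root_neq1 cmod1 e.
by rewrite (@geom_eq_nat d.+2 z) ?eqxx // (geom_root e) geom1.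
Qed.

Lemma geom_inv n x : x != 0 -> geom n.+1 x^-1 = geom n.+1 x / x ^+ n.
Proof.
move=> x0; rewrite /geom mulr_suml (reindex_inj rev_ord_inj) /=.
apply: eq_bigr => i _; rewrite subSS exprVn.
have le : (i <= n)%N by rewrite -ltnS ltn_ord.
apply: (mulIf (expf_neq0 n x0)); rewrite divfK ?expf_neq0 //.
apply: (mulfI (expf_neq0 (n - i) x0)); rewrite mulrA divff ?expf_neq0 // mul1r.
by rewrite -exprD subnK.
Qed.

(* Conjugation inverts unit numbers, so two unit solutions of [geom d.+2 x = geom d.+2 y]
   also satisfy [geom d.+2 x / x ^+ d.+1 = geom d.+2 y / y ^+ d.+1]. *)
Lemma torus_root x z : cmod x = 1 -> cmod z = 1 -> (hpoly x).[z] = 0 ->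
  [/\ x != 1, z != 1 & z != x] /\
  ((x ^+ d.+2 = 1 /\ z ^+ d.+2 = 1) \/ (x ^+ d.+1 = 1 /\ z ^+ d.+1 = 1)).
Proof.
move=> x1 z1 e; have zx := root_neq_diag (_ : 1 <= cmod x) e.
have {}zx : z != x by apply: zx; rewrite x1.
have zn1 := root_neq1 x1 e.
have xn1 : x != 1.
  by apply/eqP => xe; rewrite xe in e; have := root_at1 e; rewrite z1 ltxx.
have x0 := cmod1_neq0 x1; have z0 := cmod1_neq0 z1.
split => //; have g := geom_root e.
have g2 : geom d.+2 z / z ^+ d.+1 = geom d.+2 x / x ^+ d.+1.
  rewrite -!geom_inv // -(cmod1_conj x1) -(cmod1_conj z1) /geom.
  move: g => /(congr1 conjc); rewrite /geom !rmorph_sum /=.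
  by under eq_bigr do rewrite rmorphXn; under [X in _ = X -> _]eq_bigr do rewrite rmorphXn.
have [gx0|gx0] := eqVneq (geom d.+2 x) 0.
  left; split; apply/eqP; rewrite -subr_eq0 -geomE ?g gx0 mulr0 //.
right; rewrite g in g2; have /invr_inj e2 := mulfI gx0 g2.
have gz := geomE d.+2 z; have gx := geomE d.+2 x; rewrite g in gz.
(* With p the common value of x^(d+1) and z^(d+1), the relation (x - 1)(p z - 1) = (z - 1)(p x - 1)
   reduces to (p - 1)(z - x) = 0. *)
have h : (x ^+ d.+1 - 1) * (z - x) = 0.
  have : (x - 1) * ((z - 1) * geom d.+2 x) = (z - 1) * ((x - 1) * geom d.+2 x) by ring.
  rewrite gz gx !(exprSr _ d.+1) e2 => e3.
  have -> : (x ^+ d.+1 - 1) * (z - x) = (z - 1) * (x ^+ d.+1 * x - 1) - (x - 1) * (x ^+ d.+1 * z - 1) by ring.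
  by rewrite e3 subrr.
move/eqP: h; rewrite mulf_eq0 [z - x == 0]subr_eq0 (negbTE zx) orbF subr_eq0 => /eqP h.
by rewrite e2 h.
Qed.

Definition hroots x : seq C := sval (closed_field_poly_normal (hpoly x)).

Lemma hrootsE x : hpoly x = \prod_(r <- hroots x) ('X - r%:P).
Proof.
rewrite /hroots; case: closed_field_poly_normal => r /= e.
by rewrite {1}e (monicP (hpoly_monic x)) scale1r.
Qed.

Lemma mem_hroots x z : (z \in hroots x) = ((hpoly x).[z] == 0).
Proof. by rewrite hrootsE -/(root _ z) root_prod_XsubC. Qed.

Lemma size_hroots x : size (hroots x) = d.
Proof. by have := size_hpoly x; rewrite {1}hrootsE size_prod_XsubC => -[]. Qed.

Lemma horner_hroots x z : (hpoly x).[z] = \prod_(r <- hroots x) (z - r).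
Proof.
by rewrite {1}hrootsE horner_prod; apply: eq_bigr => r _; rewrite !hornerE.
Qed.

(** The inequality is not strict, so that a root crossing the circle is followed on both sides of
    the crossing. *)
Definition bigroots x : seq C := [seq z <- hroots x | 1 <= cmod z].

(* Dividing [(X - x) h_x = (X - z) h_z] by [X - z] shows that [z] is a simple
   root of [h_x] as soon as [h_z z != 0]. *)
Lemma bigroots_uniq x : uniq (bigroots x).
Proof.
apply: count_mem_uniq => z; rewrite count_filter.
have [zs|] := boolP (z \in bigroots x); last first.
  by rewrite mem_filter => h; apply/eqP; rewrite -leqn0 leqNgt -has_count;
    apply: contra h => /hasP[y ys /= /andP[/eqP <-] ->]; rewrite ys.
move: (zs); rewrite mem_filter => /andP[z1 zr].
rewrite (@eq_count _ _ (pred1 z)) => [|y]; last first.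
  by rewrite /= andb_idr // => /eqP ->.
have ez : (hpoly x).[z] = 0 by apply/eqP; rewrite -mem_hroots.
have eq1 := hpoly_mulXsub z; rewrite (geom_root ez) -hpoly_mulXsub in eq1.
have eq2 : hpoly x = ('X - z%:P) * \prod_(r <- rem z (hroots x)) ('X - r%:P).
  by rewrite hrootsE (perm_big _ (perm_to_rem zr)) big_cons.
rewrite eq2 mulrCA in eq1; have {}eq1 := mulfI (negbT (polyXsubC_eq0 z)) eq1.
have := hpoly_diag_neq0 z1; rewrite eq1 hornerM mulf_eq0 negb_or => /andP[_].
rewrite -/(root _ z) root_prod_XsubC => h.
have /permP/(_ (pred1 z)) -> := perm_to_rem zr.
by rewrite /= eqxx; move/count_memPn: h => ->.
Qed.

Definition nearest (s : seq C) z : C :=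
  xget 0 [set r | r \in s /\ forall r', r' \in s -> cmod (z - r) <= cmod (z - r')].

Lemma nearestP (s : seq C) z : s != [::] ->
  nearest s z \in s /\ forall r', r' \in s -> cmod (z - nearest s z) <= cmod (z - r').
Proof.
move=> s0; apply: (@xgetPex _ 0 [set r | r \in s /\ forall r', r' \in s -> cmod (z - r) <= cmod (z - r')]).
elim: s s0 => // r s IH _; have [->|/IH [r0 [r0s h]]] := eqVneq s [::].
  by exists r => /=; rewrite mem_head; split => // r'; rewrite inE => /eqP ->.
have [le|/ltW le] := leP (cmod (z - r)) (cmod (z - r0)).
  exists r; split; first by rewrite mem_head.
  by move=> r'; rewrite inE => /predU1P[->//|/h]; exact: le_trans.
exists r0; split; first by rewrite inE r0s orbT.
by move=> r'; rewrite inE => /predU1P[->//|/h].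
Qed.

(** Each factor is at least the distance to the nearest root: a small value of a monic polynomial
    forces a root nearby. *)
Lemma nearest_prod (s : seq C) z : s != [::] ->
  cmod (z - nearest s z) ^+ size s <= cmod (\prod_(r <- s) (z - r)).
Proof.
move=> s0; have [_ h] := nearestP z s0; rewrite cmod_prod.
elim: {s0} s (nearest s z) h => [|r s IH] w h; first by rewrite big_nil.
rewrite big_cons /= exprS ler_pM ?exprn_ge0 ?cmod_ge0 //; first by rewrite h ?mem_head.
by apply: IH => r' rs; rewrite h // inE rs orbT.
Qed.

Lemma ccvg_hpoly {T : Type} {F : set_system T} {FF : Filter F} (X Z : T -> C) x z :
  ccvg F X x -> ccvg F Z z -> ccvg F (fun t => (hpoly (X t)).[Z t]) (hpoly x).[z].
Proof.
move=> hx hz; under [X in ccvg _ X]eq_fun do rewrite hornerh; rewrite hornerh.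
apply: ccvg_sum => i _; apply: ccvgM; last exact: ccvgX.
by apply: ccvg_sum => k _; exact: ccvgX.
Qed.

Lemma ccvg_geom {T : Type} {F : set_system T} {FF : Filter F} (X : T -> C) x n :
  ccvg F X x -> ccvg F (fun t => geom n (X t)) (geom n x).
Proof. by move=> hx; apply: ccvg_sum => k _; exact: ccvgX. Qed.

(** Continuity of h at the diagonal point (z, z). Since (y2 - y1) h(y1, y2) = g y2 - g y1, this is
    injectivity of g near z. *)
Lemma hpoly_locally_neq0 z : 1 <= cmod z -> exists2 e : R, 0 < e &
  forall y1 y2, cmod (y1 - z) < e -> cmod (y2 - z) < e -> (hpoly y1).[y2] != 0.
Proof.
move=> z1.
pose F := filter_from [set e : R | 0 < e]
  (fun e => [set p : C * C | cmod (p.1 - z) < e /\ cmod (p.2 - z) < e]).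
have FF : Filter F.
  apply: filter_from_filter; first by exists 1 => /=.
  move=> e1 e2 /= e10 e20; exists (Num.min e1 e2); first by rewrite /= lt_min e10.
  by move=> p /=; rewrite !lt_min => -[/andP[-> ->] /andP[-> ->]].
have c1 : ccvg F fst z.
  apply: ccvg0; apply/cvgr0Pnorm_lt => e e0; exists e => //= p [h _].
  by rewrite ger0_norm // cmod_ge0.
have c2 : ccvg F snd z.
  apply: ccvg0; apply/cvgr0Pnorm_lt => e e0; exists e => //= p [_ h].
  by rewrite ger0_norm // cmod_ge0.
have [e /= e0 h] := ccvg_near_neq0 (hpoly_diag_neq0 z1) (ccvg_hpoly c1 c2).
by exists e => // y1 y2 h1 h2; exact: (h (y1, y2)).
Qed.

(** Takes the minimum of finitely many radii; [Q] must persist when the radius shrinks. *)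
Lemma seq_uniform (s : seq C) (Q : C -> R -> Prop) :
  (forall r e e', 0 < e' -> e' <= e -> Q r e -> Q r e') ->
  (forall r, r \in s -> exists2 e, 0 < e & Q r e) ->
  exists2 e, 0 < e & forall r, r \in s -> Q r e.
Proof.
move=> mono; elim: s => [|r s IH] h; first by exists 1.
have [|e1 e10 h1] := IH; first by move=> r' r's; apply: h; rewrite inE r's orbT.
have [|e2 e20 h2] := h r; first by rewrite mem_head.
have m0 : 0 < Num.min e1 e2 by rewrite lt_min e10.
exists (Num.min e1 e2) => // r'; rewrite inE => /predU1P[->|/h1].
  by apply: mono h2 => //; rewrite ge_min lexx orbT.
by apply: mono => //; rewrite ge_min lexx.
Qed.

Lemma near_seq {T : Type} {F : set_system T} {FF : Filter F} (I : eqType) (s : seq I)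
    (P : I -> T -> Prop) :
  (forall r, r \in s -> \forall t \near F, P r t) -> \forall t \near F, forall r, r \in s -> P r t.
Proof.
elim: s => [|r s IH] h; first by apply: filterE.
have h1 := h r (mem_head _ _).
have h2 : \forall t \near F, forall r, r \in s -> P r t.
  by apply: IH => r' r's; apply: h; rewrite inE r's orbT.
by apply: filterS2 h1 h2 => t p1 p2 r'; rewrite inE => /predU1P[->|/p2].
Qed.

(** Nearest root instead of analytic continuation: it is only used for a close to a parameter at
    which z itself is a root. *)
Definition branch z (a : R) := nearest (hroots (expi a)) z.

Hypothesis d0 : (0 < d)%N.

Lemma hroots_neq0 x : hroots x != [::].
Proof. by rewrite -size_eq0 size_hroots -lt0n. Qed.

Lemma branch_root z a : branch z a \in hroots (expi a).
Proof. by case: (nearestP z (hroots_neq0 (expi a))). Qed.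

(** The value of h(e^(ia), .) at z tends to 0, and by [nearest_prod] it bounds the d-th power of the
    distance from z to the branch. *)
Lemma branch_cvg z (a0 : R) : z \in hroots (expi a0) -> ccvg (nbhs a0) (branch z) z.
Proof.
rewrite mem_hroots => /eqP ez; apply: ccvg0; apply/cvgr0Pnorm_lt => e e0.
have c : ccvg (nbhs a0) (fun a => (hpoly (expi a)).[z]) (hpoly (expi a0)).[z].
  by apply: ccvg_hpoly; [exact: ccvg_expi|exact: ccvg_cst].
have ed : 0 < e ^+ d by rewrite exprn_gt0.
apply: (filterS _ (ccvg_near ed c)) => a; rewrite ez subr0 => h.
have := nearest_prod z (hroots_neq0 (expi a)); rewrite -horner_hroots size_hroots -/(branch z a).
rewrite ger0_norm ?cmod_ge0 // cmodB => h2.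
by rewrite -(@ltr_pXn2r _ d) ?nnegrE ?cmod_ge0 ?ltW // (le_lt_trans h2).
Qed.

(** A root y of h(e^(ia), .) satisfies g y = g(e^(ia)), which is close to g x0, so y is close to a
    zero of g - g x0, that is to x0 or to a root of h(x0, .). When |y| >= 1, injectivity of g near
    points of modulus at least 1 rules out x0 and identifies y with a branch. *)
Lemma branches_near (a0 : R) : \forall a \near a0,
  {in bigroots (expi a0) &, injective (branch^~ a)} /\
  forall y, y \in bigroots (expi a) -> exists2 z, z \in bigroots (expi a0) & y = branch z a.
Proof.
set x0 := expi a0; have x01 : cmod x0 = 1 := cmod_expi a0.
(* All zeros of g - g x0. The radii below serve for injectivity of g, for staying inside the disc,
   and for separating these zeros. *)
pose s := x0 :: hroots x0.
have [e1 e10 h1] : exists2 e, 0 < e & forall r, r \in s -> 1 <= cmod r ->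
    forall y1 y2, cmod (y1 - r) < e -> cmod (y2 - r) < e -> (hpoly y1).[y2] != 0.
  apply: (@seq_uniform s (fun r e => 1 <= cmod r ->
    forall y1 y2, cmod (y1 - r) < e -> cmod (y2 - r) < e -> (hpoly y1).[y2] != 0)).
    move=> r e e' e'0 le h r1 y1 y2 a1 a2; apply: h => //; exact: lt_le_trans le.
  move=> r _; have [r1|_] := boolP (1 <= cmod r); last by exists 1.
  by have [e e0 he] := hpoly_locally_neq0 r1; exists e.
have [e2 e20 h2] : exists2 e, 0 < e & forall r, r \in s -> cmod r < 1 ->
    forall y, cmod (y - r) < e -> cmod y < 1.
  apply: (@seq_uniform s (fun r e => cmod r < 1 -> forall y, cmod (y - r) < e -> cmod y < 1)).
    by move=> r e e' e'0 le h r1 y a1; apply: h => //; exact: lt_le_trans le.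
  move=> r _; have [r1|_] := boolP (cmod r < 1); last by exists 1.
  exists (1 - cmod r); first by rewrite subr_gt0.
  by move=> _ y hy; rewrite -(subrK r y) (le_lt_trans (cmodD _ _)) // -ltrBrDr.
have [e3 e30 h3] : exists2 e, 0 < e & forall r, r \in s -> forall r', r' \in s ->
    r != r' -> 2 * e <= cmod (r - r').
  apply: (@seq_uniform s (fun r e => forall r', r' \in s -> r != r' -> 2 * e <= cmod (r - r'))).
    by move=> r e e' e'0 le h r' r's rr; have := h r' r's rr; lra.
  move=> r _; apply: (@seq_uniform s (fun r' e => r != r' -> 2 * e <= cmod (r - r'))).
    by move=> r' e e' e'0 le h rr; have := h rr; lra.
  move=> r' _; have [_|rr] := eqVneq r r'; first by exists 1.
  exists (cmod (r - r') / 2); first by rewrite divr_gt0 // cmod_gt0 subr_eq0.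
  by move=> _; lra.
pose e := Num.min e1 (Num.min e2 e3).
have e0 : 0 < e by rewrite !lt_min e10 e20.
have [ee1 ee2 ee3] : [/\ e <= e1, e <= e2 & e <= e3] by rewrite !ge_min !lexx !orbT.
have cx : ccvg (nbhs a0) (fun a => expi a) x0 by exact: ccvg_expi.
have nz : \forall a \near a0, forall z, z \in bigroots x0 -> cmod (branch z a - z) < e.
  apply: (@near_seq _ (nbhs a0) _ _ _ (fun z a => cmod (branch z a - z) < e)) => z.
  rewrite mem_filter => /andP[_ zr].
  exact: (ccvg_near e0 (branch_cvg zr)).
near=> a.
have na : forall z, z \in bigroots x0 -> cmod (branch z a - z) < e by near: a.
have xa : cmod (expi a - x0) < e by near: a; exact: ccvg_near.
have ga : cmod (geom d.+2 (expi a) - geom d.+2 x0) < e ^+ d.+1.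
  by near: a; apply: ccvg_near; [rewrite exprn_gt0|exact: ccvg_geom].
split=> [z z' zs z's /= eb|y].
  apply: contraTeq isT => zz.
  have zS : z \in s by move: zs; rewrite mem_filter inE => /andP[_ ->]; rewrite orbT.
  have z'S : z' \in s by move: z's; rewrite mem_filter inE => /andP[_ ->]; rewrite orbT.
  have := h3 z zS z' z'S zz; have n1 := na z zs; have n2 := na z' z's.
  have := cmodD (z - branch z a) (branch z a - z'); rewrite addrA subrK (cmodB z) {2}eb.
  lra.
rewrite mem_filter => /andP[y1 yr].
have ey : (hpoly (expi a)).[y] = 0 by apply/eqP; rewrite -mem_hroots.
have s0 : s != [::] by [].
have [rs rmin] := nearestP y s0; set r := nearest s y in rs rmin.
have ry : cmod (y - r) < e.
  rewrite -(@ltr_pXn2r _ d.+1) ?nnegrE ?cmod_ge0 ?ltW //.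
  (* The product over [s] equals (y - x0) h(x0, y) = g y - g x0, and g y = g(e^(ia)). *)
  have := nearest_prod y s0; rewrite /= size_hroots big_cons -horner_hroots hpolyB.
  by move/le_lt_trans; apply; rewrite (geom_root ey).
have r1 : 1 <= cmod r.
  rewrite leNgt; apply/negP => r1; have := h2 r rs r1 y (lt_le_trans ry ee2).
  by rewrite ltNge y1.
have rx : r != x0.
  (* If y were near x0, then (e^(ia), y) would be a zero of h close to the diagonal point (x0,
     x0). *)
  apply/eqP => rx; have := h1 r rs r1 (expi a) y; rewrite ey eqxx.
  have xr : cmod (expi a - r) < e1 by rewrite rx (lt_le_trans xa).
  by move=> /(_ xr (lt_le_trans ry ee1)).
have rbig : r \in bigroots x0.
  by move: rs; rewrite inE (negbTE rx) /= mem_filter r1.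
(* Both y and [branch r a] are near r and have the same value of g, so they coincide. *)
exists r => //; apply/eqP; apply: contraT => yb.
have eb : (hpoly (expi a)).[branch r a] = 0 by apply/eqP; rewrite -mem_hroots branch_root.
have e12 : (hpoly y).[branch r a] = 0.
  by apply/eqP; rewrite hpoly_rootE 1?eq_sym // (geom_root ey) (geom_root eb).
have := h1 r rs r1 y (branch r a) (lt_le_trans ry ee1) (lt_le_trans (na r rbig) ee1).
by rewrite e12 eqxx.
Unshelve. all: by end_near. Qed.

End Roots.

(** * The dilogarithm off the unit circle *)

Section Dilogarithm.
Context {R : realType}.
Local Notation C := R[i].
Implicit Types (z v p : C) (t : R).

(** The Clausen function at twice the argument of z, written without choosing an argument. *)
Definition phaseBW z : R := BlochWigner (z / (conjc z)).

(* The Bloch-Wigner function of [z] in terms of its values on the unit circle: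
   half the sum of the Clausen functions of the doubled angles of the triangle
   [0, 1, z]. *)
Definition dilog z : R := (phaseBW z + phaseBW ((z - 1) / z) + phaseBW (1 - z)^-1) / 2.

Lemma phase_polar (r t : R) : r != 0 -> (r%:C * expi t) / (conjc (r%:C * expi t)) = expi (2 * t) :> C.
Proof.
move=> r0; rewrite conjc_mul conjc_C conj_expi.
rewrite invfM mulrACA divff ?mul1r; last by rewrite (inj_eq (@complexI R)).
by rewrite expiN invrK -expiD; congr expi; ring.
Qed.

Lemma phaseBW_polar z (r t : R) : r != 0 -> z = r%:C * expi t -> phaseBW z = claus (2 * t).
Proof. by move=> r0 ->; rewrite /phaseBW phase_polar. Qed.

Lemma realC_eq0 (r : R) : (r%:C == 0 :> C) = (r == 0).
Proof. by rewrite -(inj_eq (@complexI R)). Qed.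

(** The radii may be negative: doubling the angles forgets the sign. *)
Lemma dilog_polar p (r s a b : R) : r != 0 -> s != 0 -> p = r%:C * expi a -> p - 1 = s%:C * expi b ->
  dilog p = (claus (2 * a) + claus (2 * (b - a)) + claus (2 * (- b))) / 2.
Proof.
move=> r0 s0 ep eq.
have h1 : (p - 1) / p = (s / r)%:C * expi (b - a).
  by rewrite eq ep rmorphM fmorphV /= expiB invfM mulrACA.
have h2 : (1 - p)^-1 = (- s^-1)%:C * expi (- b).
  by rewrite -opprB eq invrN invfM rmorphN fmorphV /= expiN mulNr.
rewrite /dilog (phaseBW_polar r0 ep) (phaseBW_polar _ h1) ?(phaseBW_polar _ h2) //.
  by rewrite oppr_eq0 invr_eq0.
by rewrite mulf_neq0 // invr_eq0.
Qed.

(** A determination of the argument that is smooth on the half-plane around z0, also where [carg]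
    jumps. *)
Definition local_arg z0 z : R := carg z0 + atan (Im (z / z0) / Re (z / z0)).

Lemma local_argE z0 z : z0 != 0 -> 0 < Re (z / z0) -> z = (cmod z)%:C * expi (local_arg z0 z).
Proof.
move=> z00 h; have u0 : z / z0 != 0 by apply: contraTneq h => ->; rewrite ltxx.
have e1 := polar u0; rewrite carg_Re_gt0 // in e1; have e2 := polar z00.
have em : cmod z = cmod (z / z0) * cmod z0 by rewrite -cmodM divfK.
have ez : z = z / z0 * z0 by rewrite divfK.
rewrite em /local_arg expiD rmorphM /= {1}ez [LHS](congr2 *%R e1 e2); ring.
Qed.

Lemma local_arg_cvg {T : Type} {F : set_system T} {FF : Filter F} (f : T -> C) z0 :
  z0 != 0 -> ccvg F f z0 -> local_arg z0 (f t) @[t --> F] --> carg z0.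
Proof.
move=> z00 h; have [h1 h2] := ccvg_div z00 h (ccvg_cst z0).
rewrite divff // in h1 h2.
rewrite -[carg z0]addr0 -(@atan0 R) -(mul0r (1^-1)).
apply: cvgD; first exact: cvg_cst.
apply: continuous_cvg; first exact: continuous_atan.
by apply: cvgM => //; apply: cvgV => //; exact: oner_neq0.
Qed.

Lemma local_arg_near {T : Type} {F : set_system T} {FF : Filter F} (f : T -> C) z0 :
  z0 != 0 -> ccvg F f z0 -> \forall t \near F, 0 < Re (f t / z0).
Proof.
move=> z00 h; have [h1 _] := ccvg_div z00 h (ccvg_cst z0).
by rewrite divff // in h1; move/cvgr_gt : h1 => /(_ 0); apply; exact: ltr01.
Qed.

Lemma phaseBW_cvg {T : Type} {F : set_system T} {FF : Filter F} (f : T -> C) z0 :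
  z0 != 0 -> ccvg F f z0 -> phaseBW (f t) @[t --> F] --> phaseBW z0.
Proof.
move=> z00 h.
rewrite (phaseBW_polar (_ : cmod z0 != 0) (polar z00)) ?cmod_eq0 //.
have : claus (2 * local_arg z0 (f t)) @[t --> F] --> claus (2 * carg z0).
  apply: continuous_cvg; first exact: claus_continuous.
  by apply: cvgM; [exact: cvg_cst|exact: local_arg_cvg].
apply: cvg_trans; apply: near_eq_cvg.
near=> t.
have re : 0 < Re (f t / z0) by near: t; exact: local_arg_near.
have e := local_argE z00 re; rewrite (phaseBW_polar _ e) // cmod_eq0.
by apply: contraTneq re => ->; rewrite mul0r ltxx.
Unshelve. all: by end_near. Qed.

Lemma dilog_cvg {T : Type} {F : set_system T} {FF : Filter F} (f : T -> C) z0 :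
  z0 != 0 -> z0 != 1 -> ccvg F f z0 -> dilog (f t) @[t --> F] --> dilog z0.
Proof.
move=> z00 z01 h; have z01' : z0 - 1 != 0 by rewrite subr_eq0.
have z10 : 1 - z0 != 0 by rewrite subr_eq0 eq_sym.
apply: cvgM; last exact: cvg_cst.
apply: cvgD; first apply: cvgD.
- exact: phaseBW_cvg.
- apply: phaseBW_cvg; first by rewrite mulf_neq0 // invr_eq0.
  by apply: ccvg_div => //; apply: ccvgB => //; exact: ccvg_cst.
- apply: phaseBW_cvg; first by rewrite invr_eq0.
  by apply: ccvgV => //; apply: ccvgB => //; exact: ccvg_cst.
Qed.

Lemma BW1 : BlochWigner (1 : C) = 0.
Proof. by have := @claus_sin0 R 0 (@sin0 R); rewrite /claus expi0. Qed.

Lemma phaseBW_real z : z != 0 -> Im z = 0 -> phaseBW z = 0.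
Proof.
move=> z0 zr; have -> : z = (Re z)%:C by exact: complexP.
rewrite /phaseBW conjc_C divff ?BW1 // realC_eq0; apply: contra z0 => /eqP r0.
by apply/eqP/complexP.
Qed.

(** All three phases are 1, and [BlochWigner 1] is 0. *)
Lemma dilog_real z : z != 0 -> z != 1 -> Im z = 0 -> dilog z = 0.
Proof.
move=> z0 z1 zr; have z1' : z - 1 != 0 by rewrite subr_eq0.
have z1'' : 1 - z != 0 by rewrite subr_eq0 eq_sym.
rewrite /dilog !phaseBW_real ?addr0 ?mul0r ?invr_eq0 //.
- by rewrite ImV !ReImE zr subr0 oppr0 mul0r.
- by rewrite mulf_neq0 // invr_eq0.
- by rewrite ImM ImV !ReImE zr subr0 oppr0 mul0r mulr0 mul0r addr0.
Qed.

Lemma cmod_phase z : z != 0 -> cmod (1 - z / (conjc z)) = 2 * `|Im z| / cmod z.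
Proof.
move=> z0; have zc0 : (conjc z) != 0 by rewrite conjc_eq0.
have -> : 1 - z / (conjc z) = ((conjc z) - z) / (conjc z) by rewrite mulrBl divff.
rewrite cmodM cmodV cmod_conj; congr (_ / _).
have -> : (conjc z) - z = 0 +i* (- (2 * Im z)) by apply: complexP; rewrite !ReImE; ring.
by rewrite cmodE /= expr0n add0r sqrtr_sqr normrN normrM (ger0_norm (ler0n _ 2)).
Qed.

Lemma Im_sub_div z : z != 0 -> Im ((z - 1) / z) = Im z / cmod z ^+ 2.
Proof.
by move=> z0; rewrite mulrBl divff // mul1r ImD Im1 ImN ImV cmod_sqr add0r mulNr opprK.
Qed.

(** The differential ln |p| d arg(1 - p) - ln |1 - p| d arg p at p, applied to the tangent vector
    v. *)
Definition dilog_grad p v : R := ln (cmod p) * Im (v / (p - 1)) - ln (cmod (p - 1)) * Im (v / p).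

Lemma Re_1D_real (h : R) z : Re (1 + h%:C * z) = 1 + h * Re z.
Proof. by rewrite !ReImE; ring. Qed.

Lemma Im_1D_real (h : R) z : Im (1 + h%:C * z) = h * Im z.
Proof. by rewrite !ReImE; ring. Qed.

Lemma local_arg_derive z0 v t : z0 + t%:C * v != 0 ->
  is_derive t 1 (fun s => local_arg (z0 + t%:C * v) (z0 + s%:C * v)) (Im (v / (z0 + t%:C * v))).
Proof.
set p := z0 + _ => p0.
have e (s : R) : (z0 + s%:C * v) / p = 1 + (s - t)%:C * (v / p).
  have -> : z0 + s%:C * v = p + (s - t)%:C * v by rewrite /p rmorphB /=; ring.
  by rewrite mulrDl divff // mulrA.
have -> : (fun s => local_arg p (z0 + s%:C * v)) =
   fun s => carg p + atan (((s - t) * Im (v / p)) / (1 + (s - t) * Re (v / p))).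
  by apply/funext => s; rewrite /local_arg e Re_1D_real Im_1D_real.
have h : 1 + (t - t) * Re (v / p) != 0 by rewrite subrr mul0r addr0 oner_neq0.
apply: is_derive_eq; rewrite /GRing.scale /= subrr !mul0r !addr0; by field.
Qed.

(** Each Clausen term contributes minus a logarithm ln(2 |Im| / modulus) times the derivative of its
    angle. The three angles add up to 0, so the common ln(2 |Im p|) cancels and only the moduli of p
    and p - 1 remain. *)
Lemma dilog_line_derive z0 v t : Im (z0 + t%:C * v) != 0 ->
  is_derive t 1 (fun s => dilog (z0 + s%:C * v)) (dilog_grad (z0 + t%:C * v) v).
Proof.
set p := z0 + _ => ip.
have p0 : p != 0 by apply: contraNneq ip => ->.
have p1 : p - 1 != 0 by apply: contraNneq ip => /eqP; rewrite subr_eq0 => /eqP ->.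
pose al s := local_arg p (z0 + s%:C * v).
pose be s := local_arg (p - 1) (z0 - 1 + s%:C * v).
have ep1 : p - 1 = z0 - 1 + t%:C * v by rewrite /p; ring.
have dal : is_derive t 1 al (Im (v / p)) by exact: local_arg_derive.
have dbe : is_derive t 1 be (Im (v / (p - 1))).
  by rewrite /be ep1; apply: local_arg_derive; rewrite -ep1.
have alt : al t = carg p by rewrite /al /local_arg divff // mul0r atan0 addr0.
have bet : be t = carg (p - 1) by rewrite /be /local_arg -ep1 divff // mul0r atan0 addr0.
have pp := polar p0; have pp1 := polar p1.
have nm0 : cmod p != 0 by rewrite cmod_eq0.
have nm1 : cmod (p - 1) != 0 by rewrite cmod_eq0.
have e1 : expi (2 * al t) = p / (conjc p) :> C by rewrite alt -(phase_polar _ nm0) -pp.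
have e2 : expi (2 * be t) = (p - 1) / (conjc (p - 1)) :> C by rewrite bet -(phase_polar _ nm1) -pp1.
have ph1 z : z != 0 -> Im z != 0 -> z / (conjc z) != 1.
  move=> z0' iz; rewrite eq_sym -subr_eq0 -cmod_eq0 cmod_phase // mulf_neq0 ?invr_eq0 ?cmod_eq0 //.
  by rewrite mulf_neq0 // normr_eq0.
have i1 : Im (p - 1) = Im p by rewrite !ReImE subr0.
pose w := (p - 1) / p.
have w0 : w != 0 by rewrite mulf_neq0 // invr_eq0.
have iw : Im w = Im p / cmod p ^+ 2.
  exact: Im_sub_div.
have iw0 : Im w != 0 by rewrite iw mulf_neq0 // invr_eq0 expf_neq0.
have e3 : expi (2 * (be t - al t)) = w / (conjc w) :> C.
  by rewrite mulrBr expiB e1 e2 /w conjc_mul conjc_inv !invfM !invrK; ring.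
have e4 : expi (2 * - be t) = ((p - 1) / (conjc (p - 1)))^-1 :> C by rewrite mulrN expiN e2.
have c1 : cos (2 * al t) != 1 by apply: cos_neq1; rewrite e1 ph1.
have c3 : cos (2 * (be t - al t)) != 1 by apply: cos_neq1; rewrite e3 ph1.
have c4 : cos (2 * - be t) != 1.
  by apply: cos_neq1; rewrite e4 invr_eq1 ph1 // i1.
have d1 := claus_derive c1; have d3 := claus_derive c3; have d4 := claus_derive c4.
rewrite e1 cmod_phase // in d1; rewrite e3 cmod_phase // in d3.
have c4' : cmod (1 - ((p - 1) / (conjc (p - 1)))^-1) = cmod (1 - (p - 1) / (conjc (p - 1))).
  set q := (p - 1) / _; have q0 : q != 0 by rewrite /q mulf_neq0 // invr_eq0 conjc_eq0.
  have -> : 1 - q^-1 = - ((1 - q) / q) by rewrite mulrBl divff // mul1r opprB.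
  rewrite cmodN cmodM cmodV /q cmodM cmodV cmod_conj divff // invr1 mulr1 //.
rewrite e4 c4' cmod_phase // i1 in d4.
have dD : is_derive t 1 (fun s => (claus (2 * al s) + claus (2 * (be s - al s)) + claus (2 * (- be s))) / 2)
   (dilog_grad p v).
  have k1 := is_derive1_comp (g := fun s => 2 * al s) d1 (is_derive1M (is_derive1c t 2) dal).
  have k3 := is_derive1_comp (g := fun s => 2 * (be s - al s)) d3
    (is_derive1M (is_derive1c t 2) (is_derive1B dbe dal)).
  have k4 := is_derive1_comp (g := fun s => 2 * - be s) d4 (is_derive1M (is_derive1c t 2) (is_derive1N dbe)).
  apply: (is_derive_eq (is_derive1M (is_derive1D (is_derive1D k1 k3) k4) (is_derive1c t 2^-1))).
  rewrite iw /w cmodM cmodV /dilog_grad normrM normfV.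
  have lp : 0 < cmod p by rewrite cmod_gt0.
  have lp1 : 0 < cmod (p - 1) by rewrite cmod_gt0.
  have li : 0 < `|Im p| by rewrite normr_gt0.
  rewrite (ger0_norm (sqr_ge0 (cmod p))).
  have -> : 2 * (`|Im p| / cmod p ^+ 2) / (cmod (p - 1) / cmod p) = 2 * `|Im p| / (cmod p * cmod (p - 1)).
    by field; rewrite nm0 nm1.
  have l2 : 0 < 2 * `|Im p| by rewrite mulr_gt0.
  rewrite !ln_div ?posrE ?mulr_gt0 // [ln (cmod p * _)]lnM ?posrE //.
  rewrite !mulr0 !addr0; by field.
have near_eq : {near t, (fun s => (claus (2 * al s) + claus (2 * (be s - al s)) + claus (2 * (- be s))) / 2) =1
    (fun s => dilog (z0 + s%:C * v))}.
  have cz (z : C) : ccvg (nbhs t) (fun s : R => z + s%:C * v) (z + t%:C * v).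
    apply: ccvgD; first exact: ccvg_cst.
    apply: ccvgM; last exact: ccvg_cst.
    by apply: ccvg_real; exact: cvg_id.
  near=> s.
  have r1 : 0 < Re ((z0 + s%:C * v) / p) by near: s; apply: local_arg_near.
  have r2 : 0 < Re ((z0 - 1 + s%:C * v) / (p - 1)).
    by near: s; apply: local_arg_near => //; rewrite ep1; exact: cz.
  have n0 z w' : 0 < Re (z / w') -> cmod z != 0.
    by rewrite cmod_eq0; apply: contraTneq => ->; rewrite mul0r ltxx.
  have e2' : z0 + s%:C * v - 1 = (cmod (z0 - 1 + s%:C * v))%:C * expi (be s).
    by rewrite -(local_argE p1 r2); ring.
  by rewrite (dilog_polar (n0 _ _ r1) (n0 _ _ r2) (local_argE p0 r1) e2').
exact: near_eq_is_derive dD.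
Unshelve. all: by end_near. Qed.

Lemma ccvg_near_eq {T : Type} {F : set_system T} {FF : Filter F} (f g : T -> C) l :
  (\forall t \near F, f t = g t) -> ccvg F f l -> ccvg F g l.
Proof.
move=> fg [h1 h2]; split.
  by apply: cvg_trans h1; apply: near_eq_cvg; apply: filterS fg => t ->.
by apply: cvg_trans h2; apply: near_eq_cvg; apply: filterS fg => t ->.
Qed.

Lemma dilog_grad_cvg {T : Type} {F : set_system T} {FF : Filter F} (f g : T -> C) z0 v :
  z0 != 0 -> z0 != 1 -> ccvg F f z0 -> ccvg F g v ->
  dilog_grad (f t) (g t) @[t --> F] --> dilog_grad z0 v.
Proof.
move=> z00 z01 hf hg; have z01' : z0 - 1 != 0 by rewrite subr_eq0.
have hf1 : ccvg F (fun i => f i - 1) (z0 - 1) by apply: ccvgB => //; exact: ccvg_cst.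
apply: cvgB; apply: cvgM.
- by apply: continuous_cvg; [apply: continuous_ln; rewrite cmod_gt0|exact: ccvg_cmod].
- exact: (ccvg_div z01' hg hf1).2.
- by apply: continuous_cvg; [apply: continuous_ln; rewrite cmod_gt0|exact: ccvg_cmod].
- exact: (ccvg_div z00 hg hf).2.
Qed.

Lemma dilog_gradZ p v (h : R) : dilog_grad p (h%:C * v) = h * dilog_grad p v.
Proof.
have e z : Im (h%:C * v / z) = h * Im (v / z).
  by rewrite -mulrA ImM ReC ImC mul0r addr0.
by rewrite /dilog_grad !e; ring.
Qed.

Lemma dilog_grad_real p v : Im p = 0 -> Im v = 0 -> dilog_grad p v = 0.
Proof.
move=> ip iv; rewrite /dilog_grad !ImM !ImV ImD ImN Im1 ip iv oppr0 addr0 oppr0.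
by rewrite !mul0r !mulr0 !addr0 !mulr0 subr0.
Qed.

Lemma dilog_MVT z0 z :
  (forall t, 0 <= t <= 1 -> z0 + t%:C * (z - z0) != 0 /\ z0 + t%:C * (z - z0) != 1) ->
  Im z0 = 0 \/ (forall t, 0 <= t <= 1 -> Im (z0 + t%:C * (z - z0)) != 0) ->
  exists2 t, 0 <= t <= 1 & dilog z - dilog z0 = dilog_grad (z0 + t%:C * (z - z0)) (z - z0).
Proof.
move=> h01 him.
have e0 : z0 + (0 : R)%:C * (z - z0) = z0 by rewrite mul0r addr0.
have e1 : z0 + (1 : R)%:C * (z - z0) = z by rewrite mul1r addrC subrK.
have [/andP[/eqP iz0 /eqP iz]|nr] := boolP ((Im z0 == 0) && (Im z == 0)).
  exists 0; first by rewrite lexx ler01.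
  have [a0 a1] : z0 != 0 /\ z0 != 1 by have := h01 0; rewrite e0; apply; rewrite lexx ler01.
  have [b0 b1] : z != 0 /\ z != 1 by have := h01 1; rewrite e1; apply; rewrite lexx ler01.
  rewrite e0.
  by rewrite !dilog_real // dilog_grad_real ?subr0 // ImD ImN iz iz0 subr0.
have him' t : 0 < t < 1 -> Im (z0 + t%:C * (z - z0)) != 0.
  move=> /andP[t0 t1]; case: him => [iz0|h]; last by apply: h; rewrite !ltW.
  rewrite iz0 eqxx /= in nr.
  by rewrite ImD ImM ImC ReC ImD ImN iz0 subr0 mul0r add0r addr0 mulf_neq0 // gt_eqF.
have dx (x : R) : x \in `]0, 1[ ->
    is_derive x 1 (fun s : R => dilog (z0 + s%:C * (z - z0)))
      ((fun s => dilog_grad (z0 + s%:C * (z - z0)) (z - z0)) x).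
  by rewrite in_itv /= => x01; apply: dilog_line_derive; exact: him'.
have cx : {within `[0, 1], continuous (fun s : R => dilog (z0 + s%:C * (z - z0)))}.
  apply: continuous_in_subspaceT => x; rewrite inE /= in_itv /= => x01.
  have [n0 n1] := h01 x x01; apply: dilog_cvg => //.
  apply: ccvgD; first exact: ccvg_cst.
  apply: ccvgM; last exact: ccvg_cst.
  by apply: ccvg_real; exact: cvg_id.
have [c] := MVT (@ltr01 R) dx cx; rewrite in_itv /= e0 e1 subr0 mulr1 => /andP[c0 c1] e.
by exists c => //; rewrite !ltW.
Qed.

Lemma slope_is_derive (f : R -> R) (a l : R) :
  (f (h + a) - f a) / h @[h --> 0^'] --> l -> is_derive a 1 f l.
Proof.
move=> hl.
have hl' : h^-1 *: ((f \o shift a) (h *: 1) - f a) @[h --> 0^'] --> l.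
  apply: cvg_trans hl; apply: near_eq_cvg; apply: nearW => h /=.
  by rewrite [h *: 1]mulr1 [RHS]mulrC.
apply: DeriveDef; first by apply/cvg_ex; exists l.
exact/cvg_lim.
Qed.

Lemma is_derive_slope (f : R -> R) (a l : R) :
  is_derive a 1 f l -> (f (h + a) - f a) / h @[h --> 0^'] --> l.
Proof.
move=> [D <-]; apply: cvg_trans D; apply: near_eq_cvg; apply: nearW => h /=.
by rewrite [h *: 1]mulr1 [LHS]mulrC.
Qed.

Definition cder (z : R -> C) (a : R) (l : C) :=
  ccvg (0 : R)^' (fun h => (z (h + a) - z a) / h%:C) l.

Lemma cder_cvg (z : R -> C) a l : cder z a l -> ccvg (0 : R)^' (fun h => z (h + a)) (z a).
Proof.
move=> hz.
have h1 : ccvg (0 : R)^' (fun h => h%:C * ((z (h + a) - z a) / h%:C) + z a) ((0 : R)%:C * l + z a).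
  apply: ccvgD; last exact: ccvg_cst.
  by apply: ccvgM => //; apply: ccvg_real; exact: cvg_within.
rewrite mul0r add0r in h1; apply: ccvg_near_eq h1.
near=> h; have h0 : h != 0 by near: h; exact: nbhs_dnbhs_neq.
by rewrite mulrC divfK ?subrK // realC_eq0.
Unshelve. all: by end_near. Qed.

Lemma cder_cst (c : C) a : cder (fun=> c) a 0.
Proof.
by rewrite /cder; under [X in ccvg _ X]eq_fun do rewrite subrr mul0r; exact: ccvg_cst.
Qed.

Lemma cderB f g a l m : cder f a l -> cder g a m -> cder (fun t => f t - g t) a (l - m).
Proof.
move=> hf hg; apply: ccvg_near_eq (ccvgB hf hg); apply: nearW => h; ring.
Qed.

Lemma cderM f g a l m : cder f a l -> cder g a m -> cder (fun t => f t * g t) a (l * g a + f a * m).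
Proof.
move=> hf hg.
apply: ccvg_near_eq (ccvgD (ccvgM hf (cder_cvg hg)) (ccvgM (ccvg_cst (f a)) hg)).
by apply: nearW => h; ring.
Qed.

Lemma cderV f a l : f a != 0 -> cder f a l -> cder (fun t => (f t)^-1) a (- l / (f a * f a)).
Proof.
move=> f0 hf.
have h1 : ccvg (0 : R)^' (fun h => - ((f (h + a) - f a) / h%:C) / (f (h + a) * f a)) (- l / (f a * f a)).
  apply: ccvg_div; first by rewrite mulf_neq0.
    exact: ccvgN.
  by apply: ccvgM; [exact: (cder_cvg hf)|exact: ccvg_cst].
apply: ccvg_near_eq h1; near=> h.
have fh : f (h + a) != 0 by near: h; exact: (ccvg_near_neq0 f0 (cder_cvg hf)).
have h0 : h%:C != 0 :> C by rewrite realC_eq0; near: h; exact: nbhs_dnbhs_neq.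
by field; rewrite f0 fh h0.
Unshelve. all: by end_near. Qed.

Lemma cder_div f g a l m : g a != 0 -> cder f a l -> cder g a m ->
  cder (fun t => f t / g t) a (l / g a - f a * m / (g a * g a)).
Proof.
by move=> g0 hf hg; have := cderM hf (cderV g0 hg); rewrite mulrA mulrN mulNr.
Qed.

Lemma cderX f a l n : cder f a l -> cder (fun t => f t ^+ n) a (n%:R * f a ^+ n.-1 * l).
Proof.
move=> hf; elim: n => [|n IH].
  by rewrite !mul0r; exact: cder_cst.
have := cderM hf IH.
have -> : l * f a ^+ n + f a * (n%:R * f a ^+ n.-1 * l) = n.+1%:R * f a ^+ n * l.
  case: n {IH} => [|n] /=; first by rewrite !expr0 !mul0r mulr0 addr0 mulr1 !mul1r.
  by rewrite -[n.+2]add1n natrD [f a ^+ n.+1]exprS; ring.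
by apply: ccvg_near_eq; apply: nearW => h; rewrite !exprS.
Qed.

Lemma Re_divC z (h : R) : Re (z / h%:C) = Re z / h.
Proof. by rewrite -fmorphV /= ReM ReC ImC mulr0 subr0. Qed.

Lemma Im_divC z (h : R) : Im (z / h%:C) = Im z / h.
Proof. by rewrite -fmorphV /= ImM ReC ImC mulr0 add0r. Qed.

Lemma cder_expi a : cder expi a ('i%C * expi a).
Proof.
split.
  have -> : Re ('i%C * expi a) = - sin a by rewrite !ReImE; ring.
  under eq_fun do rewrite Re_divC ReD ReN !Re_expi.
  exact: is_derive_slope.
have -> : Im ('i%C * expi a) = cos a by rewrite !ReImE; ring.
under eq_fun do rewrite Im_divC ImD ImN !Im_expi.
exact: is_derive_slope.
Qed.

(* The mean value theorem is applied on segments, which meet the real axis, where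
   [dilog] vanishes but its Clausen terms are not differentiable, at most once or
   are contained in it. *)
Lemma dilog_cder (z : R -> C) a l : z a != 0 -> z a != 1 -> cder z a l ->
  is_derive a 1 (fun u => dilog (z u)) (dilog_grad (z a) l).
Proof.
move=> z0 z1 dz; apply: slope_is_derive; have cz := cder_cvg dz.
set w := z a in z0 z1 cz *.
pose P h (t : R) := 0 <= t <= 1 /\ dilog (z (h + a)) - dilog w =
   dilog_grad (w + t%:C * (z (h + a) - w)) (z (h + a) - w).
(* Within distance e of w there is neither 0 nor 1, and no real point unless w is real. *)
pose e := Num.min (cmod w) (Num.min (cmod (w - 1)) (if Im w == 0 then 1 else `|Im w|)).
have e0 : 0 < e.
  rewrite !lt_min !cmod_gt0 z0 subr_eq0 z1 /=.
  by case: ifP => // /negbT; rewrite normr_gt0.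
have ex : \forall h \near (0 : R)^', exists t, P h t.
  near=> h.
  have ch : cmod (z (h + a) - w) < e by near: h; exact: ccvg_near.
  have cp t : 0 <= t <= 1 -> cmod (t%:C * (z (h + a) - w)) < e.
    move=> /andP[t0 t1]; rewrite cmodM cmodC (ger0_norm t0).
    by rewrite (le_lt_trans _ ch) // ler_piMl // cmod_ge0.
  have [t t01 et] : exists2 t, 0 <= t <= 1 &
     dilog (z (h + a)) - dilog w = dilog_grad (w + t%:C * (z (h + a) - w)) (z (h + a) - w).
    apply: dilog_MVT.
      move=> t /cp; rewrite !lt_min => /and3P[c1 c2 _]; split.
        by apply: contraTneq c1 => /eqP; rewrite addrC addr_eq0 => /eqP ->; rewrite cmodN ltxx.
      apply: contraTneq c2 => /(canRL (addKr w)) ->.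
      by rewrite addrC -opprB cmodN ltxx.
    have [/eqP iw|iw] := boolP (Im w == 0); first by left.
    right => t /cp; rewrite !lt_min (negbTE iw) => /and3P[_ _ c3].
    rewrite ImD; apply: contraTneq c3 => /eqP; rewrite addrC addr_eq0 => /eqP im.
    by rewrite -leNgt -normrN -im Im_le_cmod.
  by exists t.
(* One mean value point is chosen for each h. The points [xi h] tend to w, and [dilog_grad] is
   continuous at w even when w is real. *)
pose tau h := xget 0 [set t | P h t].
have Ptau : \forall h \near (0 : R)^', P h (tau h).
  by apply: filterS ex => h [t Pt]; exact: (@xgetI _ 0 [set t | P h t] t Pt).
pose xi h := w + (tau h)%:C * (z (h + a) - w).
have cxi : ccvg (0 : R)^' xi w.
  apply: ccvg0; apply: (@squeeze_cvgr _ (0 : R)^' _ _ (fun=> 0) (fun h => cmod (z (h + a) - w))) => //.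
  - apply: filterS Ptau => h [/andP[t0 t1] _]; rewrite cmod_ge0 /= /xi addrC addKr.
    by rewrite cmodM cmodC (ger0_norm t0) ler_piMl // cmod_ge0.
  - exact: cvg_cst.
  - exact: ccvgP.
apply: cvg_trans (dilog_grad_cvg z0 z1 cxi dz); apply: near_eq_cvg.
near=> h; have h0 : h != 0 by near: h; exact: nbhs_dnbhs_neq.
have [_ ->] : P h (tau h) by near: h.
rewrite -/(xi h) -{2}(divfK (_ : h%:C != 0) (z (h + a) - w)); last by rewrite realC_eq0.
by rewrite [X in _ = dilog_grad _ X / _]mulrC dilog_gradZ mulrAC divff // mul1r.
Unshelve. all: by end_near. Qed.

Lemma BWV z : cmod z = 1 -> BlochWigner z^-1 = - BlochWigner z.
Proof. by move=> /unit_polar ->; rewrite -expiN -!/(claus _) clausN. Qed.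

Lemma cmod_phase1 z : z != 0 -> cmod (z / conjc z) = 1.
Proof. by move=> z0; rewrite cmodM cmodV cmod_conj divff // cmod_eq0. Qed.

Lemma phaseBW_conj z : z != 0 -> phaseBW (conjc z) = - phaseBW z.
Proof.
by move=> z0; rewrite /phaseBW conjcK -BWV ?cmod_phase1 // invf_div.
Qed.

Lemma dilog_conj z : z != 0 -> z != 1 -> dilog (conjc z) = - dilog z.
Proof.
move=> z0 z1; have z1' : z - 1 != 0 by rewrite subr_eq0.
have z1'' : 1 - z != 0 by rewrite subr_eq0 eq_sym.
have c1 : conjc (1 : C) = 1 := conjc1 R.
have e1 : (conjc z - 1) / conjc z = conjc ((z - 1) / z) by rewrite conjc_mul conjc_sub conjc_inv c1.
have e2 : (1 - conjc z)^-1 = conjc (1 - z)^-1 by rewrite conjc_inv conjc_sub c1.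
rewrite /dilog e1 e2 !phaseBW_conj ?invr_eq0 //.
  by rewrite -!opprD mulNr.
by rewrite mulf_neq0 // invr_eq0.
Qed.

(** The argument of e^(it) - 1 is t/2 + pi/2, so the Clausen terms are claus(2t) and twice - claus(t
    + pi); the duplication formula leaves claus t. *)
Lemma dilog_expi t : 0 < t < 2 * pi -> dilog (expi t) = claus t.
Proof.
move=> t02; case/andP: (t02) => t0 t2.
have s0 : 2 * sin (t / 2) != 0.
  by rewrite mulf_neq0 // gt_eqF // sin_gt0_pi //; apply/andP; split; lra.
have e2 : expi t - 1 = (2 * sin (t / 2))%:C * expi (t / 2 + pi / 2) :> C.
  rewrite expi_sub1 expiD -mulrA; congr (_ * _); rewrite mulrC; congr (_ * _).
  by rewrite /expi cos_pihalf sin_pihalf.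
have e1 : expi t = (1 : R)%:C * expi t :> C by rewrite mul1r.
rewrite (dilog_polar (oner_neq0 R) s0 e1 e2) claus_dup ?ltW //.
have -> : claus (2 * (t / 2 + pi / 2 - t)) = - claus (t + pi).
  by rewrite -clausN -[RHS]claus_period; congr claus; field.
have -> : claus (2 * - (t / 2 + pi / 2)) = - claus (t + pi).
  by rewrite -clausN; congr claus; field.
by field.
Qed.

(** Inscribed angle theorem: the triangle 1, x, y lies on the unit circle, so its doubled angles are
    arcs and the Clausen terms are those of the volume. *)
Lemma dilog_inscribed x y : cmod x = 1 -> cmod y = 1 -> x != 1 -> y != 1 -> x != y ->
  dilog ((y - 1) / (y - x)) = - (BlochWigner x - BlochWigner y + BlochWigner (y / x)) / 2.
Proof.
move=> x1 y1 xn yn xy; have x0 := cmod1_neq0 x1; have y0 := cmod1_neq0 y1.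
have xn' : x - 1 != 0 by rewrite subr_eq0.
have yn' : y - 1 != 0 by rewrite subr_eq0.
have xy' : y - x != 0 by rewrite subr_eq0 eq_sym.
have c1 : conjc (1 : C) = 1 := conjc1 R.
have cx := cmod1_conj x1; have cy := cmod1_conj y1.
have cyx : conjc (y - x) = - (y - x) / (x * y).
  by rewrite conjc_sub cx cy; field; rewrite x0 y0.
have cx1 : conjc (x - 1) = - (x - 1) / x by rewrite conjc_sub cx c1; field.
have cy1 : conjc (y - 1) = - (y - 1) / y by rewrite conjc_sub cy c1; field.
set z := (y - 1) / (y - x).
have p1 : phaseBW z = - BlochWigner x.
  rewrite -BWV // /phaseBW /z conjc_mul conjc_inv cyx cy1; congr BlochWigner.
  by field; rewrite ?x0 ?y0 ?xy' ?yn'.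
have p2 : phaseBW ((z - 1) / z) = - BlochWigner (y / x).
  rewrite -BWV ?cmodM ?cmodV ?x1 ?y1 ?divr1 //.
  have -> : (z - 1) / z = (x - 1) / (y - 1) by rewrite /z; field; rewrite ?yn' ?xy'.
  rewrite /phaseBW conjc_mul conjc_inv cx1 cy1; congr BlochWigner.
  by field; rewrite ?x0 ?y0 ?xn' ?yn'.
have p3 : phaseBW (1 - z)^-1 = BlochWigner y.
  have -> : (1 - z)^-1 = - (y - x) / (x - 1).
    have -> : 1 - z = (1 - x) / (y - x) by rewrite /z; field.
    by rewrite invf_div -(opprB x 1) invrN mulrN mulNr.
  rewrite /phaseBW conjc_mul conjc_inv cx1 -[conjc (- _)]opprK; congr BlochWigner.
  have -> : conjc (- (y - x)) = - conjc (y - x) by exact: (rmorphN (@conjc R)).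
  by rewrite cyx; field; rewrite ?x0 ?y0 ?xn' ?xy'.
by rewrite /dilog p1 p2 p3; field.
Qed.

(** Uniformity over all principal arguments is needed because arg(z - 1) is uncontrolled as z tends
    to 1. *)
Lemma claus_uniform (e : R) : 0 < e ->
  \forall u \near (0 : R), forall x : R, - pi <= x <= pi -> `|claus (2 * (x - u)) - claus (2 * x)| < e.
Proof.
move=> e0.
have /compact_near_coveringP H := @segment_compact R (- pi) pi.
pose P (u x : R) := `|claus (2 * (x - u)) - claus (2 * x)| < e.
have H1 : \forall u \near nbhs (0 : R), `[- pi, pi]%classic `<=` P u.
  apply: H => x _.
  have c : claus (2 * (p.1 - p.2)) - claus (2 * p.1) @[p --> filter_prod (nbhs x) (nbhs (0 : R))]
      --> claus (2 * (x - 0)) - claus (2 * x).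
    apply: cvgB; apply: continuous_cvg; try exact: claus_continuous.
      by apply: cvgM; [exact: cvg_cst|apply: cvgB; [exact: cvg_fst|exact: cvg_snd]].
    by apply: cvgM; [exact: cvg_cst|exact: cvg_fst].
  by rewrite subr0 subrr in c; move/cvgr0Pnorm_lt : c; apply.
by apply: filterS H1 => u h x hx; apply: (h x); rewrite /= in_itv.
Qed.

Lemma carg_range z : - pi <= carg z <= pi.
Proof.
have p0 := @pi_ge0 R.
rewrite /carg; have [_|z0] := eqVneq z 0; first by rewrite p0 oppr_le0 p0.
have m0 : 0 < cmod z by rewrite cmod_gt0.
have c1 : -1 <= Re z / cmod z <= 1.
  have := Re_le_cmod z; rewrite ler_norml => /andP[h1 h2].
  by rewrite ler_pdivlMr // ler_pdivrMr // mul1r mulN1r h1 h2.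
have := acos_ge0 c1; have := acos_lepi c1; case: ifP => _; lra.
Qed.

Lemma carg1 : carg (1 : C) = 0.
Proof. by rewrite /carg oner_eq0 /= lexx cmod1 divr1 acos1. Qed.

(** Writing al = arg z and be = arg(z - 1), the two terms containing be, claus(2 (be - al)) and -
    claus(2 be), cancel as al tends to 0, whatever be does. *)
Lemma dilog_cvg1 {T : Type} {F : set_system T} {FF : Filter F} (f : T -> C) :
  ccvg F f 1 -> (\forall t \near F, f t != 1) -> dilog (f t) @[t --> F] --> (0 : R).
Proof.
move=> hf f1; have n10 : (1 : C) != 0 := oner_neq0 _.
have ca : local_arg 1 (f t) @[t --> F] --> (0 : R) by rewrite -carg1; exact: local_arg_cvg.
have cc : claus (2 * local_arg 1 (f t)) @[t --> F] --> (0 : R).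
  have z0 : claus (2 * 0 : R) = 0 by rewrite claus_sin0 // mulr0 sin0.
  rewrite -z0; apply: continuous_cvg; first exact: claus_continuous.
  by apply: cvgM => //; exact: cvg_cst.
apply/cvgr0Pnorm_lt => e e0.
have U := ca _ (claus_uniform e0); have cc' := (cvgr0Pnorm_lt _).1 cc e e0.
near=> t.
have re : 0 < Re (f t / 1) by near: t; exact: local_arg_near.
have ft1 : f t - 1 != 0 by rewrite subr_eq0; near: t.
have ft0 : cmod (f t) != 0.
  by rewrite cmod_eq0; apply: contraTneq re => ->; rewrite mul0r ltxx.
have ft1' : cmod (f t - 1) != 0 by rewrite cmod_eq0.
have h1 : `|claus (2 * local_arg 1 (f t))| < e by near: t; exact: (cc' FF).
have h2 : `|claus (2 * (carg (f t - 1) - local_arg 1 (f t))) - claus (2 * carg (f t - 1))| < e.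
  have : forall x : R, - pi <= x <= pi ->
     `|claus (2 * (x - local_arg 1 (f t))) - claus (2 * x)| < e by near: t.
  by apply; exact: carg_range.
rewrite (dilog_polar ft0 ft1' (local_argE n10 re) (polar ft1)).
rewrite mulrN clausN -addrA normrM (ger0_norm (_ : 0 <= 2^-1)) ?invr_ge0 //.
set al := local_arg 1 (f t) in h1 h2 *; set be := carg (f t - 1) in h2 *.
have := ler_normD (claus (2 * al)) (claus (2 * (be - al)) - claus (2 * be)); lra.
Unshelve. all: by end_near. Qed.

End Dilogarithm.

(** * The primitive along the curve and its sum over the outer roots *)

Section Primitive.
Context {R : realType}.
Local Notation C := R[i].
Variable d : nat.
Hypothesis d0 : (0 < d)%N.
Implicit Types (x y z : C) (a : R).

Local Notation hpoly := (@hpoly R d).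
Local Notation hroots := (@hroots R d).
Local Notation bigroots := (@bigroots R d).
Local Notation branch := (@branch R d).
Local Notation n := d.+2.

(** The shape of the triangle 1, x, y: the quotient of its two sides at y. *)
Definition triangle x y : C := (y - 1) / (y - x).

(* Along the curve [h(x, y) = 0], [|x| = 1], this is a primitive of
   [n (n - 1) ln |y| d(arg x)]. *)
Definition prim a y : R :=
  n%:R * (claus a - dilog y + dilog (y / expi a))
  + dilog (triangle (expi a) y) - dilog (expi a ^+ n * triangle (expi a) y).

Definition outer a : seq C := [seq y <- hroots (expi a) | 1 < cmod y].

Definition Phi a : R := \sum_(y <- outer a) ln (cmod y).

Definition Psi a : R := \sum_(y <- outer a) prim a y.

Lemma big_root a y : y \in bigroots (expi a) ->
  [/\ 1 <= cmod y, (hpoly (expi a)).[y] = 0, y != 0, y != 1 & y != expi a].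
Proof.
rewrite mem_filter => /andP[y1]; rewrite mem_hroots => /eqP e; split => //.
- by rewrite -cmod_gt0 (lt_le_trans _ y1).
- by apply: root_neq1 e; exact: cmod_expi.
- by apply: root_neq_diag e; rewrite cmod_expi.
Qed.

Lemma branch_id a y : y \in hroots (expi a) -> branch y a = y.
Proof.
move=> yr; have [_ /(_ y yr)] := nearestP y (hroots_neq0 d0 (expi a)).
rewrite subrr cmod0 => h; apply/esym/eqP; rewrite -subr_eq0 -cmod_eq0.
by rewrite eq_le h cmod_ge0.
Qed.

Lemma branchP y a : (hpoly (expi a)).[branch y a] = 0.
Proof. by apply/eqP; rewrite -mem_hroots branch_root. Qed.

Lemma cvg_shift (a : R) : h + a @[h --> (0 : R)^'] --> a.
Proof.
rewrite -{2}[a]add0r; apply: cvgD; last exact: cvg_cst.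
exact: cvg_within.
Qed.

(** Implicit differentiation of g y = g x with x = e^(ia): y' = x' g'(x) / g'(y), where g'(z) = h(z,
    z). *)
Definition branch_slope a y : C := 'i%C * expi a * (hpoly (expi a)).[expi a] / (hpoly y).[y].

(** The increments of g along x and along the branch agree, so (y_h - y) h(y, y_h) = (x_h - x) h(x,
    x_h) holds exactly and only quotients of limits are needed. *)
Lemma branch_cder a y : y \in bigroots (expi a) -> cder (branch y) a (branch_slope a y).
Proof.
move=> yb; have [y1 ey y0 yn1 yx] := big_root yb.
have yr : y \in hroots (expi a) by move: yb; rewrite mem_filter => /andP[].
have cy : ccvg (0 : R)^' (fun h => branch y (h + a)) y.
  have [c1 c2] := branch_cvg d0 yr.
  by split; [apply: (cvg_comp _ _ (@cvg_shift a) c1)|apply: (cvg_comp _ _ (@cvg_shift a) c2)].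
have cx := cder_cvg (cder_expi a).
have hy0 := hpoly_diag_neq0 d y1.
have ch : ccvg (0 : R)^' (fun h => (hpoly y).[branch y (h + a)]) (hpoly y).[y].
  by apply: ccvg_hpoly => //; exact: ccvg_cst.
have h1 : ccvg (0 : R)^' (fun h => (expi (h + a) - expi a) / h%:C * (hpoly (expi a)).[expi (h + a)]
    / (hpoly y).[branch y (h + a)]) (branch_slope a y).
  apply: (ccvg_div hy0 _ ch); apply: ccvgM; first exact: cder_expi.
  by apply: ccvg_hpoly => //; exact: ccvg_cst.
apply: ccvg_near_eq h1; near=> h.
have hn : (hpoly y).[branch y (h + a)] != 0 by near: h; exact: (ccvg_near_neq0 hy0 ch).
rewrite (branch_id yr); apply: (mulIf hn); rewrite divfK //.
rewrite mulrAC hpolyB mulrAC hpolyB; congr (_ / _).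
by rewrite (geom_root ey) (geom_root (branchP y (h + a))).
Unshelve. all: by end_near. Qed.

Lemma ccvg_unique {T : Type} {F : set_system T} {FF : ProperFilter F} (f : T -> C) l m :
  ccvg F f l -> ccvg F f m -> l = m.
Proof.
move=> [h1 h2] [k1 k2]; apply: complexP.
  by rewrite -(cvg_lim (@Rhausdorff R) h1) -(cvg_lim (@Rhausdorff R) k1).
by rewrite -(cvg_lim (@Rhausdorff R) h2) -(cvg_lim (@Rhausdorff R) k2).
Qed.

(** Uses (y - 1)(x^n - 1) = (x - 1)(y^n - 1). Thus the twisted triangle minus 1 has only the factors
    x - 1, y and y - x, which makes its logarithmic derivative computable. *)
Lemma triangle_twist x y : y != x -> (hpoly x).[y] = 0 ->
  x ^+ n * triangle x y - 1 = (x - 1) * y ^+ n / (y - x).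
Proof.
move=> yx e; have yx' : y - x != 0 by rewrite subr_eq0.
have g : (y - 1) * (x ^+ n - 1) = (x - 1) * (y ^+ n - 1).
  by rewrite -!geomE (geom_root e); ring.
apply: (mulIf yx'); rewrite divfK // mulrBl mul1r /triangle mulrA divfK //.
have -> : x ^+ n * (y - 1) = (y - 1) * (x ^+ n - 1) + (y - 1) by ring.
by rewrite g; ring.
Qed.

Lemma prim_derive a y : expi a != 1 :> C -> y \in bigroots (expi a) ->
  is_derive a 1 (fun u => prim u (branch y u)) (n%:R * d.+1%:R * ln (cmod y)).
Proof.
move=> x1 yb; have [yge1 ey y0 yn1 yx] := big_root yb.
have yr : y \in hroots (expi a) by move: yb; rewrite mem_filter => /andP[].
have dy := branch_cder yb; have dx := cder_expi a; have by_ := branch_id yr.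
set y' := branch_slope a y in dy; set x := expi a in x1 yb ey yx yr dx *.
set x' := 'i%C * x in dx.
have x0 : x != 0 := expi_neq0 a.
have mx : cmod x = 1 := cmod_expi a.
have yx' : y - x != 0 by rewrite subr_eq0.
have y1' : y - 1 != 0 by rewrite subr_eq0.
have x1' : x - 1 != 0 by rewrite subr_eq0.
have xn0 : x ^+ n != 0 by rewrite expf_neq0.
have yn0 : y ^+ n != 0 by rewrite expf_neq0.
have D1 : is_derive a 1 (@claus R) (- ln (cmod (x - 1))).
  by rewrite cmodB; apply: claus_derive; exact: cos_neq1.
have D2 : is_derive a 1 (fun u => dilog (branch y u)) (dilog_grad y y').
  by have := dilog_cder _ _ dy; rewrite by_; apply.
have ndx : branch y a / expi a != 0 by rewrite by_ mulf_neq0 // invr_eq0.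
have c3 : cder (fun u => branch y u / expi u) a (y' / x - y * x' / (x * x)).
  by have := cder_div x0 dy dx; rewrite by_.
have v3 : y / x - 1 = (y - x) / x by rewrite mulrBl divff.
have yx0 : y / x != 0 by rewrite mulf_neq0 // invr_eq0.
have yx1 : y / x != 1 by rewrite -subr_eq0 v3 mulf_neq0 // invr_eq0.
have D3 : is_derive a 1 (fun u => dilog (branch y u / expi u)) (dilog_grad (y / x) (y' / x - y * x' / (x * x))).
  by have := dilog_cder _ _ c3; rewrite by_; apply.
have cB : cder (fun u => branch y u - expi u) a (y' - x') by exact: cderB.
have cy1 : cder (fun u => branch y u - 1) a y'.
  by have := cderB dy (cder_cst 1 a); rewrite subr0.
have cx1 : cder (fun u => expi u - 1) a x'.
  by have := cderB dx (cder_cst 1 a); rewrite subr0.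
have cS : cder (fun u => triangle (expi u) (branch y u)) a
    (y' / (y - x) - (y - 1) * (y' - x') / ((y - x) * (y - x))).
  by have := cder_div _ cy1 cB; rewrite by_; apply.
set S := triangle x y; set S' := y' / (y - x) - _ in cS.
have vS1 : S - 1 = (x - 1) / (y - x) by rewrite /S /triangle; field.
have S0 : S != 0 by rewrite mulf_neq0 // invr_eq0.
have S1 : S != 1 by rewrite -subr_eq0 vS1 mulf_neq0 // invr_eq0.
have D4 : is_derive a 1 (fun u => dilog (triangle (expi u) (branch y u))) (dilog_grad S S').
  by have := dilog_cder _ _ cS; rewrite by_; apply.
have cT : cder (fun u => expi u ^+ n * triangle (expi u) (branch y u)) a
    (n%:R * x ^+ d.+1 * x' * S + x ^+ n * S').
  by have := cderM (cderX n dx) cS; rewrite by_.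
(* A second derivative formula for T = x^n S, now through T - 1. The first gives T'/T, this one
   T'/(T - 1), and uniqueness of limits equates the two values of T'. *)
have cT2 : cder (fun u => expi u ^+ n * triangle (expi u) (branch y u)) a
    ((x' * y ^+ n + (x - 1) * (n%:R * y ^+ d.+1 * y')) / (y - x)
       - (x - 1) * y ^+ n * (y' - x') / ((y - x) * (y - x))).
  have := cder_div _ (cderM cx1 (cderX n dy)) cB; rewrite by_ => /(_ yx').
  apply: ccvg_near_eq; apply: nearW => h; congr (_ / _).
  have nb u : branch y u != expi u.
    by apply: root_neq_diag (branchP y u); rewrite cmod_expi.
  rewrite -(triangle_twist (nb _) (branchP y _)).
  by rewrite -(triangle_twist (nb a) (branchP y a)); ring.
have eqT := @ccvg_unique _ (0 : R)^' _ _ _ _ cT cT2.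
set T' := n%:R * x ^+ d.+1 * x' * S + _ in cT eqT.
set T := x ^+ n * S.
have vT1 : T - 1 = (x - 1) * y ^+ n / (y - x) by exact: triangle_twist.
have T0 : T != 0 by rewrite mulf_neq0.
have T1 : T != 1.
  by rewrite -subr_eq0 vT1; apply: mulf_neq0; [exact: mulf_neq0|rewrite invr_eq0].
have D5 : is_derive a 1 (fun u => dilog (expi u ^+ n * triangle (expi u) (branch y u))) (dilog_grad T T').
  by have := dilog_cder _ _ cT; rewrite by_; apply.
apply: (is_derive_eq (is_derive1B (is_derive1D (is_derive1M (is_derive1c a n%:R)
   (is_derive1D (is_derive1B D1 D2) D3)) D4) D5)).
have lny z : z != 0 -> cmod z \is Num.pos by rewrite posrE cmod_gt0.
have l3 : ln (cmod (y / x)) = ln (cmod y) by rewrite cmodM cmodV mx divr1.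
have l3' : ln (cmod (y / x - 1)) = ln (cmod (y - x)) by rewrite v3 cmodM cmodV mx divr1.
have lS : ln (cmod S) = ln (cmod (y - 1)) - ln (cmod (y - x)).
  by rewrite /S /triangle cmodM cmodV ln_div ?lny.
have lS1 : ln (cmod (S - 1)) = ln (cmod (x - 1)) - ln (cmod (y - x)).
  by rewrite vS1 cmodM cmodV ln_div ?lny.
have lT : ln (cmod T) = ln (cmod (y - 1)) - ln (cmod (y - x)).
  by rewrite /T cmodM cmodX mx expr1n mul1r.
have lT1 : ln (cmod (T - 1)) = ln (cmod (x - 1)) + n%:R * ln (cmod y) - ln (cmod (y - x)).
  have xyn : (x - 1) * y ^+ n != 0 by exact: mulf_neq0.
  rewrite vT1 cmodM cmodV (ln_div (lny _ xyn) (lny _ yx')) cmodM (lnM (lny _ x1') (lny _ yn0)).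
  by rewrite cmodX lnXn ?cmod_gt0 // [n%:R * _]mulr_natl.
have i3 : (y' / x - y * x' / (x * x)) / (y / x - 1) = (y' - x') / (y - x) - 'i%C.
  by rewrite v3 /x'; field; rewrite x0 yx'.
have i3' : (y' / x - y * x' / (x * x)) / (y / x) = y' / y - 'i%C.
  by rewrite /x'; field; rewrite x0 y0.
have iS : S' / S = y' / (y - 1) - (y' - x') / (y - x).
  by rewrite /S' /S /triangle; field; rewrite yx' y1'.
have iS1 : S' / (S - 1) = x' / (x - 1) - (y' - x') / (y - x).
  by rewrite vS1 /S'; field; rewrite yx' x1'.
have iT : T' / T = (n%:R : R)%:C * 'i%C + (y' / (y - 1) - (y' - x') / (y - x)).
  rewrite -iS /T' /T [x ^+ n]exprSr /x' rmorph_nat.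
  by field; rewrite x0 S0 expf_neq0.
have iT1 : T' / (T - 1) = (n%:R : R)%:C * (y' / y) + (x' / (x - 1) - (y' - x') / (y - x)).
  rewrite eqT vT1 [y ^+ n]exprSr rmorph_nat.
  by field; rewrite x1' yx' y0 expf_neq0.
(* What remains is bilinear in four logarithms of moduli and four imaginary parts of logarithmic
   derivatives, all treated as free variables. *)
rewrite /dilog_grad l3 l3' lS lS1 lT lT1 i3 i3' iS iS1 iT iT1.
have ImCM (r : R) z : Im (r%:C * z) = r * Im z by rewrite ImM ReC ImC mul0r addr0.
have nE : n%:R = d.+1%:R + 1 :> R by rewrite natr1.
rewrite !(ImD, ImN, ImCM, Im_i) nE.
move: (ln (cmod y)) (ln (cmod (y - 1))) (ln (cmod (x - 1))) (ln (cmod (y - x))).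
move: (Im (y' / y)) (Im (y' / (y - 1))) (Im (x' / (x - 1))) (Im ((y' - x') / (y - x))).
move: (_ - _ + _) => c i1 i2 i3'' i4 l1 l2 l3'' l4; ring.
Qed.

(** The filter is applied after following the branch: a branch that starts on the circle may be
    outside on one side of a0 only. *)
Lemma perm_outer (a0 : R) : \forall a \near a0,
  perm_eq [seq y <- [seq branch z a | z <- bigroots (expi a0)] | 1 < cmod y] (outer a).
Proof.
have := branches_near d0 a0; apply: filterS => a [inj sur].
have sub y : 1 < cmod y -> (y \in outer a) = (y \in bigroots (expi a)).
  by move=> y1; rewrite !mem_filter y1 (ltW y1).
apply: uniq_perm.
- by rewrite filter_uniq // map_inj_in_uniq // bigroots_uniq.
- have -> : outer a = [seq y <- bigroots (expi a) | 1 < cmod y].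
    rewrite /outer /bigroots -filter_predI; apply: eq_filter => y /=.
    by case: ltP => // /ltW ->.
  by rewrite filter_uniq // bigroots_uniq.
move=> y; rewrite mem_filter; have [y1|y1] := boolP (1 < cmod y); last first.
  by rewrite mem_filter (negbTE y1).
rewrite sub //=; apply/mapP/idP => [[z zb yz]|/sur [z zb ->]]; last by exists z.
by rewrite mem_filter (ltW y1) yz branch_root.
Qed.

Lemma sum_outer (f : R -> C -> R) (a0 : R) : \forall a \near a0,
  \sum_(y <- outer a) f a y =
  \sum_(z <- bigroots (expi a0) | 1 < cmod (branch z a)) f a (branch z a).
Proof.
apply: filterS (perm_outer a0) => a h.
by rewrite -(perm_big _ h) big_filter big_map.
Qed.

Lemma is_derive1_sum (I : eqType) (s : seq I) (f : I -> R -> R) (g : I -> R) a :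
  (forall i, i \in s -> is_derive a 1 (f i) (g i)) ->
  is_derive a 1 (fun u => \sum_(i <- s) f i u) (\sum_(i <- s) g i).
Proof.
elim: s => [|i s IH] h.
  by rewrite big_nil; under eq_fun do rewrite big_nil; exact: is_derive1c.
rewrite big_cons; under eq_fun do rewrite big_cons.
apply: is_derive1D; first by apply: h; rewrite mem_head.
by apply: IH => j js; apply: h; rewrite inE js orbT.
Qed.

Lemma cvg_sum_seq (I : eqType) {T : Type} {F : set_system T} {FF : Filter F}
    (s : seq I) (P : pred I) (f : I -> T -> R) (g : I -> R) :
  (forall i, i \in s -> P i -> f i t @[t --> F] --> g i) ->
  \sum_(i <- s | P i) f i t @[t --> F] --> \sum_(i <- s | P i) g i.
Proof.
elim: s => [|i s IH] h.
  by rewrite big_nil; under eq_fun do rewrite big_nil; exact: cvg_cst.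
rewrite big_cons; under eq_fun do rewrite big_cons.
have {}IH : \sum_(i <- s | P i) f i t @[t --> F] --> \sum_(i <- s | P i) g i.
  by apply: IH => j js; apply: h; rewrite inE js orbT.
by case: ifP => Pi //; apply: cvgD => //; apply: h => //; rewrite mem_head.
Qed.

Lemma branch_cmod_cvg (a0 : R) z : z \in bigroots (expi a0) -> cmod (branch z a) @[a --> a0] --> cmod z.
Proof.
rewrite mem_filter => /andP[_ zr]; apply: ccvg_cmod; exact: (branch_cvg d0 zr).
Qed.

Lemma Psi_derive a0 : expi a0 != 1 :> C -> (forall z, z \in hroots (expi a0) -> cmod z != 1) ->
  is_derive a0 1 Psi (n%:R * d.+1%:R * Phi a0).
Proof.
move=> x1 reg.
have out z : z \in bigroots (expi a0) -> 1 < cmod z.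
  by rewrite mem_filter => /andP[z1 /reg zn]; rewrite lt_neqAle eq_sym zn.
have near1 : \forall a \near a0, forall z, z \in bigroots (expi a0) -> 1 < cmod (branch z a).
  apply: (@near_seq _ (nbhs a0) _ _ _ (fun z a => 1 < cmod (branch z a))) => z zb.
  have := branch_cmod_cvg zb; move/cvgr_gt => /(_ 1); apply; exact: out.
have -> : Phi a0 = \sum_(z <- bigroots (expi a0)) ln (cmod z).
  rewrite /Phi; congr bigop; apply: eq_in_filter => z zr.
  by rewrite le_eqVlt eq_sym (negbTE (reg z zr)).
rewrite mulr_sumr.
have ds : is_derive a0 1 (fun u => \sum_(z <- bigroots (expi a0)) prim u (branch z u))
    (\sum_(z <- bigroots (expi a0)) n%:R * d.+1%:R * ln (cmod z)).
  by apply: is_derive1_sum => z zb; exact: prim_derive.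
apply: near_eq_is_derive ds.
apply: filterS2 near1 (sum_outer prim a0) => a h1 h2.
by rewrite /Psi h2 [RHS]big_seq_cond [LHS]big_seq; apply: eq_bigl => z; rewrite andb_idr // => /h1.
Qed.

(** Meant for one-sided filters; [P] records which branches are outside on that side. *)
Lemma Psi_lim (F : set_system R) (FF : Filter F) (a0 : R) (P : pred C) : F `=>` nbhs a0 ->
  expi a0 != 1 :> C ->
  (forall z, z \in bigroots (expi a0) -> \forall a \near F, (1 < cmod (branch z a)) = P z) ->
  Psi a @[a --> F] --> \sum_(z <- bigroots (expi a0) | P z) prim a0 z.
Proof.
move=> Fa x1 hP.
have c : \sum_(z <- bigroots (expi a0) | P z) prim a (branch z a) @[a --> F] -->
    \sum_(z <- bigroots (expi a0) | P z) prim a0 z.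
  apply: cvg_sum_seq => z zb _.
  have zr : z \in hroots (expi a0) by move: zb; rewrite mem_filter => /andP[].
  have H : prim u (branch z u) @[u --> a0] --> prim a0 (branch z a0).
    exact: is_derive1_cvg (prim_derive x1 zb).
  by rewrite (branch_id zr) in H; apply: cvg_trans H; exact: cvg_app.
apply: cvg_trans c; apply: near_eq_cvg.
have nP : \forall a \near F, forall z, z \in bigroots (expi a0) -> (1 < cmod (branch z a)) = P z.
  exact: (@near_seq _ F _ _ _ (fun z a => (1 < cmod (branch z a)) = P z) hP).
apply: filterS2 nP (Fa _ (sum_outer prim a0)) => a h1 h2.
rewrite /Psi h2 [RHS]big_seq_cond [LHS]big_seq_cond; apply: eq_bigl => z.
by apply: andb_id2l => /h1.
Qed.

(** As x tends to 1, S and T tend to 1 and their dilogarithms to 0 by [dilog_cvg1], while dilog(y/x)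
    and dilog y cancel. *)
Lemma Psi_lim1 (F : set_system R) (FF : Filter F) (a0 : R) : F `=>` nbhs a0 ->
  expi a0 = 1 :> C -> (\forall a \near F, expi a != 1 :> C) ->
  Psi a @[a --> F] --> (0 : R).
Proof.
move=> Fa x1 Fx.
have cx : ccvg F (@expi R) 1.
  by have [h1 h2] := ccvg_expi (@cvg_id _ (nbhs a0)); rewrite x1 in h1 h2;
    split; [apply: cvg_trans h1; exact: cvg_app|apply: cvg_trans h2; exact: cvg_app].
have c : \sum_(z <- bigroots (expi a0)) prim a (branch z a) @[a --> F] -->
    \sum_(z <- bigroots (expi a0)) (0 : R).
  apply: cvg_sum_seq => z zb _.
  have [z1 ez z0 zn1 zx] := big_root zb; rewrite x1 in ez zx.
  have zr : z \in hroots (expi a0) by move: zb; rewrite mem_filter => /andP[].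
  have cy : ccvg F (branch z) z.
    have [h1 h2] := branch_cvg d0 zr.
    by split; [apply: cvg_trans h1; exact: cvg_app|apply: cvg_trans h2; exact: cvg_app].
  have z1' : z - 1 != 0 by rewrite subr_eq0.
  have cS : ccvg F (fun a => triangle (expi a) (branch z a)) 1.
    rewrite -[X in ccvg _ _ X](divff z1'); apply: ccvg_div => //; apply: ccvgB => //.
    exact: ccvg_cst.
  have nb u : branch z u != expi u.
    by apply: root_neq_diag (branchP z u); rewrite cmod_expi.
  have -> : 0 = n%:R * (claus a0 - dilog z + dilog (z / 1)) + 0 - 0 :> R.
    by rewrite /claus x1 BW1 divr1 sub0r addNr mulr0 addr0 subr0.
  apply: cvgB; first apply: cvgD.
  - apply: cvgM; first exact: cvg_cst.
    apply: cvgD; first apply: cvgB.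
    + by apply: cvg_trans (@claus_continuous R a0); exact: cvg_app.
    + exact: dilog_cvg.
    + apply: dilog_cvg; rewrite ?divr1 //.
      by rewrite -[X in ccvg _ _ X]divr1; apply: ccvg_div => //; exact: oner_neq0.
  - apply: dilog_cvg1 => //; apply: filterS Fx => a ax.
    rewrite -subr_eq0 /triangle.
    have -> : (branch z a - 1) / (branch z a - expi a) - 1 = (expi a - 1) / (branch z a - expi a).
      by field; rewrite subr_eq0 nb.
    by rewrite mulf_neq0 ?invr_eq0 ?subr_eq0.
  - apply: dilog_cvg1.
      rewrite -[X in ccvg _ _ X](mul1r 1) -[X in ccvg _ _ (X * _)](expr1n _ n).
      by apply: ccvgM => //; exact: ccvgX.
    have ny : \forall a \near F, branch z a != 0 by exact: (ccvg_near_neq0 z0 cy).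
    apply: filterS2 Fx ny => a ax ya.
    rewrite -subr_eq0 (triangle_twist (nb a) (branchP z a)).
    by apply: mulf_neq0; [apply: mulf_neq0; rewrite ?subr_eq0 ?expf_neq0|rewrite invr_eq0 subr_eq0 nb].
rewrite big1 // in c; apply: cvg_trans c; apply: near_eq_cvg.
have near1 : \forall a \near F, forall z, z \in bigroots (expi a0) -> 1 < cmod (branch z a).
  apply: (@near_seq _ F _ _ _ (fun z a => 1 < cmod (branch z a))) => z zb; apply: Fa.
  have [_ ez _ _ _] := big_root zb; rewrite x1 in ez.
  have := branch_cmod_cvg zb; move/cvgr_gt => /(_ 1); apply; exact: root_at1 ez.
apply: filterS2 near1 (Fa _ (sum_outer prim a0)) => a h1 h2.
by rewrite /Psi h2 [RHS]big_seq_cond [LHS]big_seq; apply: eq_bigl => z; rewrite andb_idr // => /h1.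
Qed.

(** A crossing root contributes the positive part (u + |u|) / 2 of u = ln |y|, which is continuous
    through the crossing. *)
Lemma Phi_continuous : continuous Phi.
Proof.
move=> a0; rewrite /continuous_at.
pose lnp z a := (ln (cmod (branch z a)) + `|ln (cmod (branch z a))|) / 2.
have e : \forall a \near a0, Phi a = \sum_(z <- bigroots (expi a0)) lnp z a.
  apply: filterS (sum_outer (fun _ y => ln (cmod y)) a0) => a h.
  rewrite /Phi h big_mkcond; apply: eq_bigr => z _; rewrite /lnp.
  case: ifP => [/ltW z1|/negbT]; first by rewrite ger0_norm ?ln_ge0 //; field.
  by rewrite -leNgt => z1; rewrite ler0_norm ?ln_le0 // subrr mul0r.
rewrite (nbhs_singleton e).
have c : \sum_(z <- bigroots (expi a0)) lnp z a @[a --> a0] --> \sum_(z <- bigroots (expi a0)) lnp z a0.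
  apply: cvg_sum_seq => z zb _.
  have [z1 _ z0 _ _] := big_root zb.
  have zr : z \in hroots (expi a0) by move: zb; rewrite mem_filter => /andP[].
  have cl : ln (cmod (branch z a)) @[a --> a0] --> ln (cmod (branch z a0)).
    rewrite (branch_id zr); apply: continuous_cvg; last exact: branch_cmod_cvg.
    by apply: continuous_ln; rewrite cmod_gt0.
  apply: cvgM; last exact: cvg_cst.
  by apply: cvgD => //; exact: cvg_norm.
by apply: cvg_trans c; apply: near_eq_cvg; apply: filterS e => a ->.
Qed.

Lemma near_right_of_dnbhs (a0 : R) (Q : R -> Prop) :
  (\forall h \near (0 : R)^', Q h) -> \forall a \near a0^'+, Q (a - a0).
Proof.
move=> h.
have c : a - a0 @[a --> a0] --> (0 : R).
  by rewrite -(subrr a0); apply: cvgB; [exact: cvg_id|exact: cvg_cst].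
have h' : \forall a \near a0, a - a0 != 0 -> Q (a - a0) := c _ h.
near=> a; have : a - a0 != 0 -> Q (a - a0) by near: a; exact: (cvg_within _ h').
by apply; rewrite subr_eq0 gt_eqF //; near: a; exact: nbhs_right_gt.
Unshelve. all: by end_near. Qed.

Lemma near_left_of_dnbhs (a0 : R) (Q : R -> Prop) :
  (\forall h \near (0 : R)^', Q h) -> \forall a \near a0^'-, Q (a - a0).
Proof.
move=> h.
have c : a - a0 @[a --> a0] --> (0 : R).
  by rewrite -(subrr a0); apply: cvgB; [exact: cvg_id|exact: cvg_cst].
have h' : \forall a \near a0, a - a0 != 0 -> Q (a - a0) := c _ h.
near=> a; have : a - a0 != 0 -> Q (a - a0) by near: a; exact: (cvg_within _ h').
by apply; rewrite subr_eq0 lt_eqF //; near: a; exact: nbhs_left_lt.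
Unshelve. all: by end_near. Qed.

(** With s the difference quotient divided by f(a0), |f(a0 + h)|^2 = 1 + h (2 Re s + h |s|^2), and
    the bracket tends to a positive limit. *)
Lemma radial (f : R -> C) a0 l : cder f a0 l -> cmod (f a0) = 1 -> 0 < Re (l / f a0) ->
  (\forall a \near a0^'+, 1 < cmod (f a)) /\ (\forall a \near a0^'-, cmod (f a) < 1).
Proof.
move=> df f1 rl; set y := f a0 in f1 rl; have y0 := cmod1_neq0 f1.
have cs : ccvg (0 : R)^' (fun h => (f (h + a0) - y) / h%:C / y) (l / y).
  exact: (ccvg_div y0 df (ccvg_cst y)).
pose s (h : R) := (f (h + a0) - y) / h%:C / y.
have csq : 2 * Re (s h) + h * cmod (s h) ^+ 2 @[h --> (0 : R)^'] --> 2 * Re (l / y) + 0 * cmod (l / y) ^+ 2.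
  apply: cvgD; first by apply: cvgM; [exact: cvg_cst|exact: cs.1].
  apply: cvgM; first exact: cvg_within.
  by apply: cvgM; exact: ccvg_cmod.
rewrite mul0r addr0 in csq.
have pos : \forall h \near (0 : R)^', 0 < 2 * Re (s h) + h * cmod (s h) ^+ 2.
  by move/cvgr_gt : csq => /(_ 0); apply; rewrite mulr_gt0.
have key : \forall h \near (0 : R)^', (0 < h -> 1 < cmod (f (h + a0))) /\ (h < 0 -> cmod (f (h + a0)) < 1).
  near=> h.
  have h0 : h != 0 by near: h; exact: nbhs_dnbhs_neq.
  have ph : 0 < 2 * Re (s h) + h * cmod (s h) ^+ 2 by near: h.
  have e : cmod (f (h + a0)) ^+ 2 = 1 + h * (2 * Re (s h) + h * cmod (s h) ^+ 2).
    have -> : cmod (f (h + a0)) = cmod (1 + h%:C * s h).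
      rewrite -[RHS]mulr1 -f1 -cmodM; congr cmod; rewrite /s; field.
      by rewrite y0 realC_eq0.
    by rewrite !cmod_sqr Re_1D_real Im_1D_real; ring.
  have m0 := cmod_ge0 (f (h + a0)).
  split=> hh.
    rewrite -(@ltr_pXn2r _ 2) ?nnegrE // expr1n e ltrDl mulr_gt0 //.
  by rewrite -(@ltr_pXn2r _ 2) ?nnegrE // expr1n e gtrDl nmulr_rlt0.
split.
  have k := near_right_of_dnbhs a0 key.
  near=> a; have [h _] : (0 < a - a0 -> 1 < cmod (f (a - a0 + a0))) /\
      (a - a0 < 0 -> cmod (f (a - a0 + a0)) < 1) by near: a.
  by rewrite subrK in h; apply: h; rewrite subr_gt0; near: a; exact: nbhs_right_gt.
have k := near_left_of_dnbhs a0 key.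
near=> a; have [_ h] : (0 < a - a0 -> 1 < cmod (f (a - a0 + a0))) /\
    (a - a0 < 0 -> cmod (f (a - a0 + a0)) < 1) by near: a.
by rewrite subrK in h; apply: h; rewrite subr_lt0; near: a; exact: nbhs_left_lt.
Unshelve. all: by end_near. Qed.

(** Inversion exchanges the two sides of the circle, so [radial] applies to 1/f. *)
Lemma radialN (f : R -> C) a0 l : cder f a0 l -> cmod (f a0) = 1 -> Re (l / f a0) < 0 ->
  (\forall a \near a0^'+, cmod (f a) < 1) /\ (\forall a \near a0^'-, 1 < cmod (f a)).
Proof.
move=> df f1 rl; have y0 := cmod1_neq0 f1.
have dV := cderV y0 df.
have V1 : cmod (f a0)^-1 = 1 by rewrite cmodV f1 invr1.
have rV : 0 < Re (- l / (f a0 * f a0) / (f a0)^-1).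
  rewrite (_ : - l / (f a0 * f a0) / (f a0)^-1 = - (l / f a0)); last by field.
  by rewrite ReN oppr_gt0.
have [h1 h2] := radial dV V1 rV; split.
  apply: filterS h1 => a; rewrite cmodV => h.
  have p0 : 0 < cmod (f a) by rewrite -invr_gt0 (lt_trans _ h).
  by move: h; rewrite invf_gt1.
have fn0 : \forall a \near a0^'-, 0 < cmod (f a).
  have n0 : \forall h \near (0 : R)^', f (h + a0) != 0 by exact: (ccvg_near_neq0 y0 (cder_cvg df)).
  apply: filterS (near_left_of_dnbhs a0 n0) => a; by rewrite subrK cmod_gt0.
by apply: filterS2 h2 fn0 => a; rewrite cmodV => h p0; move: h; rewrite invf_lt1.
Qed.

End Primitive.

(** * Jensen's formula for one linear factor *)

Section Jensen.
Context {R : realType}.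
Local Notation C := R[i].
Local Notation mu := (@lebesgue_measure R).
Implicit Types z : C.

Lemma pi_lt4 : pi < 4 :> R. Proof. by have := @pihalf_lt2 R; lra. Qed.

(* Any bound beyond [4 pi] would do in place of 20. *)
Lemma primitive_exists (f : R -> R) : continuous f ->
  exists F : R -> R, forall x : R, - 20 < x < 20 -> is_derive x 1 F (f x).
Proof.
move=> cf; exists (fun x => \int[mu]_(t in `[- 20, x]) f t) => x /andP[x1 x2].
have int : mu.-integrable `[- 20, 20] (EFin \o f).
  by apply: continuous_compact_integrable; [exact: segment_compact|exact: continuous_subspaceT].
have [D E] := continuous_FTC1_closed x2 int x1 (cf x).
by apply: DeriveDef; [exact: D|rewrite -derive1E; exact: E].
Qed.

Lemma FTC_derive (f F : R -> R) (a b : R) : a < b -> {within `[a, b], continuous f} ->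
  (forall x, a <= x <= b -> is_derive x 1 F (f x)) ->
  (\int[mu]_(x in `[a, b]) (f x)%:E)%E = (F b - F a)%:E.
Proof.
move=> ab cf dF; rewrite (continuous_FTC2 ab cf (F := F)) //.
  split.
  - by move=> x; rewrite in_itv /= => /andP[h1 h2]; have [|//] := dF x; rewrite !ltW.
  - by apply: cvg_at_right_filter; apply: (is_derive1_cvg (dF a _)); rewrite lexx ltW.
  - by apply: cvg_at_left_filter; apply: (is_derive1_cvg (dF b _)); rewrite lexx ltW.
move=> x; rewrite in_itv /= => /andP[h1 h2]; rewrite derive1E; have [|_ ->//] := dF x; by rewrite !ltW.
Qed.

Lemma cst_of_derive0_oo (f : R -> R) (a b x y : R) :
  (forall u, a < u < b -> is_derive u 1 f 0) -> a < x -> x <= y -> y < b -> f y = f x.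
Proof.
move=> df ax xy yb; apply: cst_of_derive0 => //.
  apply: continuous_in_subspaceT => u; rewrite inE /= in_itv /= => /andP[u1 u2].
  by apply: (is_derive1_cvg (df u _)); rewrite (lt_le_trans ax u1) (le_lt_trans u2 yb).
by move=> u /andP[u1 u2]; apply: df; rewrite (lt_trans ax u1) (lt_trans u2 yb).
Qed.

Definition logdist z (t : R) : R := ln (cmod (1 - z * expi t)).

Lemma logdist_arg_gt0 z t : cmod z < 1 -> 0 < cmod (1 - z * expi t).
Proof.
move=> z1; rewrite cmod_gt0 subr_eq0; apply: contraTneq z1 => e.
by rewrite -leNgt -(@cmod1 R) e cmodM cmod_expi mulr1.
Qed.

Lemma logdist_continuous z : cmod z < 1 -> continuous (logdist z).
Proof.
move=> z1 t; apply: continuous_cvg.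
  by apply: continuous_ln; exact: logdist_arg_gt0.
apply: ccvg_cmod; apply: ccvgB; first exact: ccvg_cst.
by apply: ccvgM; [exact: ccvg_cst|apply: ccvg_expi; exact: cvg_id].
Qed.

Lemma logdist_bound z t : cmod z <= 1 / 2 -> `|logdist z t| <= ln 2.
Proof.
move=> z1; have m1 : cmod (z * expi t) <= 1 / 2 by rewrite cmodM cmod_expi mulr1.
have h1 : cmod (1 - z * expi t) <= 2.
  rewrite (le_trans (cmodD _ _)) // cmodN cmod1; lra.
have h2 : 1 / 2 <= cmod (1 - z * expi t).
  have := cmodD (1 - z * expi t) (z * expi t); rewrite subrK cmod1; lra.
have p0 : 0 < cmod (1 - z * expi t) by rewrite (lt_le_trans _ h2) //; lra.
rewrite ler_norml /logdist -lnV ?posrE // !ler_ln ?posrE ?invr_gt0 //.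
by rewrite h1 andbT; move: h2; rewrite div1r.
Qed.

(** The value v is the integral over a full period, not divided by 2 pi. Encoding it through a
    primitive reduces relations between such integrals to differentiation. *)
Definition has_mean z (v : R) := exists F : R -> R,
  (forall x : R, - 20 < x < 20 -> is_derive x 1 F (logdist z x)) /\ F (2 * pi) - F 0 = v.

Lemma has_mean_bound z v : cmod z <= 1 / 2 -> has_mean z v -> `|v| <= 2 * pi * ln 2.
Proof.
move=> z1 [F [dF <-]]; have p4 := pi_lt4; have p0 := @pi_gt0 R.
have p20 : 0 < 2 * pi :> R by lra.
have dx (x : R) : x \in `]0, (2 * pi)[ -> is_derive x 1 F (logdist z x).
  by rewrite in_itv /= => /andP[x0 x1]; apply: dF; apply/andP; split; lra.
have cF : {within `[0, 2 * pi], continuous F}.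
  apply: continuous_in_subspaceT => x; rewrite inE /= in_itv /= => /andP[x0 x1].
  by apply: (is_derive1_cvg (dF x _)); apply/andP; split; lra.
have [c _ ->] := MVT p20 dx cF; rewrite subr0 normrM (gtr0_norm p20) mulrC.
by rewrite ler_pM2l // logdist_bound.
Qed.

(* [|1 - z^2 e^{2it}| = |1 - z e^{it}| |1 - z e^{i(t + pi)}|]: doubling the angle
   halves the mean. *)
Lemma has_mean_sqr z v : cmod z < 1 -> has_mean (z ^+ 2) v -> has_mean z (v / 2).
Proof.
move=> z1 [H [dH <-]]; have p4 := pi_lt4; have p0 := @pi_gt0 R.
have [F dF] := primitive_exists (logdist_continuous z1).
exists F; split => //.
have per w t : logdist w (t + 2 * pi) = logdist w t by rewrite /logdist expi_period.
have GF : F (pi + 2 * pi) - F pi = F (0 + 2 * pi) - F 0.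
  apply: (@cst_of_derive0_oo (fun x => F (x + 2 * pi) - F x) (-1) 5) => //; try lra.
  move=> u /andP[u1 u2].
  have d1 : is_derive (u + 2 * pi) 1 F (logdist z (u + 2 * pi)) by apply: dF; apply/andP; split; lra.
  have d2 : is_derive u 1 F (logdist z u) by apply: dF; apply/andP; split; lra.
  by apply: is_derive_eq; rewrite per; ring.
have GH : H (2 * pi + 2 * pi) - H (2 * pi) = H (0 + 2 * pi) - H 0.
  apply: (@cst_of_derive0_oo (fun x => H (x + 2 * pi) - H x) (-1) 9) => //; try lra.
  move=> u /andP[u1 u2].
  have d1 : is_derive (u + 2 * pi) 1 H (logdist (z ^+ 2) (u + 2 * pi)) by apply: dH; apply/andP; split; lra.
  have d2 : is_derive u 1 H (logdist (z ^+ 2) u) by apply: dH; apply/andP; split; lra.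
  by apply: is_derive_eq; rewrite per; ring.
(* As t runs over one period, 2 t runs over two; [GH] and [GF] fold the increments back to the first
   period. *)
have K : H (2 * (2 * pi)) / 2 - F (2 * pi) - F (2 * pi + pi) = H (2 * 0) / 2 - F 0 - F (0 + pi).
  apply: (@cst_of_derive0_oo (fun x => H (2 * x) / 2 - F x - F (x + pi)) (-1) 9) => //; try lra.
  move=> u /andP[u1 u2].
  have d1 : is_derive (2 * u) 1 H (logdist (z ^+ 2) (2 * u)) by apply: dH; apply/andP; split; lra.
  have d2 : is_derive u 1 F (logdist z u) by apply: dF; apply/andP; split; lra.
  have d3 : is_derive (u + pi) 1 F (logdist z (u + pi)) by apply: dF; apply/andP; split; lra.
  apply: is_derive_eq; rewrite /GRing.scale /=.
  have -> : logdist (z ^+ 2) (2 * u) = logdist z u + logdist z (u + pi).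
    rewrite /logdist -lnM ?posrE ?logdist_arg_gt0 // -cmodM; congr (ln (cmod _)).
    by rewrite -expiX expiD expipi; ring.
  by field.
rewrite (_ : 2 * (2 * pi) = 2 * pi + 2 * pi) in K; last by ring.
rewrite mulr0 !add0r in K GF GH; rewrite (_ : 2 * pi + pi = pi + 2 * pi) in K; last by ring.
lra.
Qed.

Lemma has_mean_exists z : cmod z < 1 -> exists v, has_mean z v.
Proof.
move=> z1; have [F dF] := primitive_exists (logdist_continuous z1).
by exists (F (2 * pi) - F 0); exists F.
Qed.

(** After k squarings the point is still in the disc of radius 1/2, where the bound is uniform, and
    each squaring contributes a factor 1/2. *)
Lemma has_mean_small k z v : cmod z <= 1 / 2 -> has_mean z v -> exists2 w,
  has_mean z w & `|w| <= 2 * pi * ln 2 / 2 ^+ k.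
Proof.
elim: k z v => [|k IH] z v z1 hv.
  by exists v => //; rewrite expr0 divr1; exact: has_mean_bound hv.
have zlt : cmod z < 1 by lra.
have z2 : cmod (z ^+ 2) <= 1 / 2 by rewrite cmodX; have := cmod_ge0 z; nra.
have [v2 hv2] : exists v, has_mean (z ^+ 2) v by apply: has_mean_exists; lra.
have [w hw bw] := IH _ _ z2 hv2; exists (w / 2); first exact: has_mean_sqr.
by rewrite normrM (ger0_norm (_ : 0 <= 2^-1)) ?invr_ge0 // exprS invfM mulrA [in leRHS]mulrAC ler_pM2r // invr_gt0.
Qed.

Lemma has_mean_unique z v w : has_mean z v -> has_mean z w -> v = w.
Proof.
move=> [F [dF <-]] [G [dG <-]]; have p4 := pi_lt4; have p0 := @pi_gt0 R.
have : F (2 * pi) - G (2 * pi) = F 0 - G 0.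
  apply: (@cst_of_derive0_oo (fun x => F x - G x) (-20) 20) => //; try lra.
  by move=> u u20; have d1 := dF u u20; have d2 := dG u u20; apply: is_derive_eq; rewrite subrr.
lra.
Qed.

Lemma has_mean0_small z : cmod z <= 1 / 2 -> has_mean z 0.
Proof.
move=> z1; have [v hv] : exists v, has_mean z v by apply: has_mean_exists; lra.
have bd k : `|v| <= 2 * pi * ln 2 / 2 ^+ k.
  by have [w hw bw] := has_mean_small k z1 hv; rewrite (has_mean_unique hv hw).
suff v0 : v = 0 by rewrite -v0.
apply/eqP; rewrite -normr_eq0 eq_le normr_ge0 andbT leNgt; apply/negP => v0.
pose c := 2 * pi * ln 2 / `|v|.
have c0 : 0 <= c by rewrite divr_ge0 // !mulr_ge0 ?pi_ge0 // ln_ge0 // ler1n.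
have := archi_boundP c0; set k := Num.bound c => ck.
have := bd k; rewrite ler_pdivlMr ?exprn_gt0 // => b.
have : c < 2 ^+ k.
  by rewrite (lt_le_trans ck) // -natrX ler_nat ltnW // ltn_expl.
by rewrite /c ltr_pdivrMr // => b2; have := le_lt_trans b b2; rewrite [X in X < _]mulrC ltxx.
Qed.

(** Enough squarings bring z into the disc of radius 1/2, where the mean is 0; halving 0 brings this
    back to z. *)
Lemma has_mean0 z : cmod z < 1 -> has_mean z 0.
Proof.
move=> z1.
have [k zk] : exists k, cmod z ^+ (2 ^ k) <= 1 / 2.
  have c : cmod z ^+ m @[m --> \oo] --> (0 : R).
    by apply: cvg_expr; rewrite ger0_norm // cmod_ge0.
  have : \forall m \near \oo, cmod z ^+ m < 1 / 2.
    by move/cvgr_lt : c => /(_ (1 / 2)); apply; lra.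
  move=> [N _ hN]; exists N; apply/ltW/hN => /=; exact/ltnW/ltn_expl.
elim: k z z1 zk => [|k IH] z z1 zk; first by apply: has_mean0_small; rewrite expn0 expr1 in zk.
rewrite -(mul0r 2^-1); apply: has_mean_sqr => //; apply: IH.
  by rewrite cmodX expr_lt1 // cmod_ge0.
by rewrite cmodX -exprM -expnS.
Qed.

(** On the circle |e^(ix) - al| is |1 - conj(al) e^(ix)|, which handles al inside; for al outside,
    the factor |al| is taken out and 1/al is inside. *)
Lemma jensen_root (al : C) : cmod al != 1 -> exists F : R -> R,
  (forall x : R, - 20 < x < 20 -> is_derive x 1 F (ln (cmod (expi x - al)))) /\
  F (2 * pi) - F 0 = 2 * pi * (if 1 < cmod al then ln (cmod al) else 0).
Proof.
move=> al1; case: ifP => [a1|/negbT]; last first.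
  rewrite -leNgt le_eqVlt (negbTE al1) /= => a1.
  have ca1 : cmod (conjc al) < 1 by rewrite cmod_conj.
  have [F [dF F0]] := has_mean0 ca1.
  exists F; split; last by rewrite F0 mulr0.
  move=> x /dF; rewrite /logdist.
  have -> // : cmod (1 - conjc al * expi x) = cmod (expi x - al).
  rewrite -(cmod_conj (expi x - al)) conjc_sub -[RHS]mulr1 -(cmod_expi x) -cmodM; congr cmod.
  by rewrite mulrBl conj_expi -expiD addNr expi0.
have ai : cmod al^-1 < 1 by rewrite cmodV invf_lt1 // (lt_trans ltr01).
have a0 : al != 0 by rewrite -cmod_gt0 (lt_trans ltr01).
have [F [dF F0]] := has_mean0 ai.
exists (fun x => F x + x * ln (cmod al)); split; last by rewrite mul0r addr0 addrAC F0 add0r.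
move=> x x20; have d1 := dF x x20.
apply: (is_derive_eq (is_derive1D d1 (is_derive1M (is_derive1id x) (is_derive1c x (ln (cmod al)))))).
rewrite mulr0 add0r mulr1 /logdist -lnM ?posrE ?logdist_arg_gt0 ?cmod_gt0 // -cmodM cmodB; congr (ln (cmod _)).
by rewrite mulrBl mul1r mulrAC mulVf // mul1r.
Qed.

End Jensen.

(** * Roots of unity, velocity signs and volumes *)

Section RootsOfUnity.
Context {R : realType}.
Local Notation C := R[i].
Implicit Types (x y z : C) (a b : R).

Definition ang (N k : nat) : R := 2 * k%:R * pi / N%:R.

Lemma expi_ang N k : expi (ang N k) = expi (2 * pi / N%:R) ^+ k :> C.
Proof. by rewrite expiX /ang; congr expi; ring. Qed.

Lemma expi_angX N k : (0 < N)%N -> expi (ang N k) ^+ N = 1 :> C.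
Proof.
move=> N0; have n0 : N%:R != 0 :> R by rewrite pnatr_eq0 -lt0n.
have e : N%:R * ang N k = k%:R * (2 * pi) by rewrite /ang; field.
by rewrite expiX e -expiX expi2pi expr1n.
Qed.

Lemma ang_gt0 N k : (0 < N)%N -> (0 < k)%N -> 0 < ang N k.
Proof. by move=> N0 k0; rewrite divr_gt0 ?mulr_gt0 ?ltr0n // pi_gt0. Qed.

Lemma ang_lt N j k : (0 < N)%N -> (ang N j < ang N k) = (j < k)%N.
Proof.
move=> N0; rewrite ltr_pM2r ?invr_gt0 ?ltr0n // ltr_pM2r ?pi_gt0 //.
by rewrite ltr_pM2l // ltr_nat.
Qed.

Lemma angN N : (0 < N)%N -> ang N N = 2 * pi.
Proof. by move=> N0; rewrite /ang; field; rewrite pnatr_eq0 -lt0n. Qed.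

Lemma ang0 N : ang N 0 = 0.
Proof. by rewrite /ang mulr0 !mul0r. Qed.

Lemma ang_lt2pi N k : (k < N)%N -> ang N k < 2 * pi.
Proof.
move=> kN; have N0 : (0 < N)%N by rewrite (leq_ltn_trans _ kN).
by rewrite -(angN N0) ang_lt.
Qed.

Lemma expi_ang_neq1 N k : (0 < k < N)%N -> expi (ang N k) != 1 :> C.
Proof.
move=> /andP[k0 kN]; have N0 : (0 < N)%N by rewrite (leq_ltn_trans _ kN).
by apply: expi_eq1; rewrite ang_gt0 // ang_lt2pi.
Qed.

Lemma ang_prim N : (0 < N)%N -> N.-primitive_root (expi (2 * pi / N%:R) : C).
Proof.
move=> N0; apply/andP; split => //; apply/forallP => i; apply/eqP.
rewrite unity_rootE -expi_ang; have [->|iN] := eqVneq i.+1 N.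
  by rewrite angN // expi2pi eqxx.
by apply/negbTE/expi_ang_neq1; rewrite /= ltn_neqAle iN ltn_ord.
Qed.

Lemma unity_ang N z : (0 < N)%N -> z ^+ N = 1 -> exists2 j, (j < N)%N & z = expi (ang N j).
Proof.
move=> N0 zN; have [j ->] := prim_rootP (ang_prim N0) zN.
by exists j; rewrite ?ltn_ord // expi_ang.
Qed.

Lemma unity_cmod N z : (0 < N)%N -> z ^+ N = 1 -> cmod z = 1.
Proof. by move=> N0 /(unity_ang N0)[j _ ->]; exact: cmod_expi. Qed.

Lemma expi_inj a b : 0 <= a < 2 * pi -> 0 <= b < 2 * pi -> expi a = expi b :> C -> a = b.
Proof.
wlog ab : a b / a <= b => [hw ha hb e|].
  by have [/hw|/ltW/hw h] := leP a b; [exact|apply/esym/h].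
move=> /andP[a0 a2] /andP[b0 b2] e; apply/eqP; rewrite eq_le ab /= leNgt; apply/negP => lt.
have : expi (b - a) != 1 :> C by apply: expi_eq1; apply/andP; split; lra.
by rewrite expiB e divff ?expi_neq0 // eqxx.
Qed.

(** The two expressions are the relative velocities of a root at crossings of order n and n - 1
    ([slope_n], [slope_n1]). The chord quotient is a real factor times e^(i(b - a)/2), and the
    second expression has the conjugate phase: hence opposite signs at the two kinds of crossing. *)
Lemma Re_rot a b : 0 < a < 2 * pi -> 0 < b < 2 * pi ->
  Re ('i%C * ((expi b - 1) / (expi a - 1))) = - (sin (b / 2) / sin (a / 2) * sin ((b - a) / 2)) /\
  Re ('i%C * (expi a * (expi b - 1) / ((expi a - 1) * expi b))) = sin (b / 2) / sin (a / 2) * sin ((b - a) / 2).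
Proof.
move=> /andP[a0 a2] /andP[b0 b2].
have sa : 0 < sin (a / 2) by apply: sin_gt0_pi; apply/andP; split; lra.
have sa' : (2 * sin (a / 2))%:C != 0 :> C by rewrite realC_eq0 mulf_neq0 // gt_eqF.
have i0 : 'i%C != 0 :> C by rewrite eq_complex /= oner_eq0 andbF.
have gen (u v i e f : C) : u != 0 -> i != 0 -> f != 0 -> v * i * e / (u * i * f) = v / u * (e / f).
  by move=> u0 i0' f0; field; rewrite u0 i0' f0.
have e : (expi b - 1) / (expi a - 1) = (sin (b / 2) / sin (a / 2))%:C * expi ((b - a) / 2) :> C.
  rewrite !expi_sub1 mulrBl expiB.
  have -> : (sin (b / 2) / sin (a / 2))%:C = (2 * sin (b / 2))%:C / (2 * sin (a / 2))%:C :> C.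
    by rewrite -fmorph_div /=; congr (_%:C); field; rewrite gt_eqF.
  by apply: gen => //; exact: expi_neq0.
split.
  by rewrite e !ReImE; ring.
have -> : expi a * (expi b - 1) / ((expi a - 1) * expi b) =
   (sin (b / 2) / sin (a / 2))%:C * expi (- ((b - a) / 2)) :> C.
  have -> : expi (- ((b - a) / 2)) = expi ((b - a) / 2) * (expi a / expi b) :> C.
    by rewrite -expiB -expiD; congr expi; field.
  rewrite mulrA -e; field.
  by rewrite expi_neq0 subr_eq0 expi_eq1 // a0.
by rewrite !ReImE sinN; ring.
Qed.

Lemma sin_sign a b : 0 < a < 2 * pi -> 0 < b < 2 * pi -> a != b ->
  (0 < sin (b / 2) / sin (a / 2) * sin ((b - a) / 2)) = (a < b) /\
  (sin (b / 2) / sin (a / 2) * sin ((b - a) / 2) < 0) = (b < a).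
Proof.
move=> /andP[a0 a2] /andP[b0 b2] ab.
have sa : 0 < sin (a / 2) by apply: sin_gt0_pi; apply/andP; split; lra.
have sb : 0 < sin (b / 2) by apply: sin_gt0_pi; apply/andP; split; lra.
have q0 : 0 < sin (b / 2) / sin (a / 2) by rewrite divr_gt0.
rewrite pmulr_rgt0 // pmulr_rlt0 //.
have [lt|gt|e] := ltgtP a b; last by rewrite e eqxx in ab.
  have h : 0 < sin ((b - a) / 2) by apply: sin_gt0_pi; apply/andP; split; lra.
  by rewrite h ltNge (ltW h).
have h : 0 < sin ((a - b) / 2) by apply: sin_gt0_pi; apply/andP; split; lra.
have e : sin ((b - a) / 2) = - sin ((a - b) / 2) by rewrite -sinN; congr sin; field.
by rewrite e oppr_gt0 oppr_lt0 h ltNge (ltW h).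
Qed.

(** The volume in terms of the two endpoint angles, in which it is antisymmetric. *)
Definition volc a b : R := claus a - claus b + claus (b - a).

Lemma volcN a b : volc b a = - volc a b.
Proof. have h : claus (a - b) = - claus (b - a) by rewrite -clausN opprB.
by rewrite /volc h; ring. Qed.

Lemma volE a b : vol a b = volc a (a + b).
Proof. by rewrite /vol /volc /claus (addrC a b) addrK. Qed.

Lemma dilog_expi_sub a b : 0 < a < 2 * pi -> 0 < b < 2 * pi -> a != b ->
  dilog (expi (b - a)) = claus (b - a).
Proof.
move=> /andP[a0 a2] /andP[b0 b2] ab; have [lt|gt|e] := ltgtP a b; last by rewrite e eqxx in ab.
  by apply: dilog_expi; apply/andP; split; lra.
rewrite -expi_period -claus_period; apply: dilog_expi; apply/andP; split; lra.
Qed.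

End RootsOfUnity.

(** * Values at the crossings and summation of the increments *)

Section Torus.
Context {R : realType}.
Local Notation C := R[i].
Variable d : nat.
Hypothesis d0 : (0 < d)%N.
Implicit Types (x y z : C) (a b : R).

Local Notation hpoly := (@hpoly R d).
Local Notation hroots := (@hroots R d).
Local Notation bigroots := (@bigroots R d).
Local Notation branch := (@branch R d).
Local Notation n := d.+2.
Local Notation V := (@prim R d).
Local Notation Psi := (@Psi R d).
Local Notation Phi := (@Phi R d).
Local Notation slope := (@branch_slope R d).

(** If x^n = 1, the last two dilogarithms cancel. If x^(n-1) = 1, then x^n S = x S is the conjugate
    of S; the two add up to 2 dilog S = - volc and turn the factor n into n - 1. *)
Lemma prim_torus a b : 0 < a < 2 * pi -> 0 < b < 2 * pi -> a != b ->
  (expi a ^+ n = 1 :> C -> V a (expi b) = n%:R * volc a b) /\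
  (expi a ^+ d.+1 = 1 :> C -> V a (expi b) = d.+1%:R * volc a b).
Proof.
move=> ha hb ab; case/andP: (ha) => a0 a2; case/andP: (hb) => b0 b2.
have e1 : dilog (expi b) = claus b by exact: dilog_expi.
have e2 : dilog (expi b / expi a) = claus (b - a) by rewrite -expiB dilog_expi_sub.
have ne : expi a != expi b :> C.
  by apply: contra ab => /eqP /expi_inj -> //; apply/andP; split; lra.
have xa : expi a != 1 :> C by exact: expi_eq1.
have xb : expi b != 1 :> C by exact: expi_eq1.
have e3 : dilog (triangle (expi a) (expi b)) = - volc a b / 2.
  by rewrite /triangle dilog_inscribed ?cmod_expi // -expiB.
split => h.
  by rewrite /prim h mul1r e1 e2 addrK.
have e4 : expi a ^+ n * triangle (expi a) (expi b) = conjc (triangle (expi a) (expi b)) :> C.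
  have ba : expi b - expi a != 0 :> C by rewrite subr_eq0 eq_sym.
  rewrite exprSr h mul1r /triangle conjc_mul conjc_inv !conjc_sub !conj_expi !expiN conjc1.
  have k1 : (expi b)^-1 - 1 = - (expi b - 1) / expi b :> C by field; rewrite expi_neq0.
  have k2 : (expi b)^-1 - (expi a)^-1 = - (expi b - expi a) / (expi a * expi b) :> C.
    by field; rewrite !expi_neq0.
  by rewrite k1 k2; field; rewrite ba !expi_neq0.
have t0 : triangle (expi a) (expi b) != 0 by rewrite mulf_neq0 ?invr_eq0 ?subr_eq0 // eq_sym.
have t1 : triangle (expi a) (expi b) != 1.
  rewrite -subr_eq0 /triangle.
  have -> : (expi b - 1) / (expi b - expi a) - 1 = (expi a - 1) / (expi b - expi a) :> C.
    by field; rewrite subr_eq0 eq_sym.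
  by rewrite mulf_neq0 ?invr_eq0 ?subr_eq0 // eq_sym.
by rewrite /prim e4 dilog_conj // e1 e2 e3 -/(volc a b) -(natr1 d.+1); field.
Qed.

(** Here g x = 0, so the other roots are the nontrivial zeros of z^n - 1. *)
Lemma big_n k z : (0 < k < n)%N ->
  z \in bigroots (expi (ang n k)) <-> [/\ z ^+ n = 1, z != 1 & z != expi (ang n k)].
Proof.
move=> kn; set x := expi (ang n k).
have x1 : x != 1 by exact: expi_ang_neq1.
have xn : x ^+ n = 1 by exact: expi_angX.
have gx : geom n x = 0.
  by apply/eqP; have := geomE n x; rewrite xn subrr => /eqP; rewrite mulf_eq0 subr_eq0 (negbTE x1).
split=> [zb|[zn z1 zx]].
  have [_ ez _ z1 zx] := big_root zb; split => //.
  by apply/eqP; rewrite -subr_eq0 -geomE (geom_root ez) gx mulr0.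
rewrite mem_filter (unity_cmod _ zn) // lexx mem_hroots hpoly_rootE // gx.
by have := geomE n z; rewrite zn subrr => /eqP; rewrite mulf_eq0 subr_eq0 (negbTE z1).
Qed.

(** Here g x = 1, since the first n - 1 terms of g sum to 0 and the last one is 1. *)
Lemma big_n1 k z : (0 < k < d.+1)%N ->
  z \in bigroots (expi (ang d.+1 k)) <-> [/\ z ^+ d.+1 = 1, z != 1 & z != expi (ang d.+1 k)].
Proof.
move=> kn; set x := expi (ang d.+1 k).
have x1 : x != 1 by exact: expi_ang_neq1.
have xn : x ^+ d.+1 = 1 by exact: expi_angX.
have g1 y : y ^+ d.+1 = 1 -> y != 1 -> geom n y = 1.
  move=> yn y1; rewrite geomS yn.
  have := geomE d.+1 y; rewrite yn subrr => /eqP; rewrite mulf_eq0 subr_eq0 (negbTE y1) /= => /eqP ->.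
  by rewrite add0r.
split=> [zb|[zn z1 zx]].
  have [_ ez z0 z1 zx] := big_root zb; split => //.
  have := geomE n z; rewrite (geom_root ez) g1 // mulr1 => /(addIr _).
  by rewrite exprSr => /esym e; apply: (mulIf z0); rewrite mul1r.
by rewrite mem_filter (unity_cmod _ zn) // lexx mem_hroots hpoly_rootE //; apply/eqP; rewrite !g1.
Qed.

Lemma perm_big_ang N k : (0 < k < N)%N ->
  (forall z, z \in bigroots (expi (ang N k)) <-> [/\ z ^+ N = 1, z != 1 & z != expi (ang N k)]) ->
  perm_eq (bigroots (expi (ang N k))) [seq expi (ang N j) | j <- index_iota 1 N & j != k].
Proof.
move=> /andP[k0 kN] H; have N0 : (0 < N)%N by rewrite (leq_ltn_trans _ kN).
have inj j1 j2 : (j1 < N)%N -> (j2 < N)%N -> expi (ang N j1) = expi (ang N j2) :> C -> j1 = j2.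
  move=> h1 h2; rewrite !expi_ang => /eqP; rewrite (eq_prim_root_expr (ang_prim N0)).
  by rewrite !modn_small // => /eqP.
apply: uniq_perm; first exact: bigroots_uniq.
  rewrite map_inj_in_uniq ?filter_uniq ?iota_uniq // => j1 j2.
  rewrite !mem_filter !mem_index_iota => /and3P[_ _ h1] /and3P[_ _ h2]; exact: inj.
move=> z; apply/idP/mapP => [/H [zN z1 zx]|[j]].
  have [j jN ez] := unity_ang N0 zN; exists j => //.
  rewrite mem_filter mem_index_iota jN andbT; apply/andP; split.
    by apply: contra zx => /eqP <-; rewrite ez.
  by rewrite lt0n; apply: contra z1 => /eqP j0; rewrite ez j0 ang0 expi0.
rewrite mem_filter mem_index_iota => /and3P[jk j0 jN] ->; apply/H; split.
- exact: expi_angX.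
- by apply: expi_ang_neq1; rewrite j0.
- by apply: contra jk => /eqP /inj ->.
Qed.

(** At a zero of g, [hpoly_diag] reduces to (z - 1) g'(z) = n z^(n-1). *)
Lemma slope_n a z : expi a ^+ n = 1 :> C -> expi a != 1 :> C -> z ^+ n = 1 -> z != 1 ->
  slope a z / z = 'i%C * ((z - 1) / (expi a - 1)).
Proof.
move=> xn x1 zn z1; set x := expi a in xn x1 *.
have x1' : x - 1 != 0 by rewrite subr_eq0.
have z1' : z - 1 != 0 by rewrite subr_eq0.
have z0 : z != 0 by rewrite -cmod_gt0 (unity_cmod _ zn).
have g0 y : y ^+ n = 1 -> y != 1 -> (y - 1) * (hpoly y).[y] = n%:R * y ^+ d.+1.
  move=> yn y1; rewrite hpoly_diag; have := geomE n y; rewrite yn subrr => /eqP.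
  by rewrite mulf_eq0 subr_eq0 (negbTE y1) /= => /eqP ->; rewrite subr0.
have hz : (hpoly z).[z] != 0 by apply: hpoly_diag_neq0; rewrite (unity_cmod _ zn).
have n0 : n%:R != 0 :> C by rewrite pnatr_eq0.
rewrite /branch_slope -/x.
have -> : (hpoly x).[x] = n%:R * x ^+ d.+1 / (x - 1) by rewrite -g0 // mulrC mulKf.
have -> : (hpoly z).[z] = n%:R * z ^+ d.+1 / (z - 1) by rewrite -g0 // mulrC mulKf.
have zd : z ^+ d.+1 = z^-1 by apply: (mulIf z0); rewrite -exprSr zn mulVf.
have x0 : x != 0 := expi_neq0 a.
have xd : x ^+ d.+1 = x^-1 by apply: (mulIf x0); rewrite -exprSr xn mulVf.
by rewrite zd xd; move: n0; generalize (n%:R : C) => m m0; field; rewrite x1' z0 x0 z1' m0.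
Qed.

(** At a nontrivial (n-1)-th root of unity, [hpoly_diag] reduces to (z - 1) g'(z) = n - 1. *)
Lemma slope_n1 a z : expi a ^+ d.+1 = 1 :> C -> expi a != 1 :> C -> z ^+ d.+1 = 1 -> z != 1 ->
  slope a z / z = 'i%C * (expi a * (z - 1) / ((expi a - 1) * z)).
Proof.
move=> xn x1 zn z1; set x := expi a in xn x1 *.
have x1' : x - 1 != 0 by rewrite subr_eq0.
have z1' : z - 1 != 0 by rewrite subr_eq0.
have z0 : z != 0 by rewrite -cmod_gt0 (unity_cmod _ zn).
have g0 y : y ^+ d.+1 = 1 -> y != 1 -> (y - 1) * (hpoly y).[y] = d.+1%:R.
  move=> yn y1; rewrite hpoly_diag yn geomS yn; have := geomE d.+1 y; rewrite yn subrr => /eqP.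
  by rewrite mulf_eq0 subr_eq0 (negbTE y1) /= => /eqP ->; rewrite mulr1 add0r -natr1 addrK.
have n0 : d.+1%:R != 0 :> C by rewrite pnatr_eq0.
rewrite /branch_slope -/x.
have -> : (hpoly x).[x] = d.+1%:R / (x - 1) by rewrite -(g0 x) // mulrC mulKf.
have -> : (hpoly z).[z] = d.+1%:R / (z - 1) by rewrite -(g0 z) // mulrC mulKf.
have gen (i m : C) : m != 0 -> i * x * (m / (x - 1)) / (m / (z - 1)) / z = i * (x * (z - 1) / ((x - 1) * z)).
  by move=> m0; field; rewrite x1' z0 z1' m0.
exact: gen.
Qed.

Lemma Psi_sides (a0 : R) : expi a0 != 1 :> C ->
  (forall z, z \in bigroots (expi a0) -> cmod z = 1 /\ Re (slope a0 z / z) != 0) ->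
  Psi a @[a --> a0^'+] --> \sum_(z <- bigroots (expi a0) | 0 < Re (slope a0 z / z)) V a0 z /\
  Psi a @[a --> a0^'-] --> \sum_(z <- bigroots (expi a0) | Re (slope a0 z / z) < 0) V a0 z.
Proof.
move=> x1 H.
have side z : z \in bigroots (expi a0) ->
    (\forall a \near a0^'+, (1 < cmod (branch z a)) = (0 < Re (slope a0 z / z))) /\
    (\forall a \near a0^'-, (1 < cmod (branch z a)) = (Re (slope a0 z / z) < 0)).
  move=> zb; have [z1 zs] := H z zb.
  have zr : z \in hroots (expi a0) by move: zb; rewrite mem_filter => /andP[].
  have dz := branch_cder d0 zb; have bz := branch_id d0 zr.
  have hz : cmod (branch z a0) = 1 by rewrite bz.
  have [lt|gt|e] := ltgtP (Re (slope a0 z / z)) 0; last by rewrite e eqxx in zs.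
    have [|h1 h2] := radialN dz hz; first by rewrite bz.
    by split; [apply: filterS h1 => a ha; rewrite ltNge (ltW ha)|apply: filterS h2 => a ->].
  have [|h1 h2] := radial dz hz; first by rewrite bz.
  by split; [apply: filterS h1 => a ->|apply: filterS h2 => a ha; rewrite ltNge (ltW ha)].
split; apply: Psi_lim => //; try exact: cvg_within.
  by move=> z /side[].
by move=> z /side[].
Qed.

Lemma Psi_sides_ang N k (c : R) (pos : pred nat) : (0 < k < N)%N ->
  (forall z, z \in bigroots (expi (ang N k)) <-> [/\ z ^+ N = 1, z != 1 & z != expi (ang N k)]) ->
  (forall j, (0 < j < N)%N -> j != k ->
    [/\ (0 < Re (slope (ang N k) (expi (ang N j)) / expi (ang N j))) = pos j,
        (Re (slope (ang N k) (expi (ang N j)) / expi (ang N j)) < 0) = ~~ pos j &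
        V (ang N k) (expi (ang N j)) = c * volc (ang N k) (ang N j)]) ->
  Psi a @[a --> (ang N k)^'+] --> c * (\sum_(1 <= j < N | (j != k) && pos j) volc (ang N k) (ang N j)) /\
  Psi a @[a --> (ang N k)^'-] --> c * (\sum_(1 <= j < N | (j != k) && ~~ pos j) volc (ang N k) (ang N j)).
Proof.
move=> kN Hb H; have N0 : (0 < N)%N by case/andP: kN => k0; apply: leq_ltn_trans.
have pm := perm_big_ang kN Hb.
have [||h1 h2] := @Psi_sides (ang N k).
- exact: expi_ang_neq1.
- move=> z; rewrite (perm_mem pm) => /mapP[j]; rewrite mem_filter mem_index_iota => /andP[jk jN] ->.
  split; first exact: cmod_expi.
  have [p1 p2 _] := H j jN jk; rewrite neq_lt p1 p2; by case: (pos j).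
rewrite !(perm_big _ pm) !big_map !big_filter_cond in h1 h2.
have e (P Q : pred nat) : (forall j, (0 < j < N)%N -> j != k -> P j = Q j) ->
    \sum_(j <- index_iota 1 N | (j != k) && P j) V (ang N k) (expi (ang N j)) =
    c * \sum_(1 <= j < N | (j != k) && Q j) volc (ang N k) (ang N j).
  move=> PQ; rewrite mulr_sumr big_seq_cond [RHS]big_seq_cond.
  rewrite (eq_bigl (fun j => (j \in index_iota 1 N) && ((j != k) && Q j))).
    by apply: eq_bigr => j /and3P[]; rewrite mem_index_iota => jN jk _; have [_ _ ->] := H j jN jk.
  move=> j; rewrite mem_index_iota; have [jN|//] := boolP (0 < j < N)%N.
  by have [//|jk] := eqVneq j k; rewrite /= PQ.
split.
  rewrite -(e (fun j => 0 < Re (slope (ang N k) (expi (ang N j)) / expi (ang N j))) pos); first exact: h1.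
  by move=> j jN jk; have [] := H j jN jk.
rewrite -(e (fun j => Re (slope (ang N k) (expi (ang N j)) / expi (ang N j)) < 0) (fun j => ~~ pos j)).
  exact: h2.
by move=> j jN jk; have [] := H j jN jk.
Qed.

Definition above N k : R := \sum_(1 <= j < N | (k < j)%N) volc (ang N k) (ang N j).
Definition below N k : R := \sum_(1 <= j < N | (j < k)%N) volc (ang N k) (ang N j).

Lemma ang_itv N k : (0 < k < N)%N -> 0 < (ang N k : R) < 2 * pi.
Proof.
move=> /andP[k0 kN]; have N0 : (0 < N)%N by rewrite (leq_ltn_trans _ kN).
by rewrite ang_gt0 // ang_lt2pi.
Qed.

Lemma ang_neq N j k : (0 < N)%N -> j != k -> ang N j != ang N k :> R.
Proof. by move=> N0; rewrite !neq_lt !ang_lt. Qed.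

(** As a increases through the crossing, the roots with j < k leave the disc and those with j > k
    enter it; at (n-1)-th roots of unity it is the other way round. *)
Lemma Psi_sides_n k : (0 < k < n)%N ->
  Psi a @[a --> (ang n k)^'+] --> n%:R * below n k /\
  Psi a @[a --> (ang n k)^'-] --> n%:R * above n k.
Proof.
move=> kn; have [||h1 h2] := @Psi_sides_ang n k n%:R (fun j => (j < k)%N) kn.
- by move=> z; exact: big_n.
- move=> j jn jk; have ij := ang_itv jn; have ik := ang_itv kn.
  have ne : ang n k != ang n j :> R by apply: ang_neq; rewrite // eq_sym.
  rewrite slope_n ?expi_angX ?expi_ang_neq1 //.
  have [-> _] := Re_rot ik ij; have [s1 s2] := sin_sign ik ij ne.
  rewrite oppr_gt0 oppr_lt0 s1 s2 !ang_lt //; split => //.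
    by rewrite -leqNgt ltn_neqAle eq_sym jk.
  by have [+ _] := prim_torus ik ij ne; apply; exact: expi_angX.
split.
  rewrite /below (eq_bigl (fun j => (j != k) && (j < k)%N)) // => j.
  by rewrite [(j < k)%N]ltn_neqAle andbA andbb.
rewrite /above (eq_bigl (fun j => (j != k) && ~~ (j < k)%N)) // => j.
by rewrite -leqNgt ltn_neqAle eq_sym.
Qed.

Lemma Psi_sides_n1 k : (0 < k < d.+1)%N ->
  Psi a @[a --> (ang d.+1 k)^'+] --> d.+1%:R * above d.+1 k /\
  Psi a @[a --> (ang d.+1 k)^'-] --> d.+1%:R * below d.+1 k.
Proof.
move=> kn; have [||h1 h2] := @Psi_sides_ang d.+1 k d.+1%:R (fun j => (k < j)%N) kn.
- by move=> z; exact: big_n1.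
- move=> j jn jk; have ij := ang_itv jn; have ik := ang_itv kn.
  have ne : ang d.+1 k != ang d.+1 j :> R by apply: ang_neq; rewrite // eq_sym.
  rewrite slope_n1 ?expi_angX ?expi_ang_neq1 //.
  have [_ ->] := Re_rot ik ij; have [s1 s2] := sin_sign ik ij ne.
  rewrite s1 s2 !ang_lt //; split => //.
    by rewrite -leqNgt ltn_neqAle jk.
  by have [_] := prim_torus ik ij ne; apply; exact: expi_angX.
split.
  rewrite /above (eq_bigl (fun j => (j != k) && (k < j)%N)) // => j.
  by rewrite [(k < j)%N]ltn_neqAle eq_sym andbA andbb.
rewrite /below (eq_bigl (fun j => (j != k) && ~~ (k < j)%N)) // => j.
by rewrite -leqNgt ltn_neqAle.
Qed.

Lemma unit_root_ang a z : 0 < a < 2 * pi -> z \in hroots (expi a) -> cmod z = 1 ->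
  exists2 j, (j < n)%N & a = ang n j \/ a = ang d.+1 j.
Proof.
move=> /andP[a0 a2]; rewrite mem_hroots => /eqP ez z1.
have inj N : (0 < N)%N -> expi a ^+ N = 1 :> C -> exists2 j, (j < N)%N & a = ang N j.
  move=> N0 /(unity_ang N0)[j jN e]; exists j => //; apply: expi_inj e.
    by rewrite ltW.
  by rewrite ang_lt2pi // divr_ge0 // !mulr_ge0 // pi_ge0.
have [_ [[xn _]|[xn _]]] := torus_root (cmod_expi a) z1 ez.
  by have [j jn ->] := inj n isT xn; exists j => //; left.
by have [j jn ->] := inj d.+1 isT xn; exists j; [exact: ltnW|right].
Qed.

(** With no crossing in between, [Psi] minus n (n - 1) [G] is constant on the open interval, and its
    one-sided limits at l and r agree. *)
Lemma Psi_increment (G : R -> R) (l r L1 L2 : R) :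
  (forall x : R, - 20 < x < 20 -> is_derive x 1 G (Phi x)) ->
  0 <= l -> l < r -> r <= 2 * pi ->
  (forall j, ~~ (l < ang n j < r)) -> (forall j, ~~ (l < ang d.+1 j < r)) ->
  Psi a @[a --> l^'+] --> L1 -> Psi a @[a --> r^'-] --> L2 ->
  n%:R * d.+1%:R * (G r - G l) = L2 - L1.
Proof.
move=> dG l0 lr r2 h1 h2 c1 c2; have p4 := @pi_lt4 R.
set c := n%:R * d.+1%:R.
pose D u := Psi u - c * G u.
have dD u : l < u < r -> is_derive u 1 D 0.
  move=> /andP[lu ur].
  have u2 : 0 < u < 2 * pi by apply/andP; split; lra.
  have u20 : -20 < u < 20 by apply/andP; split; lra.
  have dP : is_derive u 1 Psi (c * Phi u).
    apply: Psi_derive => //; first exact: expi_eq1.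
    move=> z zr; apply/negP => /eqP z1.
    have [j _ [e|e]] := unit_root_ang u2 zr z1.
      by have := h1 j; rewrite -e lu ur.
    by have := h2 j; rewrite -e lu ur.
  apply: (is_derive_eq (is_derive1B dP (is_derive1M (is_derive1c u c) (dG u u20)))).
  by rewrite mulr0 addr0 subrr.
pose m := (l + r) / 2.
have lm : l < m by rewrite /m; lra.
have mr : m < r by rewrite /m; lra.
have Dm u : l < u < r -> D u = D m.
  move=> /andP[lu ur]; have [um|mu] := leP u m.
    by apply/esym; exact: (cst_of_derive0_oo dD).
  by apply: (cst_of_derive0_oo dD) => //; exact: ltW.
have cG (x : R) : 0 <= x <= 2 * pi -> {for x, continuous G}.
  by move=> /andP[x0 x2]; apply: (is_derive1_cvg (dG x _)); apply/andP; split; lra.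
have e1 : L1 - c * G l = D m.
  have k1 : D u @[u --> l^'+] --> L1 - c * G l.
    apply: cvgB => //; apply: cvgM; first exact: cvg_cst.
    by apply: cvg_at_right_filter; apply: cG; apply/andP; split; lra.
  have k2 : D u @[u --> l^'+] --> D m.
    have k3 : cst (D m) u @[u --> l^'+] --> D m by exact: cvg_cst.
    apply: cvg_trans k3; apply: near_eq_cvg; near=> u; rewrite /cst Dm //.
    by apply/andP; split; near: u; [exact: nbhs_right_gt|exact: nbhs_right_lt].
  by rewrite -(cvg_lim (@Rhausdorff R) k1) -(cvg_lim (@Rhausdorff R) k2).
have e2 : L2 - c * G r = D m.
  have k1 : D u @[u --> r^'-] --> L2 - c * G r.
    apply: cvgB => //; apply: cvgM; first exact: cvg_cst.
    by apply: cvg_at_left_filter; apply: cG; apply/andP; split; lra.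
  have k2 : D u @[u --> r^'-] --> D m.
    have k3 : cst (D m) u @[u --> r^'-] --> D m by exact: cvg_cst.
    apply: cvg_trans k3; apply: near_eq_cvg; near=> u; rewrite /cst Dm //.
    by apply/andP; split; near: u; [exact: nbhs_left_gt|exact: nbhs_left_lt].
  by rewrite -(cvg_lim (@Rhausdorff R) k1) -(cvg_lim (@Rhausdorff R) k2).
rewrite mulrBr; lra.
Unshelve. all: by end_near. Qed.

Lemma ang_cross N M j k : (0 < N)%N -> (0 < M)%N -> (ang N j < ang M k :> R) = (j * M < k * N)%N.
Proof.
have e L i : ang L i = 2 * pi * (i%:R / L%:R) :> R by rewrite /ang; ring.
move=> N0 M0; rewrite !e ltr_pM2l ?mulr_gt0 ?pi_gt0 // ltr_pdivrMr ?ltr0n // mulrAC.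
by rewrite ltr_pdivlMr ?ltr0n // -!natrM ltr_nat.
Qed.

(** With [belowN], this lets the ends of the period, where [Psi] tends to 0, obey the same formulas
    as the crossings. *)
Lemma above0 N : above N 0 = 0.
Proof.
rewrite /above big1 // => j _; rewrite /volc ang0 subr0.
by rewrite claus_sin0 ?sin0 // sub0r addNr.
Qed.

Lemma belowN N : (0 < N)%N -> below N N = 0.
Proof.
move=> N0; rewrite /below big1 // => j _; rewrite /volc angN //.
have -> : claus (ang N j - 2 * pi) = claus (ang N j) :> R.
  by rewrite -[LHS]claus_period subrK.
by rewrite (claus_sin0 (t := 2 * pi)) ?sub0r ?addNr // mulr_natl sin2pi.
Qed.

(** The crossings interlace: k/(n-1) < (k+1)/n < (k+1)/(n-1). This is the first half of each step,
    [step2] the second. *)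
Lemma step1 (G : R -> R) k : (k < d.+1)%N ->
  (forall x : R, - 20 < x < 20 -> is_derive x 1 G (Phi x)) ->
  n%:R * d.+1%:R * (G (ang n k.+1) - G (ang d.+1 k)) = n%:R * above n k.+1 - d.+1%:R * above d.+1 k.
Proof.
move=> kd dG; apply: Psi_increment => //.
- by rewrite divr_ge0 // !mulr_ge0 // pi_ge0.
- by rewrite ang_cross //; nia.
- by apply/ltW/ang_lt2pi.
- move=> j; apply/negP => /andP[+]; rewrite ang_cross // ang_lt // ltnS ltnNge => /negP h1 h2.
  by apply: h1; exact: leq_mul.
- move=> j; apply/negP => /andP[]; rewrite ang_lt // ang_cross // => h1; rewrite ltnNge => /negP[].
  exact: leq_mul.
- case: k kd => [|k] kd; last by have [] := @Psi_sides_n1 k.+1 kd.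
  rewrite above0 mulr0 ang0; apply: (@Psi_lim1 _ _ d0 _ _ 0) => //; [exact: cvg_within|exact: expi0|].
  near=> u; apply: expi_eq1; apply/andP; split; near: u; first exact: nbhs_right_gt.
  by apply: nbhs_right_lt; rewrite mulr_gt0 // pi_gt0.
- by have [] := @Psi_sides_n k.+1 kd.
Unshelve. all: by end_near. Qed.

Lemma step2 (G : R -> R) k : (k < d.+1)%N ->
  (forall x : R, - 20 < x < 20 -> is_derive x 1 G (Phi x)) ->
  n%:R * d.+1%:R * (G (ang d.+1 k.+1) - G (ang n k.+1)) = d.+1%:R * below d.+1 k.+1 - n%:R * below n k.+1.
Proof.
move=> kd dG; apply: Psi_increment => //.
- by rewrite divr_ge0 // !mulr_ge0 // pi_ge0.
- by rewrite ang_cross //; nia.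
- by rewrite -(@angN _ d.+1) // leNgt ang_lt // -leqNgt.
- move=> j; apply/negP => /andP[]; rewrite ang_lt // ang_cross // => h1 h2.
  by have := leq_mul h1 (leqnn d.+1); nia.
- move=> j; apply/negP => /andP[+]; rewrite ang_cross // ang_lt // ltnS => h1 h2.
  by have := leq_mul h2 (leqnn n); nia.
- by have [] := @Psi_sides_n k.+1 kd.
- move: kd; rewrite leq_eqVlt => /predU1P[->|kd]; last by have [] := @Psi_sides_n1 k.+1 kd.
  rewrite belowN // mulr0 angN //.
  apply: (@Psi_lim1 _ _ d0 _ _ (2 * pi)) => //; [exact: cvg_within|exact: expi2pi|].
  near=> u; apply: expi_eq1; apply/andP; split; near: u; last exact: nbhs_left_lt.
  by apply: nbhs_left_gt; rewrite mulr_gt0 // pi_gt0.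
Unshelve. all: by end_near. Qed.

Definition volsum N : R := \sum_(1 <= k < N) \sum_(k.+1 <= k' < N)
  vol (2 * k%:R * pi / N%:R) (2 * (k'%:R - k%:R) * pi / N%:R).

Lemma volsum_above N : volsum N = \sum_(1 <= k < N) above N k.
Proof.
apply: eq_big_nat => k /andP[k1 kN]; rewrite /above [in RHS](@big_cat_nat _ _ _ k.+1) //=.
rewrite [X in X + _]big_nat_cond [X in X + _]big1 ?add0r; last first.
  by move=> j /andP[/andP[_ jk] kj]; move: jk; rewrite ltnS leqNgt kj.
rewrite [RHS]big_nat_cond [LHS]big_nat_cond; apply: eq_big => [j|j /andP[/andP[kj _] _]].
  by rewrite andbT; case: (k < j)%N; rewrite ?andbT ?andbF.
rewrite volE; congr volc; rewrite /ang; ring.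
Qed.

(** Exchanging the two indices turns [below] into [above], and [volc] is antisymmetric. *)
Lemma volsum_below N : \sum_(1 <= k < N) below N k = - volsum N.
Proof.
rewrite volsum_above -sumrN /below /above (exchange_big_dep_nat xpredT) //=.
apply: eq_bigr => k _; rewrite -sumrN.
by apply: eq_bigr => j _; rewrite volcN.
Qed.

(** Telescoping over both families of crossings. Each volume sum occurs twice, once from each side
    of its crossings, which gives the factor 2; division by n (n - 1) leaves 1/(n - 1) and 1/n. *)
Lemma total_integral (G : R -> R) :
  (forall x : R, - 20 < x < 20 -> is_derive x 1 G (Phi x)) ->
  G (2 * pi) - G 0 = - 2 / n%:R * volsum d.+1 + 2 / d.+1%:R * volsum n.
Proof.
move=> dG.
have c0 : n%:R * d.+1%:R != 0 :> R by rewrite mulf_neq0 // pnatr_eq0.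
apply: (mulfI c0).
have -> : n%:R * d.+1%:R * (G (2 * pi) - G 0) =
   \sum_(0 <= k < d.+1) (n%:R * (above n k.+1 - below n k.+1) + d.+1%:R * (below d.+1 k.+1 - above d.+1 k)).
  have e1 : G (2 * pi) = G (ang d.+1 d.+1) by rewrite angN.
  have e0 : G 0 = G (ang d.+1 0) by rewrite ang0.
  rewrite e1 e0 -(telescope_sumr (fun k => G (ang d.+1 k))) // mulr_sumr.
  apply: eq_big_nat => k /andP[_ kd].
  have -> : G (ang d.+1 k.+1) - G (ang d.+1 k) =
    (G (ang d.+1 k.+1) - G (ang n k.+1)) + (G (ang n k.+1) - G (ang d.+1 k)) by ring.
  by rewrite mulrDr step1 // step2 //; ring.
rewrite big_split /= -!mulr_sumr !sumrB.
have sh (f : nat -> R) N : \sum_(0 <= k < N) f k.+1 = \sum_(1 <= k < N.+1) f k by rewrite big_add1.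
rewrite !sh volsum_below -volsum_above.
rewrite (big_nat_recr d.+1) //= belowN // addr0 volsum_below.
rewrite big_ltn // above0 add0r -volsum_above.
have gen (p q u v : R) : p != 0 -> q != 0 ->
    p * (v - - v) + q * (- u - u) = p * q * (- 2 / p * u + 2 / q * v).
  by move=> p0 q0; field; rewrite p0 q0.
by apply: gen; rewrite pnatr_eq0.
Qed.

End Torus.

(** * Changing an integrand at finitely many points *)

Section FiniteChange.
Context {R : realType}.
Local Notation mu := (@lebesgue_measure R).
Implicit Types (D : set R) (s : seq R) (f g : R -> \bar R).

(** One point is changed at a time, so nothing has to be known about f at the exceptional points. *)
Lemma measurable_fun_finite_change D s f g : measurable D -> measurable_fun D g ->
  (forall x, D x -> x \notin s -> f x = g x) -> measurable_fun D f.
Proof.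
move=> mD; elim: s g => [|p s IH] g mg fg.
  by apply: eq_measurable_fun mg => x; rewrite inE => Dx; rewrite fg.
apply: (IH (fun x => if x == p then f p else g x)).
  apply: measurable_fun_if => //; first exact: measurable_fun_eqr.
  by apply: measurable_funS mg.
by move=> x Dx xs; case: eqVneq => [->//|xp]; rewrite fg // in_cons negb_or xp.
Qed.

Lemma integral_finite_change D s f g : measurable D -> measurable_fun D g ->
  (forall x, D x -> x \notin s -> f x = g x) ->
  (\int[mu]_(x in D) f x = \int[mu]_(x in D) g x)%E.
Proof.
move=> mD mg fg; apply: ae_eq_integral => //.
  exact: measurable_fun_finite_change mg fg.
have cs : countable [set` s] by exact/finite_set_countable/finite_seq.
exists [set` s]; split.
- exact: countable_measurable.
- exact: countable_lebesgue_measure0.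
- move=> x /= h; apply: contrapT => xs; apply: h => Dx; apply: fg => //.
  by apply/negP.
Qed.

End FiniteChange.

(** * The Mahler measure as the integral of [Phi] *)

Section Mahler.
Context {R : realType}.
Local Notation C := R[i].
Local Notation mu := (@lebesgue_measure R).
Variable d : nat.

(** The variable y of the outer integration becomes the parameter of [hpoly], and x, integrated
    first, the variable whose roots enter Jensen's formula. *)
Lemma horner_Pd (x y : C) : (Pd R d).[x, y] = (hpoly d y).[x].
Proof.
rewrite hornerh /Pd !horner_sum; apply: eq_bigr => i _.
rewrite !horner_sum /geom (big_ord_widen d.+1) ?leq_subr // mulr_suml.
apply: eq_big => [j|j _]; first by rewrite ltn_subRL ltnS.
by rewrite hornerM hornerXn horner_exp hornerC hornerM !horner_exp hornerC hornerX mulrC.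
Qed.

Lemma jensen_seq (s : seq C) : {in s, forall z, cmod z != 1} -> exists F : R -> R,
  (forall x : R, - 20 < x < 20 -> is_derive x 1 F (ln (cmod (\prod_(z <- s) (expi x - z))))) /\
  F (2 * pi) - F 0 = 2 * pi * \sum_(z <- s | 1 < cmod z) ln (cmod z).
Proof.
elim: s => [|z s IH] hs.
  exists (fun=> 0); split => [x _|]; last by rewrite big_nil mulr0 subrr.
  by rewrite big_nil cmod1 ln1; exact: is_derive_cst.
have [F [dF eF]] := jensen_root (hs z (mem_head _ _)).
have [w ws|G [dG eG]] := IH; first by apply: hs; rewrite in_cons ws orbT.
exists (fun x => F x + G x); split => [x hx|].
  have nz w : w \in z :: s -> expi x - w != 0.
    by move=> /hs; apply: contra; rewrite subr_eq0 => /eqP <-; rewrite cmod_expi.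
  apply: (is_derive_eq (is_derive1D (dF x hx) (dG x hx))).
  rewrite big_cons cmodM lnM // posrE cmod_gt0 ?nz ?mem_head //.
  by rewrite prodf_seq_neq0; apply/allP => w ws; rewrite /= nz // in_cons ws orbT.
rewrite big_cons; have -> : F (2 * pi) + G (2 * pi) - (F 0 + G 0) =
  (F (2 * pi) - F 0) + (G (2 * pi) - G 0) by ring.
by rewrite eF eG -mulrDr; case: ifP => // _; rewrite add0r.
Qed.

Lemma inner_integral (a : R) : {in hroots d (expi a), forall z, cmod z != 1} ->
  (\int[mu]_(t in `[0%R, (2 * pi)%R]) lne (cmod (hpoly d (expi a)).[expi t])%:E)%E =
  (2 * pi * Phi d a)%:E.
Proof.
move=> hz; have [F [dF eF]] := jensen_seq hz; have p0 := @pi_gt0 R; have p4 := @pi_lt4 R.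
have pos t : 0 < cmod (hpoly d (expi a)).[expi t].
  rewrite cmod_gt0 -mem_hroots; apply/negP => /hz.
  by rewrite cmod_expi eqxx.
under eq_integral do rewrite lne_EFin //.
have -> : 2 * pi * Phi d a = F (2 * pi) - F 0 by rewrite eF /Phi /outer big_filter.
apply: (@FTC_derive R (fun t => ln (cmod (hpoly d (expi a)).[expi t]))).
- by rewrite mulr_gt0.
- apply: continuous_subspaceT => t; apply: continuous_cvg; first exact: continuous_ln.
  by apply: ccvg_cmod; apply: ccvg_hpoly; [exact: ccvg_cst|apply: ccvg_expi; exact: cvg_id].
- by move=> x /andP[x0 x2]; rewrite horner_hroots; apply: dF; apply/andP; split; lra.
Qed.

Hypothesis d0 : (0 < d)%N.

Lemma mahler_Pd (G : R -> R) :
  (forall x : R, - 20 < x < 20 -> is_derive x 1 G (Phi d x)) ->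
  ((2 * pi)%:E * mahler (Pd R d))%E = (G (2 * pi) - G 0)%:E.
Proof.
move=> dG; have p0 := @pi_gt0 R; have p4 := @pi_lt4 R.
have cPhi : continuous (fun a => 2 * pi * Phi d a : R).
  by move=> a; apply: cvgM; [exact: cvg_cst|exact: Phi_continuous].
rewrite /mahler; under eq_integral do under eq_integral do rewrite horner_Pd.
(* The exceptional angles are those where a root may lie on the circle. The range includes j = d +
   2, because [ang d.+2 d.+2] is the endpoint 2 pi. *)
rewrite (integral_finite_change (s := [seq ang d.+2 j | j <- iota 0 d.+3] ++
  [seq ang d.+1 j | j <- iota 0 d.+3]) (g := fun a => (2 * pi * Phi d a)%:E)).
- have -> : (\int[mu]_(a in `[0%R, (2 * pi)%R]) (2 * pi * Phi d a)%:E)%E =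
      (2 * pi * G (2 * pi) - 2 * pi * G 0)%:E.
    apply: (@FTC_derive R (fun a => 2 * pi * Phi d a) (fun x => 2 * pi * G x)).
    + by rewrite mulr_gt0.
    + exact: continuous_subspaceT.
    + move=> x /andP[x0 x2]; have x20 : -20 < x < 20 by apply/andP; split; lra.
      apply: (is_derive_eq (is_derive1M (is_derive1c x (2 * pi)) (dG x x20))).
      by rewrite mulr0 addr0.
  have gen (p u v : R) : p != 0 -> 2 * p * (((2 * p) ^+ 2)^-1 * (2 * p * u - 2 * p * v)) = u - v.
    by move=> q0; field.
  by rewrite -!EFinM; congr (_%:E); apply: gen; rewrite gt_eqF.
- exact: measurable_itv.
- apply/measurable_EFinP; apply: measurable_funTS; exact: continuous_measurable_fun.
move=> a aI; rewrite mem_cat negb_or => /andP[/mapP h1 /mapP h2].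
move: aI; rewrite /= in_itv /= => /andP[a0 a2].
apply: inner_integral => z zr; apply/negP => /eqP z1.
have a02 : 0 < a < 2 * pi.
  rewrite !lt_neqAle a0 a2 !andbT; apply/andP; split; apply/eqP => e; apply: h1.
    by exists 0%N; rewrite ?mem_iota // ang0.
  by exists d.+2; [rewrite mem_iota /= add0n|rewrite angN].
have [j jn [e|e]] := unit_root_ang a02 zr z1; [apply: h1|apply: h2]; exists j => //.
  by rewrite mem_iota; exact: (ltnW jn).
by rewrite mem_iota; exact: (ltnW jn).
Qed.

End Mahler.

Theorem theorem6p1 (R : realType) (d : nat) (hd : (1 <= d)%N) :
  ((2 * pi)%:E * mahler (Pd R d))%E =
  (- 2 / d.+2%:R *
     (\sum_(1 <= k < d.+1) \sum_(k.+1 <= k' < d.+1)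
        vol (2 * k%:R * pi / d.+1%:R) (2 * (k'%:R - k%:R) * pi / d.+1%:R))
   + 2 / d.+1%:R *
     (\sum_(1 <= k < d.+2) \sum_(k.+1 <= k' < d.+2)
        vol (2 * k%:R * pi / d.+2%:R) (2 * (k'%:R - k%:R) * pi / d.+2%:R)))%:E.
Proof.
have [G dG] := primitive_exists (Phi_continuous (R := R) hd).
by rewrite (mahler_Pd hd dG) (total_integral hd dG).
Qed.
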